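(* Let $n\geq3$ and let $\Omega\subset\mathbb{R}^n$ be a bounded domain with smooth boundary. Then $$|\mathbb{S}^{n-1}|\leq\int_{\partial\Omega}\left(\frac{|H|}{n-1}\right)^{n-1}d\sigma .$$ Moreover, equality holds if and only if $\Omega$ is a round ball.
   Context: $H$ is the mean curvature (sum of principal curvatures) of $\partial\Omega$ with respect to the unit normal pointing out of $\Omega$ (towards infinity), with sign such that the unit sphere $\mathbb{S}^{n-1}$ has $H=n-1$. $d\sigma$ is the Euclidean area element on $\partial\Omega$, and $|\mathbb{S}^{n-1}|$ is the area of the unit sphere. *)

(* Defs.v *)
From HB Require Import structures.
From mathcomp Require Import all_boot all_order all_algebra.
From mathcomp Require Import all_classical all_reals all_analysis.

Set Implicit Arguments.
Unset Strict Implicit.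
Unset Printing Implicit Defensive.

Import Order.TTheory GRing.Theory Num.Theory.
Import numFieldNormedType.Exports.

Local Open Scope classical_set_scope.
Local Open Scope ring_scope.

(* The library norm of 'rV[R]_n is the sup norm: it induces the usual topology
   and bounded sets, but lengths and areas need the Euclidean norm. *)
Section euclidean.
Context {R : realType} {n : nat}.
Implicit Types (u v c : 'rV[R]_n).

Definition dot u v : R := \sum_(i < n) u ord0 i * v ord0 i.

Definition enorm u : R := Num.sqrt (dot u u).

Definition eball c (r : R) : set 'rV[R]_n := [set x | enorm (x - c) < r].

Definition unit_sphere : set 'rV[R]_n := [set x | enorm x = 1].

(* Equal to -oo on the empty set. *)
Definition diam (A : set 'rV[R]_n) : \bar R :=
  ereal_sup [set (enorm (x - y))%:E | x in A & y in A].

End euclidean.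

(* Volume of the Euclidean unit ball of R^m, by the recursion
   omega_{m+2} = (2 pi / (m+2)) omega_m. *)
Fixpoint ball_volume (R : realType) (m : nat) : R :=
  match m with
  | 0 => 1
  | 1 => 2
  | m'.+2 => 2 * pi / m'.+2%:R * ball_volume R m'
  end.

Section hausdorff.
Context {R : realType} {n : nat}.
Variable m : nat.
Implicit Types (A B : set 'rV[R]_n) (d : R).

(* Volume of the m-dimensional ball with the diameter of A. With this
   normalization the m-dimensional Hausdorff measure of an m-dimensional
   C^1 submanifold is its Euclidean area. *)
Definition hausdorff_cost A : \bar R :=
  if pselect (A !=set0) then
    ((ball_volume R m / 2 ^+ m)%:E * diam A ^+ m)%E
  else 0%E.

Definition hausdorff_cover d A : set (set 'rV[R]_n)^nat :=
  [set F | A `<=` \bigcup_k F k /\ forall k, (diam (F k) <= d%:E)%E].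

Definition hausdorff_pre d A : \bar R :=
  ereal_inf [set \sum_(k <oo) hausdorff_cost (F k) | F in hausdorff_cover d A]%E.

Definition hausdorff A : \bar R :=
  ereal_sup [set hausdorff_pre d A | d in [set d : R | 0 < d]].

Local Open Scope ereal_scope.

Lemma ball_volume_ge0 k : (0 <= ball_volume R k)%R.
Proof.
suff: ((0 <= ball_volume R k) && (0 <= ball_volume R k.+1))%R by case/andP.
elim: k => [|k /andP[h1 h2]]; first by rewrite /= ler01 ler0n.
rewrite h2 /=; apply: mulr_ge0 => //; apply: divr_ge0 => //.
by apply: mulr_ge0 => //; exact: pi_ge0.
Qed.

Lemma diam_ge0 A : A !=set0 -> 0 <= diam A.
Proof.
move=> [x Ax]; apply: (@le_trans _ _ (enorm (x - x))%:E).
  by rewrite lee_fin sqrtr_ge0.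
by apply: ereal_sup_ubound; exists x => //; exists x.
Qed.

Lemma hausdorff_cost_ge0 A : 0 <= hausdorff_cost A.
Proof.
rewrite /hausdorff_cost; case: pselect => //= A0.
apply: mule_ge0; last by apply: expe_ge0; exact: diam_ge0.
by rewrite lee_fin divr_ge0// ?exprn_ge0// ball_volume_ge0.
Qed.

Lemma hausdorff_cost0 : hausdorff_cost set0 = 0.
Proof. by rewrite /hausdorff_cost; case: pselect => //= -[x []]. Qed.

Lemma hausdorff_pre_ge0 d A : 0 <= hausdorff_pre d A.
Proof.
apply: le_ereal_inf_tmp => _ [F _ <-]; apply: nneseries_ge0 => k _ _.
exact: hausdorff_cost_ge0.
Qed.

Lemma hausdorff_pre_sigma_subadditive d :
  sigma_subadditive (hausdorff_pre d).
Proof.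
move=> A; have [[i ioo]|] := pselect (exists i, hausdorff_pre d (A i) = +oo).
  rewrite (eseries_pinfty _ _ ioo) ?leey// => k _.
  by rewrite -ltNye (lt_le_trans _ (hausdorff_pre_ge0 _ _)).
rewrite -forallNE => Aoo.
suff add2e (e : {posnum R}) : hausdorff_pre d (\bigcup_k A k) <=
    \sum_(i <oo) hausdorff_pre d (A i) + e%:num%:E.
  by apply/lee_addgt0Pr => _/posnumP[].
rewrite (le_trans _ (epsilon_trick _ _ _))//; last first.
  by move=> k; exact: hausdorff_pre_ge0.
pose P k (B : (set 'rV[R]_n)^nat) := hausdorff_cover d (A k) B /\
  \sum_(j <oo) hausdorff_cost (B j) <=
  hausdorff_pre d (A k) + (e%:num / (2 ^ k.+1)%:R)%:E.
have [G PG] : {G : ((set 'rV[R]_n)^nat)^nat & forall k, P k (G k)}.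
  apply: (@choice _ _ P) => k; rewrite /P.
  have en1 : (0 < e%:num / (2 ^ k.+1)%:R)%R by [].
  have Af : hausdorff_pre d (A k) \is a fin_num.
    by rewrite ge0_fin_numE ?hausdorff_pre_ge0// ltey; exact/eqP.
  have [_ [B AB <-] xS] := lb_ereal_inf_adherent en1 Af.
  by exists B; split => //; exact/ltW.
pose c := hausdorff_cost \o uncurry G.
have c_ge0 x : 0 <= c x by exact: hausdorff_cost_ge0.
apply: (@le_trans _ _ (\esum_(i in setT) c i)).
  apply: ereal_inf_lbound => /=.
  have /card_esym/ppcard_eqP[f] := card_nat2.
  exists (uncurry G \o f).
    split => [t [i _] Ait|k].
      have [j _ Gijt] := (PG i).1.1 t Ait.
      by exists (f^-1%FUN (i, j)) => //=; rewrite invK ?inE.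
    by rewrite /=; case: (f k) => a b; exact: (PG a).1.2.
  rewrite -(esum_pred_image c _ xpredT) ?[fun=> _]set_true//.
  by rewrite image_eq.
rewrite (_ : esum _ _ = \sum_(i <oo) \sum_(j <oo) hausdorff_cost (G i j));
    last first.
  pose J : nat -> set (nat * nat) := fun i => [set (i, j) | j in setT].
  rewrite (_ : setT = \bigcup_k J k); last first.
    by rewrite predeqE => -[a b]; split => // _; exists a => //; exists b.
  rewrite esum_bigcupT /=; last 2 first.
    - apply/trivIsetP => i j _ _ ij.
      rewrite predeqE => -[k l] /=; split => //= -[] [_] _ [<-{k} _].
      by move=> [l' _] [] /esym/eqP; rewrite (negbTE ij).
    - by move=> ?; exact: c_ge0.
  rewrite -(image_id [set: nat]) -fun_true esum_pred_image//; last first.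
    by move=> k _; exact: esum_ge0.
  apply: eq_eseriesr => /= j _.
  rewrite -(esum_pred_image c (pair j) predT)//=; last first.
    by move=> ? ? _ _; exact: (@can_inj _ _ _ snd).
  by congr esum; rewrite predeqE => -[a b]; split; move=> [i _ <-]; exists i.
apply: lee_nneseries => [k _ _|k _]; last exact: (PG k).2.
by apply: nneseries_ge0 => l _ _; exact: hausdorff_cost_ge0.
Qed.

Lemma hausdorff_ge0 A : 0 <= hausdorff A.
Proof.
apply: (le_trans (hausdorff_pre_ge0 1 A)).
by apply: ereal_sup_ubound; exists 1%R => //=.
Qed.

Lemma hausdorff0 : hausdorff set0 = 0.
Proof.
apply/eqP; rewrite eq_le hausdorff_ge0 andbT.
apply: ge_ereal_sup => _ [d /= d0 <-]; apply: ereal_inf_lbound.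
exists (fun=> set0).
  split => // k; rewrite /diam (_ : [set _ | _ in _ & _ in _] = set0) ?ereal_sup0 ?leNye//.
  by rewrite -subset0 => _ [x []].
by apply: eseries0 => k _ _; exact: hausdorff_cost0.
Qed.

Lemma le_hausdorff : {homo hausdorff : A B / A `<=` B >-> A <= B}.
Proof.
move=> A B AB; apply: ge_ereal_sup => _ [d d0 <-].
apply: (@le_trans _ _ (hausdorff_pre d B)); last first.
  by apply: ereal_sup_ubound; exists d.
apply: ereal_inf_le_tmp => _ [F [BF dF] <-]; exists F => //.
by split => //; exact: subset_trans BF.
Qed.

Lemma hausdorff_sigma_subadditive : sigma_subadditive hausdorff.
Proof.
move=> F; apply: ge_ereal_sup => _ [d d0 <-].
apply: (le_trans (hausdorff_pre_sigma_subadditive _ _)).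
apply: lee_nneseries => [k _ _|k _]; first exact: hausdorff_pre_ge0.
by apply: ereal_sup_ubound; exists d.
Qed.

HB.instance Definition _ := isOuterMeasure.Build R 'rV[R]_n hausdorff
  hausdorff0 hausdorff_ge0 le_hausdorff hausdorff_sigma_subadditive.

End hausdorff.

(* The (n-1)-dimensional Hausdorff measure on R^n, as a measure on the
   sigma-algebra of its Caratheodory measurable sets. *)
Definition area (R : realType) (n : nat) :
    set (caratheodory_type (@hausdorff R n n.-1)) -> \bar R :=
  @hausdorff R n n.-1.

Arguments area R n _ : clear implicits.

HB.instance Definition _ (R : realType) (n : nat) :=
  isMeasure.Build _ _ _ (area R n)
    (caratheodory_measure0 (@hausdorff R n n.-1))
    (caratheodory_measure_ge0 (mu := @hausdorff R n n.-1))
    (caratheodory_measure_sigma_additive (mu := @hausdorff R n n.-1)).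

Section domains.
Context {R : realType} {n : nat}.
Implicit Types (U Omega : set 'rV[R]_n) (phi : 'rV[R]_n -> R) (p : 'rV[R]_n).

Definition bounded_domain Omega : Prop :=
  [/\ open Omega, connected Omega, Omega !=set0 & bounded_set Omega].

Definition boundary Omega : set 'rV[R]_n := closure Omega `\` Omega°.

Fixpoint Ck_on (k : nat) U phi : Prop :=
  match k with
  | 0 => forall x, U x -> {for x, continuous phi}
  | k'.+1 => (forall x, U x -> differentiable phi x) /\
             forall v, Ck_on k' U ('D_v phi)
  end.

Definition smooth_on U phi : Prop := forall k, Ck_on k U phi.

Definition gradient phi p : 'rV[R]_n :=
  \row_(i < n) 'D_(delta_mx ord0 i) phi p.

Definition unit_gradient phi p : 'rV[R]_n :=
  (enorm (gradient phi p))^-1 *: gradient phi p.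

(* Only used at boundary points p, where it forces phi p = 0. *)
Definition local_defining_function Omega p U phi : Prop :=
  [/\ open U, U p, smooth_on U phi,
      forall x, U x -> gradient phi x != 0 &
      forall x, U x -> (Omega x <-> phi x < 0)].

Definition smooth_boundary Omega : Prop :=
  forall p, boundary Omega p ->
  exists U phi, local_defining_function Omega p U phi.

(* Near p, unit_gradient phi extends the unit normal of the boundary pointing
   out of Omega, so its derivative at p along tangent vectors is the shape
   operator. The rows of e form an orthonormal basis of the tangent space at p,
   made of eigenvectors of the shape operator with eigenvalues the entries
   of k. *)
Definition principal_curvatures Omega p (k : 'rV[R]_n.-1) : Prop :=
  exists U phi (e : 'M[R]_(n.-1, n)),
  [/\ local_defining_function Omega p U phi,
      e *m e^T = 1%:M,
      forall i, dot (row i e) (unit_gradient phi p) = 0 &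
      forall i, 'D_(row i e) (unit_gradient phi) p = k ord0 i *: row i e].

(* All families of principal curvatures at a boundary point p have the same
   sum; the value 0 is a dummy for points without principal curvatures. *)
Definition mean_curvature Omega p : R :=
  xget 0 [set \sum_(i < n.-1) k ord0 i | k in principal_curvatures Omega p].

End domains.

(* Main.v *)
Require Import Defs.
From HB Require Import structures.
From mathcomp Require Import all_boot all_order all_algebra.
From mathcomp Require Import all_classical all_reals all_analysis.
From mathcomp Require Import measurable_realfun ring lra.
Import Order.TTheory GRing.Theory Num.Theory.
Import numFieldNormedType.Exports.
Local Open Scope classical_set_scope.
Local Open Scope ring_scope.

(* Every unit vector w is the outer normal at a point of the boundary Sigma where
   a hyperplane orthogonal to w supports Omega, so the Gauss map sends the set of
   contact points onto the unit sphere. At a contact point the principal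
   curvatures are nonnegative and the Jacobian of the Gauss map is their product,
   at most (H / (n-1))^(n-1) by AM-GM; integrating gives the inequality.

   If equality holds, the local bound is sharp at every p in Sigma, so that
   either H p = 0 or p is a contact point with equal positive principal
   curvatures. Since n - 1 >= 2, near a point p0 of the second kind the Gauss map
   u is x |-> u p0 + kappa (x - p0), so Sigma osculates a sphere of radius
   1 / kappa; the set A of points where it does is open and closed in Sigma and
   in the sphere, hence is the whole sphere. All points of A being contact points,
   Omega lies in the ball, the rest of Sigma lies inside the ball, has no contact
   point and hence has H = 0. This rest is empty: being compact, it would have a
   point farthest from a given centre, where H cannot vanish. *)

Set Implicit Arguments.
Unset Strict Implicit.
Unset Printing Implicit Defensive.

(** * Euclidean geometry *)

(** Both sides of the inequality are built from Hausdorff measure, so everything rests on how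
    [hausdorff] behaves under maps. Two estimates are used: an [L]-Lipschitz comparison costs a
    factor [L ^+ m], and on compact subsets of R^m a diagonal dilation costs at most the product of
    its factors. The Lipschitz estimate alone would bound the Gauss map by the m-th power of the
    largest principal curvature. Factoring the Gauss map, up to a constant close to 1, through the
    dilation by the principal curvatures gives their product, which is what AM-GM compares with [H].
    Normals enter through the relation [supports], so charts, which are only local, need no gluing.
    For the equality case a single point where the local estimate is not sharp must make the
    integral inequality strict: the integrand is lowered by a bump at that point and the inequality
    is proved again for the lowered function. The umbilic argument works with first-order increments
    of the normal along the boundary, read in the tangential projection. *)

Section euclid.
Context {R : realType} {n : nat}.
Implicit Types (u v w p x y : 'rV[R]_n) (a b : R).

Lemma dotE u v : dot u v = (u *m v^T) ord0 ord0.
Proof. by rewrite mxE; apply: eq_bigr => i _; rewrite mxE. Qed.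

Lemma dotC u v : dot u v = dot v u.
Proof. by apply: eq_bigr => i _; rewrite mulrC. Qed.

Lemma dotDl u v w : dot (u + v) w = dot u w + dot v w.
Proof. by rewrite -big_split; apply: eq_bigr => i _; rewrite mxE mulrDl. Qed.

Lemma dotZl a u v : dot (a *: u) v = a * dot u v.
Proof. by rewrite mulr_sumr; apply: eq_bigr => i _; rewrite mxE mulrA. Qed.

Lemma dotDr u v w : dot u (v + w) = dot u v + dot u w.
Proof. by rewrite dotC dotDl !(dotC u). Qed.

Lemma dotZr a u v : dot u (a *: v) = a * dot u v.
Proof. by rewrite dotC dotZl dotC. Qed.

Lemma dotNl u v : dot (- u) v = - dot u v.
Proof. by rewrite -scaleN1r dotZl mulN1r. Qed.

Lemma dotNr u v : dot u (- v) = - dot u v.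
Proof. by rewrite dotC dotNl dotC. Qed.

Lemma dotBl u v w : dot (u - v) w = dot u w - dot v w.
Proof. by rewrite dotDl dotNl. Qed.

Lemma dotBr u v w : dot u (v - w) = dot u v - dot u w.
Proof. by rewrite dotDr dotNr. Qed.

Lemma dot0l u : dot 0 u = 0.
Proof. by rewrite -(scale0r 0) dotZl mul0r. Qed.

Lemma dot0r u : dot u 0 = 0.
Proof. by rewrite dotC dot0l. Qed.

Lemma dot_delta u i : dot u (delta_mx ord0 i) = u ord0 i.
Proof.
rewrite /dot (bigD1 i)//= mxE !eqxx mulr1 big1 ?addr0// => j ji.
by rewrite mxE (negbTE ji) andbF mulr0.
Qed.

Lemma dot_ge0 u : 0 <= dot u u.
Proof. by apply: sumr_ge0 => i _; rewrite -expr2 sqr_ge0. Qed.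

Lemma dot_eq0 u : (dot u u == 0) = (u == 0).
Proof.
apply/eqP/eqP => [|->]; last exact: dot0l.
move/eqP; rewrite psumr_eq0 => [/allP h|i _]; last by rewrite -expr2 sqr_ge0.
apply/rowP => i; rewrite mxE; have := h i (mem_index_enum _).
by rewrite /= mulf_eq0 orbb => /eqP.
Qed.

Lemma enorm_ge0 u : 0 <= enorm u.
Proof. exact: sqrtr_ge0. Qed.

Lemma sqr_enorm u : enorm u ^+ 2 = dot u u.
Proof. by rewrite sqr_sqrtr// dot_ge0. Qed.

Lemma enorm_eq0 u : (enorm u == 0) = (u == 0).
Proof. by rewrite -dot_eq0 -sqr_enorm expf_eq0. Qed.

Lemma enorm_gt0 u : (0 < enorm u) = (u != 0).
Proof. by rewrite lt_def enorm_ge0 andbT enorm_eq0. Qed.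

Lemma enorm0 : enorm (0 : 'rV[R]_n) = 0.
Proof. by apply/eqP; rewrite enorm_eq0. Qed.

Lemma enormZ a u : enorm (a *: u) = `|a| * enorm u.
Proof.
by rewrite /enorm dotZl dotZr mulrA -expr2 sqrtrM ?sqr_ge0// sqrtr_sqr.
Qed.

Lemma enormN u : enorm (- u) = enorm u.
Proof. by rewrite -scaleN1r enormZ normrN1 mul1r. Qed.

Lemma enormB u v : enorm (u - v) = enorm (v - u).
Proof. by rewrite -enormN opprB. Qed.

(** Cauchy-Schwarz, by expanding the squared norm of [enorm v *: u - enorm u *: v]. *)
Lemma ler_dot u v : dot u v <= enorm u * enorm v.
Proof.
have [->|u0] := eqVneq u 0; first by rewrite dot0l enorm0 mul0r.
have [->|v0] := eqVneq v 0; first by rewrite dot0r enorm0 mulr0.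
have := dot_ge0 (enorm v *: u - enorm u *: v).
rewrite !(dotBl, dotBr, dotZl, dotZr) (dotC v u) -!sqr_enorm.
move: u0 v0; rewrite -!enorm_gt0.
move: (enorm u) (enorm v) (dot u v) => s t d s0 t0 h.
have : 0 <= 2 * (s * t) * (s * t - d) by apply: le_trans h _; rewrite le_eqVlt; apply/orP; left; apply/eqP; ring.
by rewrite pmulr_rge0 ?subr_ge0// !mulr_gt0.
Qed.

Lemma ler_abs_dot u v : `|dot u v| <= enorm u * enorm v.
Proof.
by rewrite ler_norml ler_dot andbT lerNl -dotNl -(enormN u) ler_dot.
Qed.

Lemma ler_enormD u v : enorm (u + v) <= enorm u + enorm v.
Proof.
rewrite -(@ler_pXn2r _ 2)// ?nnegrE ?addr_ge0 ?enorm_ge0//.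
rewrite sqr_enorm !(dotDl, dotDr) (dotC v u) -!sqr_enorm.
by have := ler_dot u v; move: (enorm u) (enorm v) (dot u v) => s t d h; nra.
Qed.

Lemma ler_enormB u v : enorm (u - v) <= enorm u + enorm v.
Proof. by rewrite -(enormN v) ler_enormD. Qed.

Lemma ler_enorm_dist w u v : enorm (u - v) <= enorm (u - w) + enorm (w - v).
Proof. by rewrite -(subrKA w) ler_enormD. Qed.

Lemma ler_dist_enorm u v : `|enorm u - enorm v| <= enorm (u - v).
Proof.
have := ler_enormD (u - v) v; have := ler_enormD (v - u) u.
rewrite !subrK (enormB v) ler_norml => h1 h2; apply/andP; split; lra.
Qed.

Lemma coord_le_enorm u i : `|u ord0 i| <= enorm u.
Proof.
rewrite -(@ler_pXn2r _ 2)// ?nnegrE ?enorm_ge0// sqr_enorm real_normK ?num_real//.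
rewrite /dot (bigD1 i)//= expr2 lerDl sumr_ge0// => j _.
by rewrite -expr2 sqr_ge0.
Qed.

Lemma enorm_delta i : enorm (delta_mx ord0 i : 'rV[R]_n) = 1.
Proof. by rewrite /enorm dot_delta mxE !eqxx sqrtr1. Qed.

Lemma ler_enorm_sum (I : Type) (r : seq I) (P : pred I) (f : I -> 'rV[R]_n) :
  enorm (\sum_(i <- r | P i) f i) <= \sum_(i <- r | P i) enorm (f i).
Proof.
elim/big_rec2 : _ => [|i s t _ h]; first by rewrite enorm0.
by apply: le_trans (ler_enormD _ _) _; rewrite lerD2l.
Qed.

Lemma enorm_le_sum u : enorm u <= \sum_i `|u ord0 i|.
Proof.
rewrite {1}(row_sum_delta u); apply: le_trans (ler_enorm_sum _ _ _) _.
by apply: ler_sum => i _; rewrite enormZ enorm_delta mulr1.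
Qed.

Lemma enorm_le_bound u a : (forall i, `|u ord0 i| <= a) -> enorm u <= n%:R * a.
Proof.
move=> h; apply: le_trans (enorm_le_sum u) _.
apply: le_trans (ler_sum _ (fun i _ => h i)) _.
by rewrite sumr_const card_ord mulr_natl.
Qed.

Lemma norm_le_enorm u : `|u| <= enorm u.
Proof.
rewrite [`|u|]mx_normrE; elim/big_rec : _ => [|[i j] s _ h]; first exact: enorm_ge0.
by rewrite ge_max h andbT/= ord1 coord_le_enorm.
Qed.

Lemma enorm_le_norm u : enorm u <= n%:R * `|u|.
Proof.
apply: enorm_le_bound => i; rewrite [`|u|]mx_normrE.
exact: (le_bigmax_cond _ (fun ij : 'I_1 * 'I_n => `|u ij.1 ij.2|) (j := (ord0, i))).
Qed.

Lemma nbhs_enormP p (A : set 'rV[R]_n) :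
  nbhs p A <-> exists2 r, 0 < r & eball p r `<=` A.
Proof.
split=> [/nbhs_ballP[r /= r0 h]|[r r0 h]].
  exists r => // x; rewrite /eball/= => xp; apply: h.
  rewrite -ball_normE/= distrC; exact: le_lt_trans (norm_le_enorm _) xp.
(* The factor [n] between the two norms is replaced by [n.+1], which is nonzero in every
   dimension. *)
apply/nbhs_ballP; exists (r / n.+1%:R) => /=; first by rewrite divr_gt0.
move=> x; rewrite -ball_normE/= distrC ltr_pdivlMr// mulrC => xp; apply: h.
apply: le_lt_trans xp; apply: le_trans (enorm_le_norm _) _.
by rewrite ler_wpM2r// ler_nat.
Qed.

Lemma nbhs_eball p r : 0 < r -> nbhs p (eball p r).
Proof. by move=> r0; apply/nbhs_enormP; exists r. Qed.

Lemma open_enormP (A : set 'rV[R]_n) :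
  open A <-> forall p, A p -> exists2 r, 0 < r & eball p r `<=` A.
Proof.
rewrite openE; split=> h p Ap; first by apply/nbhs_enormP; exact: h.
by apply/nbhs_enormP; exact: h.
Qed.

Lemma closure_enormP (A : set 'rV[R]_n) p :
  closure A p <-> forall r, 0 < r -> exists2 x, A x & enorm (x - p) < r.
Proof.
split=> [h r r0|h B /nbhs_enormP[r r0 rB]].
  by have [x [Ax xr]] := h _ (nbhs_eball p r0); exists x.
by have [x Ax xr] := h r r0; exists x; split => //; exact: rB.
Qed.

Lemma eball_center p r : 0 < r -> eball p r p.
Proof. by move=> r0; rewrite /eball/= subrr enorm0. Qed.

Lemma open_eball p r : open (eball p r).
Proof.
apply/open_enormP => x xp; exists (r - enorm (x - p)); first by rewrite subr_gt0.
move=> y; rewrite /eball/= => yx; apply: le_lt_trans (ler_enorm_dist x _ _) _.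
by rewrite -ltrBrDr.
Qed.

Lemma continuous_enormP (U : pseudoMetricNormedZmodType R) (f : 'rV[R]_n -> U) p :
  {for p, continuous f} <->
  forall e, 0 < e -> exists2 d, 0 < d & forall x, enorm (x - p) < d -> `|f x - f p| < e.
Proof.
have FF : Filter (nbhs p) by exact: nbhs_filter.
split=> [/cvgrPdist_lt h e e0|h].
  have /nbhs_enormP[d d0 hd] := h e e0; exists d => // x xp.
  by rewrite distrC; exact: (hd x xp).
apply/cvgrPdist_lt => e e0; have [d d0 hd] := h e e0.
by apply/nbhs_enormP; exists d => // x xp; rewrite /= distrC; exact: hd.
Qed.

Lemma dot_continuous u : continuous (dot u : 'rV[R]_n -> R).
Proof.
move=> p; apply/continuous_enormP => e e0.
exists (e / (enorm u + 1)); first by rewrite divr_gt0// ltr_wpDl// enorm_ge0.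
move=> x; rewrite ltr_pdivlMr ?ltr_wpDl ?enorm_ge0// => xp.
rewrite -dotBr; apply: le_lt_trans (ler_abs_dot _ _) _; apply: le_lt_trans xp.
by rewrite mulrC ler_wpM2l ?enorm_ge0// lerDl.
Qed.

Lemma closed_enormP (A : set 'rV[R]_n) :
  closed A <-> forall p, (forall r, 0 < r -> exists2 x, A x & enorm (x - p) < r) -> A p.
Proof.
by split=> [cA p /closure_enormP/cA//|h p /closure_enormP/h].
Qed.

Lemma bounded_enormP (A : set 'rV[R]_n) :
  bounded_set A <-> exists M, forall x, A x -> enorm x <= M.
Proof.
split=> [[M [_ h]]|[M h]].
  exists (n%:R * (M + 1)) => x Ax; apply: le_trans (enorm_le_norm x) _.
  by rewrite ler_wpM2l//; apply: (h (M + 1)) => //; rewrite ltrDl.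
exists M; split; first exact: num_real.
move=> x Mx y Ay; apply: le_trans (norm_le_enorm y) _.
by apply: le_trans (h _ Ay) _; exact: ltW.
Qed.

Lemma compact_closed_bounded (A : set 'rV[R]_n) (M : R) : closed A ->
  (forall x, A x -> enorm x <= M) -> compact A.
Proof.
by move=> cA bA; apply: bounded_closed_compact => //; apply/bounded_enormP; exists M.
Qed.

End euclid.

Section frames.
Context {R : realType} {k n : nat}.
Implicit Types (e : 'M[R]_(k, n)) (x y : 'rV[R]_n).

Lemma dot_mul_tr e (u : 'rV[R]_k) x : dot (u *m e) x = dot u (x *m e^T).
Proof. by rewrite !dotE trmx_mul trmxK mulmxA. Qed.

Lemma mul_trE e x i : (x *m e^T) ord0 i = dot x (row i e).
Proof. by rewrite mxE; apply: eq_bigr => j _; rewrite !mxE. Qed.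

Lemma dot_frame e (u v : 'rV[R]_k) : e *m e^T = 1%:M ->
  dot (u *m e) (v *m e) = dot u v.
Proof. by move=> h; rewrite dot_mul_tr -mulmxA h mulmx1. Qed.

Lemma enorm_frame e (u : 'rV[R]_k) : e *m e^T = 1%:M ->
  enorm (u *m e) = enorm u.
Proof. by move=> h; rewrite /enorm dot_frame. Qed.

Lemma enorm_proj_le e x : e *m e^T = 1%:M -> enorm (x *m e^T) <= enorm x.
Proof.
move=> h; have [->|x0] := eqVneq (x *m e^T) 0; first by rewrite enorm0 enorm_ge0.
have : enorm (x *m e^T) ^+ 2 <= enorm (x *m e^T) * enorm x.
  rewrite sqr_enorm -dot_mul_tr; apply: le_trans (ler_dot _ _) _.
  by rewrite enorm_frame.
by rewrite expr2 ler_pM2l// enorm_gt0.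
Qed.

Lemma dot_rows e i j : e *m e^T = 1%:M -> dot (row i e) (row j e) = (i == j)%:R.
Proof. by move=> h; rewrite -mul_trE -row_mul h !mxE. Qed.

Lemma enorm_row e i : e *m e^T = 1%:M -> enorm (row i e) = 1.
Proof. by move=> h; rewrite /enorm dot_rows// eqxx sqrtr1. Qed.

End frames.

Section hyperplane_frames.
Context {R : realType} {m : nat}.
Implicit Types (e : 'M[R]_(m, m.+1)) (x u : 'rV[R]_m.+1).

(** Stacking [u] on [e] gives a square matrix with orthonormal rows. A right inverse of a square
    matrix is also a left inverse, and that identity, split into blocks, is the decomposition. *)
Lemma frame_decomp e u x : e *m e^T = 1%:M ->
  (forall i, dot (row i e) u = 0) -> enorm u = 1 ->
  x = x *m e^T *m e + dot x u *: u.
Proof.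
move=> he hu u1; pose A : 'M[R]_(1 + m) := col_mx u e.
have ue0 : u *m e^T = 0.
  by apply/rowP => i; rewrite mul_trE dotC hu mxE.
have uu : u *m u^T = 1%:M.
  by apply/matrixP => i j; rewrite !ord1 -dotE -sqr_enorm u1 expr1n mxE eqxx.
have AA : A *m A^T = 1%:M.
  rewrite tr_col_mx mul_col_row uu ue0 he -[e *m u^T]trmxK trmx_mul trmxK ue0 trmx0.
  by rewrite -scalar_mx_block.
have := mulmx1C AA; rewrite tr_col_mx mul_row_col => h.
rewrite -{1}(mulmx1 x) -h mulmxDr addrC !mulmxA; congr (_ + _).
have -> : x *m u^T = (dot x u)%:M.
  by apply/matrixP => i j; rewrite !ord1 -dotE mxE eqxx mulr1n.
by rewrite mul_scalar_mx.
Qed.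

Lemma frame_pythagoras e u x : e *m e^T = 1%:M ->
  (forall i, dot (row i e) u = 0) -> enorm u = 1 ->
  enorm x ^+ 2 = enorm (x *m e^T) ^+ 2 + dot x u ^+ 2.
Proof.
move=> he hu u1; rewrite !sqr_enorm {1}(frame_decomp x he hu u1) dotDl dotZl.
by rewrite dot_mul_tr (dotC u) expr2.
Qed.

Lemma dot_frame_normal e u (y : 'rV[R]_m) : (forall i, dot (row i e) u = 0) ->
  dot (y *m e) u = 0.
Proof.
move=> hu; rewrite dot_mul_tr (_ : u *m _ = 0) ?dot0r//.
by apply/rowP => i; rewrite mul_trE dotC hu mxE.
Qed.

End hyperplane_frames.

(** * Spectral theorem for real symmetric matrices *)

Section spectral.
Context {R : realType}.

(** The reflection in the hyperplane orthogonal to [u - d] exchanges the two unit vectors; when they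
    coincide the identity does. *)
Lemma householder {m : nat} (u d : 'rV[R]_m) : enorm u = 1 -> enorm d = 1 ->
  exists2 P : 'M[R]_m, P *m P^T = 1%:M & d *m P = u.
Proof.
move=> u1 d1; have [w0|w0] := eqVneq (u - d) 0.
  exists 1%:M; rewrite ?trmx1 ?mulmx1//; apply/eqP.
  by rewrite eq_sym -subr_eq0 w0.
set w := u - d in w0; set s := dot w w.
have s0 : s != 0 by rewrite dot_eq0.
have ws : w *m w^T = s%:M.
  by apply/matrixP => i j; rewrite !ord1 -dotE mxE eqxx mulr1n.
pose P := 1%:M - (2 / s) *: (w^T *m w).
have PT : P^T = P by rewrite /P linearB linearZ /= trmx1 trmx_mul trmxK.
exists P.
  rewrite PT /P; have : w^T *m w *m (w^T *m w) = s *: (w^T *m w).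
    by rewrite mulmxA -(mulmxA w^T) ws mul_mx_scalar -scalemxAl.
  move: (w^T *m w) => M MM.
  have : 2 / s * (2 / s) * s = 2 / s + 2 / s by field.
  move: (2 / s) => a aas.
  rewrite mulmxBl mul1mx mulmxBr mulmx1 -scalemxAl -scalemxAr MM.
  by rewrite !scalerA aas scalerDl opprB addrK subrK.
rewrite /P mulmxBr mulmx1 -scalemxAr mulmxA.
have -> : d *m w^T = (dot d w)%:M.
  by apply/matrixP => i j; rewrite !ord1 -dotE mxE eqxx mulr1n.
have -> : dot d w = - (s / 2).
  by rewrite /s /w !(dotBr, dotBl) -!sqr_enorm u1 d1 (dotC d); field.
rewrite mul_scalar_mx scalerA (_ : _ * _ = -1) ?scaleN1r ?opprK /w ?[d + _]addrC ?subrK//.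
by field.
Qed.

(** An orthogonal matrix that sends the first basis vector to [u] has [u] as its first row, so its
    other rows span the orthogonal complement. *)
Lemma orthonormal_completion {m : nat} (u : 'rV[R]_m.+1) : enorm u = 1 ->
  exists2 e : 'M[R]_(m, m.+1), e *m e^T = 1%:M & forall i, dot (row i e) u = 0.
Proof.
move=> u1; have [P PP Pu] := householder u1 (enorm_delta ord0).
have re i : row i (row' ord0 P) = row (lift ord0 i) P.
  by apply/rowP => j; rewrite !mxE.
exists (row' ord0 P).
  apply/matrixP => i j; rewrite [LHS](_ : _ = (row i (row' ord0 P) *m (row' ord0 P)^T) ord0 j); last first.
    by rewrite -row_mul [RHS]mxE.
  by rewrite mul_trE !re dot_rows// mxE (inj_eq lift_inj).
by move=> i; rewrite re -Pu -rowE dot_rows.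
Qed.

(** Near 0 the linear term dominates. With [r = 1 / (q + 1)], the choice [t = - b * r] gives
    [b ^+ 2 * r * (q * r - 2)], which is negative unless [b] is 0. *)
Lemma affine_quadratic_ge0 (b q : R) : (forall t, 0 <= 2 * t * b + t ^+ 2 * q) ->
  b = 0.
Proof.
move=> h; apply/eqP/negPn/negP => b0.
have q0 : 0 <= q.
  by have := h 1; have := h (-1); nra.
have b2 : 0 < b ^+ 2 by rewrite exprn_even_gt0//= b0.
have q1 : 0 < (q + 1)^-1 by rewrite invr_gt0 ltr_wpDl.
have := h (- b * (q + 1)^-1).
have : q * (q + 1)^-1 <= 1 by rewrite ler_pdivrMr ?mul1r ?lerDl// ltr_wpDl.
move: (q + 1)^-1 q1 => r r0 qr.
rewrite [X in 0 <= X](_ : _ = b ^+ 2 * r * (q * r - 2)); last by ring.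
by rewrite pmulr_rge0 ?(mulr_gt0 b2 r0)// => h2; lra.
Qed.

Lemma sphere_compact {m : nat} : compact (@unit_sphere R m).
Proof.
apply: (@compact_closed_bounded _ _ _ 1) => [|x /= ->//].
apply/closed_enormP => p h /=; apply/eqP; rewrite -subr_eq0 -normr_le0.
apply/ler_addgt0Pr => e e0; rewrite add0r.
have [x /= x1 xp] := h e e0; rewrite -x1 distrC.
by apply: le_trans (ler_dist_enorm _ _) _; exact: ltW.
Qed.

Lemma quadratic_form_continuous {m : nat} (A : 'M[R]_m) :
  continuous (fun x : 'rV[R]_m => dot (x *m A) x).
Proof.
move=> x; rewrite /continuous_at /dot.
have FF : Filter (nbhs x) by exact: nbhs_filter.
apply: cvg_big => [y|i _]; first exact: add_continuous.
apply: cvgM; last exact: coord_continuous.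
under eq_fun do rewrite mxE.
rewrite mxE; apply: cvg_big => [y|j _]; first exact: add_continuous.
by apply: cvgM; [exact: coord_continuous|exact: cvg_cst].
Qed.

(** [u] maximizes the quadratic form on the unit sphere and [l] is the maximum. Moving [u] along the
    residual [u *m A - l *: u] changes the form, to first order, by twice the squared norm of the
    residual, so the residual vanishes. *)
Lemma symmetric_eigenvector {m : nat} (A : 'M[R]_m.+1) : A^T = A ->
  exists u l, enorm u = 1 /\ u *m A = l *: u.
Proof.
move=> AT.
have S0 : (@unit_sphere R m.+1) !=set0.
  by exists (delta_mx ord0 ord0); rewrite /unit_sphere/= enorm_delta.
have [u us umax] := @EVT_max_rV _ _ (fun x => dot (x *m A) x) _ S0 sphere_compact
  (continuous_subspaceT (@quadratic_form_continuous _ A)).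
have u1 : enorm u = 1 by move: us; rewrite inE.
set l := dot (u *m A) u in umax.
have ub v : dot (v *m A) v <= l * dot v v.
  have [->|v0] := eqVneq v 0; first by rewrite !dot0r mulr0.
  have ev : enorm v != 0 by rewrite enorm_eq0.
  have := umax ((enorm v)^-1 *: v).
  rewrite inE /unit_sphere/= enormZ ger0_norm ?invr_ge0 ?enorm_ge0//.
  rewrite mulVf// => /(_ erefl); rewrite -scalemxAl dotZl dotZr mulrA.
  rewrite -sqr_enorm -expr2 exprVn mulrC ler_pdivrMr//.
  by rewrite exprn_gt0// lt_def ev enorm_ge0.
have symA v w : dot (v *m A) w = dot (w *m A) v.
  by rewrite dot_mul_tr AT dotC.
exists u, l; split=> //; apply/eqP; rewrite -subr_eq0 -dot_eq0; apply/eqP.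
have [v vE] : exists v, u *m A - l *: u = v by exists (u *m A - l *: u).
rewrite vE; pose q := l * dot v v - dot (v *m A) v.
suff h t : 0 <= 2 * t * (- dot v v) + t ^+ 2 * q.
  by apply/eqP; rewrite -oppr_eq0; apply/eqP/(affine_quadratic_ge0 h).
have := ub (u + t *: v); rewrite -subr_ge0 mulmxDl -scalemxAl.
rewrite !(dotDl, dotDr, dotZl, dotZr) (symA v u) (dotC v u) -(sqr_enorm u) u1 -/l.
have -> : dot (u *m A) v = dot v v + l * dot u v.
  by rewrite -[u *m A](subrK (l *: u)) vE dotDl dotZl.
rewrite /q => h; apply: le_trans h _; rewrite le_eqVlt; apply/orP; left.
apply/eqP; ring.
Qed.

(** The orthogonal complement of an eigenvector is invariant under [A], so the induction hypothesis
    applies to the compression [e *m A *m e^T] of [A] to it. *)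
Lemma symmetric_diagonalizable {n : nat} (A : 'M[R]_n) : A^T = A ->
  exists (Q : 'M[R]_n) (k : 'rV[R]_n), Q *m Q^T = 1%:M /\
    forall i, row i Q *m A = k ord0 i *: row i Q.
Proof.
elim: n A => [|m IH] A AT.
  by exists 1%:M, 0; split=> [|[]//]; rewrite trmx1 mulmx1.
have [u [l [u1 ul]]] := symmetric_eigenvector AT.
have [e ee eu] := orthonormal_completion u1.
have [|Q [k [QQ Qk]]] := IH (e *m A *m e^T).
  by rewrite !trmx_mul trmxK AT mulmxA.
have ue0 : u *m e^T = 0 by apply/rowP => i; rewrite mul_trE dotC eu mxE.
have eu0 : e *m u^T = 0 by apply: trmx_inj; rewrite trmx_mul trmxK ue0 trmx0.
have uu : u *m u^T = 1%:M.
  by apply/matrixP => i j; rewrite !ord1 -dotE -sqr_enorm u1 expr1n mxE eqxx.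
exists (col_mx u (Q *m e) : 'M[R]_(1 + m)); exists (row_mx l%:M k : 'rV[R]_(1 + m)).
split.
  rewrite [LHS](_ : _ = col_mx u (Q *m e) *m (col_mx u (Q *m e))^T)//.
  rewrite tr_col_mx mul_col_row uu trmx_mul mulmxA ue0 mul0mx.
  rewrite -(mulmxA Q e u^T) eu0 mulmx0.
  by rewrite mulmxA -(mulmxA Q) ee mulmx1 QQ -scalar_mx_block.
move=> i; case: (split_ordP (i : 'I_(1 + m))) => j -> {i}.
  rewrite (row_mxEl (l%:M : 'M[R]_1)) [row _ _](_ : _ = row j u); last first.
    exact: (rowKu _ u (Q *m e)).
  by rewrite ord1 mxE eqxx (_ : row ord0 u = u)//; apply/rowP => i; rewrite mxE.
rewrite (row_mxEr (l%:M : 'M[R]_1)) [row _ _](_ : _ = row j (Q *m e)); last first.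
  exact: (rowKd _ u (Q *m e)).
rewrite row_mul; set y := row j Q.
rewrite {1}(frame_decomp (y *m e *m A) ee eu u1).
rewrite (_ : dot _ u = 0) ?scale0r ?addr0; last first.
  by rewrite dot_mul_tr AT ul dotZr dot_frame_normal// mulr0.
by rewrite -[y *m e *m A]mulmxA -(mulmxA y) Qk -scalemxAl.
Qed.

End spectral.

(** * Hausdorff measure *)

Section hausdorff_covers.
Context {R : realType}.
Local Open Scope ereal_scope.

Lemma diam_ub {n : nat} (A : set 'rV[R]_n) x y : A x -> A y ->
  (enorm (x - y))%:E <= diam A.
Proof. by move=> Ax Ay; apply: ereal_sup_ubound; exists x => //; exists y. Qed.

Lemma diam_le {n : nat} (A : set 'rV[R]_n) (M : \bar R) :
  (forall x y, A x -> A y -> (enorm (x - y))%:E <= M) -> diam A <= M.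
Proof. by move=> h; apply: ge_ereal_sup => _ [x Ax [y Ay <-]]; exact: h. Qed.

Lemma diam0 {n : nat} : diam (set0 : set 'rV[R]_n) = -oo.
Proof. by apply/eqP; rewrite eq_le leNye andbT; apply: diam_le. Qed.

Lemma le_expe (x y : \bar R) m : 0 <= x -> x <= y -> x ^+ m <= y ^+ m.
Proof.
move=> x0 xy; elim: m => [//|m IH]; rewrite !expeS; apply: lee_pmul => //.
exact: expe_ge0.
Qed.

Lemma mule_expe (x y : \bar R) m : (x * y) ^+ m = x ^+ m * y ^+ m.
Proof. by elim: m => [|m IH]; rewrite ?expe0 ?mule1// !expeS IH muleACA. Qed.

Lemma hausdorff_costE {n : nat} m (A : set 'rV[R]_n) : A !=set0 ->
  hausdorff_cost m A = (ball_volume R m / 2 ^+ m)%:E * diam A ^+ m.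
Proof. by move=> A0; rewrite /hausdorff_cost; case: pselect. Qed.

Lemma ball_volume_gt0 m : (0 < ball_volume R m)%R.
Proof.
suff: ((0 < ball_volume R m) && (0 < ball_volume R m.+1))%R by case/andP.
elim: m => [|k /andP[h1 h2]]; first by rewrite /= ltr01 ltr0n.
by rewrite h2 /= !mulr_gt0// ?invr_gt0// pi_gt0.
Qed.

Lemma hausdorff_cost_scale {n k : nat} m (A : set 'rV[R]_n) (B : set 'rV[R]_k)
    (L : R) : (0 <= L)%R -> (A !=set0 -> B !=set0) ->
  (A !=set0 -> diam A <= L%:E * diam B) ->
  hausdorff_cost m A <= (L ^+ m)%:E * hausdorff_cost m B.
Proof.
move=> L0 AB dAB; have [A0|/set0P/negP/negPn/eqP->] := pselect (A !=set0);
    last first.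
  by rewrite hausdorff_cost0 mule_ge0 ?hausdorff_cost_ge0// lee_fin exprn_ge0.
rewrite !hausdorff_costE ?AB//; last exact: AB.
rewrite muleCA lee_pmul ?lee_fin ?divr_ge0 ?exprn_ge0 ?ball_volume_ge0//.
  by apply: expe_ge0; exact: diam_ge0.
rewrite EFin_expe -mule_expe; apply: le_expe; [exact: diam_ge0|exact: dAB].
Qed.

(* The maps are compared with each other rather than composed, so that neither
   has to be injective. *)
Lemma le_hausdorff_lipschitz {T : Type} {n k : nat} m (f : T -> 'rV[R]_n)
    (h : T -> 'rV[R]_k) (A : set T) (L : R) : (0 < L)%R ->
  (forall x y, A x -> A y -> (enorm (f x - f y) <= L * enorm (h x - h y))%R) ->
  hausdorff m (f @` A) <= (L ^+ m)%:E * hausdorff m (h @` A).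
Proof.
move=> L0 fh; apply: ge_ereal_sup => _ [d /= d0 <-].
have Lm0 : (0 < L ^+ m)%R by rewrite exprn_gt0.
have dL : (0 < d / L)%R by rewrite divr_gt0.
apply: (@le_trans _ _ ((L ^+ m)%:E * hausdorff_pre m (d / L) (h @` A))); last first.
  rewrite lee_pmul2l ?lte_fin//.
  by apply: ereal_sup_ubound; exists (d / L)%R.
rewrite -lee_pdivrMl//; apply: le_ereal_inf_tmp => _ [F [hF dF] <-].
rewrite lee_pdivrMl// -nneseriesZl; last by move=> *; exact: hausdorff_cost_ge0.
pose G i := f @` (A `&` h @^-1` F i).
have GF i : G i !=set0 -> diam (G i) <= L%:E * diam (F i).
  move=> _; apply: diam_le => _ _ [x [Ax Fx] <-] [y [Ay Fy] <-].
  apply: (@le_trans _ _ (L * enorm (h x - h y))%:E); first by rewrite lee_fin fh.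
  by rewrite EFinM lee_pmul2l ?lte_fin//; exact: diam_ub.
have G0 i : G i !=set0 -> F i !=set0 by move=> [_ [x [_ Fx] _]]; exists (h x).
apply: (@le_trans _ _ (\sum_(i <oo) hausdorff_cost m (G i))).
  apply: ereal_inf_lbound; exists G => //; split=> [_ [x Ax <-]|i].
    have [|i _ Fi] := hF (h x); first by exists x.
    by exists i => //; exists x.
  have [Gi|/set0P/negP/negPn/eqP->] := pselect (G i !=set0);
    last by rewrite diam0 leNye.
  apply: (le_trans (GF i Gi)); rewrite -lee_pdivlMl// -EFinM mulrC.
  exact: dF.
apply: lee_nneseries => [i _ _|i _]; first exact: hausdorff_cost_ge0.
by apply: hausdorff_cost_scale (GF i) => //; [exact: ltW|exact: G0].
Qed.

End hausdorff_covers.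

(** * Hausdorff measure as a metric outer measure, and measurability of closed sets *)

Section metric_outer_measure.
Context {R : realType} {n m : nat}.
Local Open Scope ereal_scope.
Implicit Types A B X : set 'rV[R]_n.
Local Notation mu := (@hausdorff R n m).

Lemma hausdorff_mono A B : A `<=` B -> mu A <= mu B.
Proof. exact: le_hausdorff. Qed.

(** A covering set of diameter at most [d] cannot meet both [A] and [B], so every cover of the union
    splits into a cover of each. *)
Lemma hausdorff_pre_setU_separated (d : R) A B : (0 < d)%R ->
  (forall x y, A x -> B y -> (d < enorm (x - y))%R) ->
  hausdorff_pre m d A + hausdorff_pre m d B <= hausdorff_pre m d (A `|` B).
Proof.
move=> d0 sep; apply: le_ereal_inf_tmp => _ [F [FAB dF] <-].
pose P i := pselect (F i `&` A !=set0).
pose FA i := if P i then F i else set0.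
pose FB i := if P i then set0 else F i.
apply: (@le_trans _ _ (\sum_(i <oo) hausdorff_cost m (FA i) +
                       \sum_(i <oo) hausdorff_cost m (FB i))).
  apply: leeD; apply: ereal_inf_lbound.
    exists FA => //; split=> [x Ax|i].
      have [|i _ Fx] := FAB x; first by left.
      by exists i => //; rewrite /FA; case: (P i) => // nP; case: nP; exists x.
    by rewrite /FA; case: (P i) => ? /=; [exact: dF|rewrite diam0 leNye].
  exists FB => //; split=> [x Bx|i].
    have [|i _ Fx] := FAB x; first by right.
    exists i => //; rewrite /FB; case: (P i) => // -[y [Fy Ay]]; exfalso.
    have := le_trans (diam_ub Fy Fx) (dF i); rewrite lee_fin leNgt.
    by rewrite sep.
  by rewrite /FB; case: (P i) => ? /=; [rewrite diam0 leNye|exact: dF].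
rewrite -nneseriesD; last 2 first.
  by move=> *; exact: hausdorff_cost_ge0.
  by move=> *; exact: hausdorff_cost_ge0.
apply: lee_nneseries => [i _ _|i _].
  by rewrite adde_ge0 ?hausdorff_cost_ge0.
by rewrite /FA /FB; case: (P i) => ? /=; rewrite hausdorff_cost0 ?adde0 ?add0e.
Qed.

Lemma le_hausdorff_pre (d d' : R) A : (d' <= d)%R ->
  hausdorff_pre m d A <= hausdorff_pre m d' A.
Proof.
move=> dd; apply: ereal_inf_le_tmp => _ [F [AF dF] <-]; exists F => //.
by split=> // i; apply: le_trans (dF i) _; rewrite lee_fin.
Qed.

Lemma hausdorff_setU_separated (d : R) A B : (0 < d)%R ->
  (forall x y, A x -> B y -> (d <= enorm (x - y))%R) ->
  mu A + mu B <= mu (A `|` B).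
Proof.
move=> d0 sep.
have [oo|fin] := eqVneq (mu (A `|` B)) +oo; first by rewrite oo leey.
have finU : mu (A `|` B) \is a fin_num.
  by rewrite ge0_fin_numE ?hausdorff_ge0// ltey.
have finS C : C `<=` A `|` B -> mu C \is a fin_num.
  move=> CAB; rewrite ge0_fin_numE ?hausdorff_ge0//.
  by apply: le_lt_trans (hausdorff_mono CAB) _; rewrite ltey.
have preS (e : R) C : (0 < e)%R -> hausdorff_pre m e C <= mu C.
  by move=> e0; apply: ereal_sup_ubound; exists e.
have finA := finS A (@subsetUl _ A B); have finB := finS B (@subsetUr _ A B).
rewrite -leeBrDr//; apply: ge_ereal_sup => _ [d1 /= d10 <-].
have fin1 : hausdorff_pre m d1 A \is a fin_num.
  rewrite ge0_fin_numE ?hausdorff_pre_ge0//.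
  by apply: le_lt_trans (preS _ _ d10) _; rewrite -ge0_fin_numE ?hausdorff_ge0.
rewrite leeBrDr// addeC -leeBrDr//; apply: ge_ereal_sup => _ [d2 /= d20 <-].
(* Halving [d] turns the weak separation into the strict one required at scale [e]; the other two
   bounds let the scales [d1] and [d2] be compared with [e]. *)
rewrite leeBrDr//; pose e := (Num.min (d / 2) (Num.min d1 d2))%R.
have e0 : (0 < e)%R by rewrite !lt_min d10 d20 divr_gt0.
apply: (@le_trans _ _ (hausdorff_pre m e A + hausdorff_pre m e B)).
  rewrite addeC; apply: leeD; apply: le_hausdorff_pre;
    by rewrite !ge_min lexx ?orbT.
apply: (le_trans (hausdorff_pre_setU_separated e0 _)); last exact: preS.
move=> x y Ax By; apply: lt_le_trans (sep x y Ax By).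
apply: (@le_lt_trans _ _ (d / 2)%R); first by rewrite ge_min lexx.
by rewrite ltr_pdivrMr// ltr_pMr// ltr1n.
Qed.

Lemma hausdorff_sum_separated (A : (set 'rV[R]_n)^nat) X N :
  (forall i, A i `<=` X) ->
  (forall N, exists2 d : R, (0 < d)%R & forall i x y, (i < N)%N -> A i x -> A N y ->
     (d <= enorm (x - y))%R) ->
  \sum_(i < N) mu (A i) <= mu X.
Proof.
move=> AX sep; apply: (@le_trans _ _ (mu (\bigcup_(i < N) A i))); last first.
  by apply: hausdorff_mono => x [i _ Aix]; exact: AX Aix.
elim: N => [|N IH]; first by rewrite big_ord0 hausdorff_ge0.
rewrite big_ord_recr /=; apply: (le_trans (leeD2r _ IH)).
have [d d0 dA] := sep N.
apply: (le_trans (hausdorff_setU_separated d0 _)).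
  by move=> x y [i /= iN Aix] ANy; exact: (dA i).
apply: hausdorff_mono => x [[i /= iN Aix]|ANx]; last by exists N => /=.
by exists i => //=; rewrite ltnS ltnW.
Qed.

Definition lipschitz1 (g : 'rV[R]_n -> R) :=
  forall x y, (g x - g y <= enorm (x - y))%R.

(* Outside C, the layers a (k+1) <= g < a k with k of a given parity are at
   positive distance from each other, so their measures have a finite sum. *)
Lemma sublevel_measurable (g : 'rV[R]_n -> R) : lipschitz1 g ->
  mu.-caratheodory [set x | (g x <= 0)%R].
Proof.
move=> g1; apply: le_caratheodory_measurable => X /=.
set C := [set x | (g x <= 0)%R].
have [->|fin] := eqVneq (mu X) +oo; first by rewrite leey.
have finX : mu X \is a fin_num by rewrite ge0_fin_numE ?hausdorff_ge0// ltey.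
pose a (k : nat) : R := (k.+1%:R^-1)%R.
have a_gt0 k : (0 < a k)%R by rewrite invr_gt0.
have a_lt j k : (j < k)%N -> (a k < a j)%R.
  by move=> jk; rewrite ltf_pV2 ?posrE// ltr_nat.
have a_le j k : (j <= k)%N -> (a k <= a j)%R.
  by move=> jk; rewrite lef_pV2 ?posrE// ler_nat.
pose Rg k := X `&` [set x | (a k.+1 <= g x < a k)%R].
pose A k := X `&` [set x | (a k <= g x)%R].
have RgX k : Rg k `<=` X by move=> x [].
have sumR2 N p : \sum_(i < N) mu (Rg (p + i.*2)%N) <= mu X.
  apply: (@hausdorff_sum_separated (fun i => Rg (p + i.*2)%N)) => [i|k]; first exact: RgX.
  case: k => [|k]; first by exists 1%R.
  exists (a (p + k.*2.+1)%N - a (p + k.+1.*2)%N)%R.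
    by rewrite subr_gt0 a_lt// ltn_add2l doubleS.
  move=> i x y ik [_ /= /andP[gx _]] [_ /= /andP[_ gy]].
  apply: le_trans (g1 x y); apply: lerB; last exact: ltW.
  apply: le_trans gx; apply: a_le.
  by rewrite addnS ltnS leq_add2l leq_double -ltnS.
have sumR N : \sum_(0 <= i < N) mu (Rg i) <= mu X + mu X.
  have R0 i : 0 <= mu (Rg i) by exact: hausdorff_ge0.
  apply: (@le_trans _ _ (\sum_(0 <= i < N.*2) mu (Rg i))).
    apply: lee_sum_nneg_natr => //; last by rewrite -addnn leq_addr.
  apply: le_trans (leeD (sumR2 N 0%N) (sumR2 N 1%N)).
  elim: N => [|N IH]; first by rewrite big_geq// !big_ord0 adde0.
  rewrite doubleS !big_nat_recr//= !big_ord_recr/= addeACA add0n add1n.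
  by rewrite -[leLHS]addeA; apply: leeD IH _.
have cvR : \sum_(i <oo) mu (Rg i) \is a fin_num.
  rewrite ge0_fin_numE; last by apply: nneseries_ge0 => *; exact: hausdorff_ge0.
  apply: (@le_lt_trans _ _ (mu X + mu X)); last by rewrite -ge0_fin_numE ?fin_numD ?finX ?adde_ge0 ?hausdorff_ge0.
  apply: lime_le; last by apply: nearW => N; exact: sumR.
  by apply: is_cvg_nneseries => *; exact: hausdorff_ge0.
(* [A k] is at distance at least [a k] from [C], so its measure adds to that of [X] in [C]. What it
   misses outside [C] lies in the layers of index at least [k], and the tail of their convergent
   series tends to 0. *)
have tail k : mu (X `&` ~` C) <= mu (A k) + \sum_(k <= i <oo) mu (Rg i).
  have sub : X `&` ~` C `<=` A k `|` \bigcup_(i in [set i | (k <= i)%N]) Rg i.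
    move=> x [Xx /= /negP]; rewrite -ltNge => gx.
    have [h|h] := leP (a k) (g x); [by left|right].
    have [N Na] : exists N, (a N <= g x)%R.
      exists (Num.trunc (g x)^-1).
      rewrite /a invf_ple ?posrE//; apply/ltW; exact: truncnS_gt.
    have ex : exists N, (a N <= g x)%R by exists N.
    case: (ex_minnP ex) => [[|M]] aM Mmin.
      by move: h; rewrite ltNge (le_trans _ aM)// a_le.
    exists M => /=; last first.
      split=> //=; rewrite aM /= ltNge; apply/negP => /Mmin; by rewrite ltnn.
    rewrite leqNgt; apply/negP => Mk; move: h; rewrite ltNge => /negP; apply.
    apply: le_trans aM; exact: a_le.
  apply: (le_trans (hausdorff_mono sub)).
  apply: (le_trans (outer_measureU2 mu _ _)); apply: leeD2l.
  have -> : [set i | (k <= i)%N] = ~` `I_k.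
    by apply/seteqP; split=> i /=; [rewrite leqNgt => /negP|move/negP; rewrite -leqNgt].
  exact: outer_measure_sigma_subadditive_tail.
have main k : mu (X `&` C) + mu (A k) <= mu X.
  apply: (le_trans (hausdorff_setU_separated (a_gt0 k) _)); last first.
    by apply: hausdorff_mono => x [[]|[]].
  move=> x y [_ /= gx] [_ /= gy]; rewrite enormB; apply: le_trans (g1 _ _).
  by apply: le_trans gy _; rewrite lerDl oppr_ge0.
apply/lee_addgt0Pr => e e0.
have : (fun k => \sum_(k <= i <oo) mu (Rg i)) @ \oo --> 0.
  apply: nneseries_tail_cvg => [|*]; last exact: hausdorff_ge0.
  by rewrite -ge0_fin_numE//; apply: nneseries_ge0 => *; exact: hausdorff_ge0.
move=> /fine_cvgP[_ /cvgrPdist_lt /(_ e e0)] [N _ hN].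
have := hN N (leqnn N); rewrite /= sub0r normrN => eN.
have tf : \sum_(N <= i <oo) mu (Rg i) \is a fin_num.
  rewrite ge0_fin_numE; last by apply: nneseries_ge0 => *; exact: hausdorff_ge0.
  apply: le_lt_trans (_ : \sum_(i <oo) mu (Rg i) < +oo); last first.
    by rewrite -ge0_fin_numE//; apply: nneseries_ge0 => *; exact: hausdorff_ge0.
  rewrite [leRHS](nneseries_split 0 N); last by move=> *; exact: hausdorff_ge0.
  by rewrite add0n leeDr// sume_ge0// => *; exact: hausdorff_ge0.
apply: (@le_trans _ _ (mu (X `&` C) + (mu (A N) + \sum_(N <= i <oo) mu (Rg i)))).
  by rewrite leeD2l.
rewrite addeA; apply: leeD; first exact: main.
rewrite -(fineK tf) lee_fin; apply: le_trans (ler_norm _) _; exact: ltW.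
Qed.

End metric_outer_measure.

Section edist.
Context {R : realType} {n : nat}.
Implicit Types (C : set 'rV[R]_n) (x y : 'rV[R]_n).

Definition edist C x : R := inf [set enorm (x - y) | y in C].

Lemma edist_le C x y : C y -> edist C x <= enorm (x - y).
Proof.
move=> Cy; apply: ge_inf; last by exists y.
by exists 0 => _ [z _ <-]; exact: enorm_ge0.
Qed.

Lemma edist_lt C x (a : R) : C !=set0 -> edist C x < a ->
  exists2 y, C y & enorm (x - y) < a.
Proof.
move=> [z Cz]; rewrite -subr_gt0 => ax.
have [|_ [y Cy <-]] := inf_adherent ax (_ : has_inf [set enorm (x - y) | y in C]).
  split; first by exists (enorm (x - z)), z.
  by exists 0 => _ [y _ <-]; exact: enorm_ge0.
by rewrite -/(edist C x) subrKC => h; exists y.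
Qed.

Lemma edist_lipschitz1 C : C !=set0 -> lipschitz1 (edist C).
Proof.
move=> C0 x y; rewrite lerBlDr; apply/ler_addgt0Pr => e e0.
have [|z Cz yz] := @edist_lt C y (edist C y + e) C0; first by rewrite ltrDl.
apply: le_trans (edist_le x Cz) _; apply: le_trans (ler_enorm_dist y _ _) _.
by rewrite -addrA lerD2l ltW.
Qed.

Lemma edist_le0 C : closed C -> C !=set0 -> [set x | edist C x <= 0] = C.
Proof.
move=> cC C0; apply/seteqP; split=> x /= h.
  move/closed_enormP: cC; apply=> r r0.
  have [|y Cy xy] := @edist_lt C x r C0; first exact: le_lt_trans r0.
  by exists y => //; rewrite enormB.
by apply: le_trans (edist_le x h) _; rewrite subrr enorm0.
Qed.

End edist.

Section borel_measurable.
Context {R : realType} {n m : nat}.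
Local Notation mu := (@hausdorff R n m).

Lemma closed_caratheodory (C : set 'rV[R]_n) : closed C -> mu.-caratheodory C.
Proof.
move=> cC; have [C0|/set0P/negP/negPn/eqP->] := pselect (C !=set0).
  rewrite -(edist_le0 cC C0); apply: sublevel_measurable.
  exact: edist_lipschitz1.
exact: caratheodory_measurable_set0.
Qed.

Lemma open_caratheodory (C : set 'rV[R]_n) : open C -> mu.-caratheodory C.
Proof.
move=> oC; rewrite -(setCK C); apply: caratheodory_measurable_setC.
by apply: closed_caratheodory; exact: open_closedC.
Qed.

Lemma compact_caratheodory (C : set 'rV[R]_n) : compact C -> mu.-caratheodory C.
Proof.
by move=> cC; apply: closed_caratheodory; exact: compact_closed.
Qed.

Definition hausdorff_measure : set (caratheodory_type mu) -> \bar R := mu.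

HB.instance Definition _ := isMeasure.Build _ _ _ hausdorff_measure
  (caratheodory_measure0 mu) (caratheodory_measure_ge0 (mu := mu))
  (caratheodory_measure_sigma_additive (mu := mu)).

Lemma hausdorff_cvg_increasing (F : (set 'rV[R]_n)^nat) :
  (forall i, mu.-caratheodory (F i)) -> (forall i j, (i <= j)%N -> F i `<=` F j) ->
  mu (F i) @[i --> \oo] --> mu (\bigcup_i F i).
Proof.
move=> mF homF.
apply: (@nondecreasing_cvg_mu _ _ _ hausdorff_measure F); first exact: mF.
  by apply: bigcup_measurable => k _; exact: mF.
by move=> i j ij; apply/subsetPset; exact: homF.
Qed.

Lemma hausdorff_cvg_decreasing (F : (set 'rV[R]_n)^nat) :
  (mu (F 0%N) < +oo)%E ->
  (forall i, mu.-caratheodory (F i)) -> (forall i j, (i <= j)%N -> F j `<=` F i) ->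
  mu (F i) @[i --> \oo] --> mu (\bigcap_i F i).
Proof.
move=> F0 mF homF.
apply: (@nonincreasing_cvg_mu _ _ _ hausdorff_measure F); [exact: F0|exact: mF| |].
  by apply: bigcap_measurable => // k _; exact: mF.
by move=> i j ij; apply/subsetPset; exact: homF.
Qed.

End borel_measurable.

Section finite_unions.
Context {R : realType} {T : Type} (mu : {outer_measure set T -> \bar R}).
Context {I : choiceType}.
Implicit Types (s : seq I) (A : I -> set T).

Lemma outer_measure_bigsetU s A :
  (mu (\big[setU/set0]_(i <- s) A i) <= \sum_(i <- s) mu (A i))%E.
Proof.
elim: s => [|i s IH]; first by rewrite !big_nil outer_measure0.
by rewrite !big_cons; apply: le_trans (outer_measureU2 mu _ _) _; exact: leeD2l.
Qed.

Lemma caratheodory_bigsetU s A : uniq s -> (forall i, mu.-caratheodory (A i)) ->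
  (forall i j, i != j -> A i `&` A j = set0) ->
  mu (\big[setU/set0]_(i <- s) A i) = (\sum_(i <- s) mu (A i))%E.
Proof.
move=> us mA dA; elim: s us => [|i s IH]; first by rewrite !big_nil outer_measure0.
rewrite /= => /andP[is_ us]; rewrite !big_cons (mA i) -IH//; congr (mu _ + mu _)%E.
  by rewrite setUK.
rewrite setIUl setICr set0U -bigcup_seq; apply/setIidPl => x [j /= js Ajx] Aix.
have ij : i != j by apply: contraNneq is_ => ->.
by have : set0 x by rewrite -(dA i j ij).
Qed.

End finite_unions.

Section isometry.
Context {R : realType}.
Local Open Scope ereal_scope.

Lemma hausdorff_contraction {T : Type} {n k : nat} m (f : T -> 'rV[R]_n)
    (h : T -> 'rV[R]_k) (A : set T) :
  (forall x y, A x -> A y -> (enorm (f x - f y) <= enorm (h x - h y))%R) ->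
  hausdorff m (f @` A) <= hausdorff m (h @` A).
Proof.
move=> fh; have := @le_hausdorff_lipschitz R T n k m f h A 1 ltr01.
by rewrite expr1n mul1e; apply=> x y Ax Ay; rewrite mul1r fh.
Qed.

Lemma hausdorff_translate {n : nat} m (A : set 'rV[R]_n) v :
  hausdorff m ((fun x => (x + v)%R) @` A) = hausdorff m A.
Proof.
rewrite -{2}(image_id A); apply/eqP; rewrite eq_le.
by apply/andP; split; apply: hausdorff_contraction => x y _ _;
  rewrite opprD addrACA subrr addr0.
Qed.

Lemma hausdorff_scale {n : nat} m (A : set 'rV[R]_n) (r : R) : (0 < r)%R ->
  hausdorff m ((fun x => (r *: x)%R) @` A) = (r ^+ m)%:E * hausdorff m A.
Proof.
move=> r0; rewrite -{2}(image_id A); apply/eqP; rewrite eq_le; apply/andP; split.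
  apply: le_hausdorff_lipschitz => // x y _ _.
  by rewrite -scalerBr enormZ gtr0_norm.
rewrite -lee_pdivlMl ?exprn_gt0// -exprVn.
apply: le_hausdorff_lipschitz => [|x y _ _]; first by rewrite invr_gt0.
by rewrite -scalerBr enormZ gtr0_norm// mulrA mulVf ?mul1r// gt_eqF.
Qed.

End isometry.

(** Cauchy's functional equation: positivity makes [f] monotone, and squeezing [N * s] between
    consecutive integers determines [f s] up to [f 1 / N]. *)
Lemma additive_nonneg_linear {R : realType} (f : R -> R) :
  (forall s t, 0 <= s -> 0 <= t -> f (s + t) = f s + f t) ->
  (forall s, 0 <= s -> 0 <= f s) -> forall s, 0 <= s -> f s = s * f 1.
Proof.
move=> fD f0 s s0.
have fn n t : 0 <= t -> f (n%:R * t) = n%:R * f t.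
  move=> t0; elim: n => [|n IH].
    by have := fD 0 0 (lexx _) (lexx _); rewrite addr0 !mul0r => /eqP; rewrite -subr_eq subrr => /eqP.
  by rewrite -natr1 !mulrDl !mul1r fD ?IH// mulr_ge0.
have fmono t t' : 0 <= t -> t <= t' -> f t <= f t'.
  move=> t0 tt'; rewrite -(subrK t t') addrC fD ?subr_ge0//.
  by rewrite lerDl f0// subr_ge0.
have f1 : 0 <= f 1 by exact: f0.
apply/eqP; rewrite -subr_eq0 -normr_le0; apply/ler_addgt0Pr => e e0; rewrite add0r.
pose N := (Num.trunc (f 1 / e)).+1.
have N0 : 0 < N%:R :> R by [].
have Ne : f 1 < N%:R * e by rewrite -ltr_pdivrMr// truncnS_gt.
have Ns : 0 <= N%:R * s by rewrite mulr_ge0.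
pose k := Num.trunc (N%:R * s).
have /andP[k1 k2] : k%:R <= N%:R * s < k.+1%:R by exact: trunc_itv.
have h1 := fmono _ _ (ler0n _ _) k1.
have h2 := fmono _ _ Ns (ltW k2).
move: h1 h2; rewrite fn// -(mulr1 k%:R) -(mulr1 k.+1%:R) !fn// => h1 h2.
rewrite -(@ler_pM2l _ N%:R)// -(ger0_norm (ltW N0)) -normrM (ger0_norm (ltW N0)).
apply: le_trans (ltW Ne); rewrite ler_norml; move: h1 h2 k1 k2.
by rewrite -natr1 => h1 h2 k1 k2; apply/andP; split; nra.
Qed.

(** * Hausdorff measure of boxes and of their dilations *)

Section boxes.
Context {R : realType} {m : nat}.
Implicit Types (a l : 'I_m -> R) (x : 'rV[R]_m).
Local Notation mu := (@hausdorff R m m).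

(** Half-open, so that the cells of a grid are disjoint and a coordinate hyperplane cuts a box into
    two disjoint boxes. *)
Definition box a l : set 'rV[R]_m :=
  [set x | forall i, a i <= x ord0 i < a i + l i].

Definition cube (s : R) : set 'rV[R]_m := box (fun=> 0) (fun=> s).

Lemma open_halfspace i (s : R) : open [set x : 'rV[R]_m | x ord0 i < s].
Proof.
apply/open_enormP => x /= xs; exists (s - x ord0 i); first by rewrite subr_gt0.
move=> y yx /=; have := le_lt_trans (coord_le_enorm (y - x) i) yx.
by rewrite !mxE => /(le_lt_trans (ler_norm _)); rewrite ltrD2r.
Qed.

Lemma halfspace_caratheodory i (s : R) :
  mu.-caratheodory [set x : 'rV[R]_m | x ord0 i < s].
Proof. exact/open_caratheodory/open_halfspace. Qed.

Lemma box_caratheodory a l : mu.-caratheodory (box a l).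
Proof.
have -> : box a l = \bigcap_(i in [set: 'I_m])
    ([set x | x ord0 i < a i + l i] `\` [set x | x ord0 i < a i]).
  apply/seteqP; split=> [x h i _|x h i].
    by have /andP[h1 h2] := h i; split=> //=; apply/negP; rewrite -leNgt.
  by have [/= -> /negP] := h i I; rewrite -leNgt => ->.
apply: (@fin_bigcap_measurable _ (caratheodory_type mu)) => [|i _]; first exact: finite_finset.
by apply: caratheodory_measurable_setD; exact: halfspace_caratheodory.
Qed.

Lemma box_translate a l : mu (box a l) = mu (box (fun=> 0) l).
Proof.
rewrite -(hausdorff_translate m (box (fun=> 0) l) (\row_i a i)); congr (mu _).
apply/seteqP; split=> [x h|_ [x h <-] i].
  exists (x - \row_i a i); rewrite ?subrK// => i.
  by rewrite !mxE add0r subr_ge0 ltrBlDl h.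
by have := h i; rewrite !mxE lerDr addrC ltrD2l add0r.
Qed.

Lemma diam_box a l (s : R) : 0 <= s -> (forall i, l i <= s) ->
  (diam (box a l) <= (m%:R * s)%:E)%E.
Proof.
move=> s0 ls; apply: diam_le => x y xb yb; rewrite lee_fin.
apply: enorm_le_bound => i; rewrite !mxE.
have := xb i; have := yb i; have := ls i.
by rewrite ler_norml => h /andP[h1 h2] /andP[h3 h4]; apply/andP; split; lra.
Qed.

Definition grid_cell (h : R) (N : nat) (z : {ffun 'I_m -> 'I_N}) : set 'rV[R]_m :=
  box (fun i => (z i)%:R * h) (fun=> h).

Lemma grid_cell_cover (h : R) N x : 0 < h -> cube (N%:R * h) x ->
  exists z : {ffun 'I_m -> 'I_N}, grid_cell h z x.
Proof.
move=> h0 xc.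
have xi i : exists k : 'I_N, k%:R * h <= x ord0 i < k%:R * h + h.
  have /andP[x0 xN] := xc i; rewrite add0r -ltr_pdivrMr// in xN.
  have x0' : 0 <= x ord0 i / h by rewrite divr_ge0// ltW.
  have /andP[k1 k2] := trunc_itv x0'.
  have kN : (Num.trunc (x ord0 i / h) < N)%N.
    by rewrite -(ltr_nat R); exact: le_lt_trans xN.
  exists (Ordinal kN); rewrite /= -ler_pdivlMr// k1/=.
  by rewrite -[X in _ + X]mul1r -mulrDl natr1 -ltr_pdivrMr.
have [f hf] := choice xi; exists (finfun f) => i.
by rewrite ffunE hf.
Qed.

Lemma grid_cell_disjoint (h : R) N (z z' : {ffun 'I_m -> 'I_N}) : 0 < h ->
  z != z' -> grid_cell h z `&` grid_cell h z' = set0.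
Proof.
move=> h0 zz'; rewrite -subset0 => x [xz xz']; move/eqP: zz'; apply.
apply/ffunP => i; apply/val_inj/eqP.
have key (j k : nat) : j%:R * h <= x ord0 i -> x ord0 i < k%:R * h + h -> (j <= k)%N.
  move=> h1 h2; have := le_lt_trans h1 h2.
  by rewrite -[X in _ + X]mul1r -mulrDl natr1 ltr_pM2r// ltr_nat ltnS.
have /andP[h1 h2] := xz i; have /andP[h3 h4] := xz' i.
by rewrite eqn_leq; apply/andP; split; apply: key.
Qed.

Lemma hausdorff_pre_le_cost (d : R) (A : set 'rV[R]_m) :
  (diam A <= d%:E)%E -> (hausdorff_pre m d A <= hausdorff_cost m A)%E.
Proof.
move=> dA; apply: ereal_inf_lbound.
exists (fun k => if k == 0%N then A else set0).
  split=> [x Ax|[|k]//]; first by exists 0%N.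
  by rewrite diam0 leNye.
rewrite (nneseries_split _ 1) => [|[|k] _]; last 2 first.
  exact: hausdorff_cost_ge0.
  exact: hausdorff_cost_ge0.
rewrite add0n big_nat1 eseries0 ?adde0// => k; case: k => // k _ _.
exact: hausdorff_cost0.
Qed.

Lemma hausdorff_pre_bigsetU (I : choiceType) (d : R) (s : seq I) (A : I -> set 'rV[R]_m) :
  (hausdorff_pre m d (\big[setU/set0]_(i <- s) A i) <=
   \sum_(i <- s) hausdorff_pre m d (A i))%E.
Proof.
have pre0 : hausdorff_pre m d (set0 : set 'rV[R]_m) = 0%E.
  apply/eqP; rewrite eq_le hausdorff_pre_ge0 andbT -(@hausdorff_cost0 R m m).
  by apply: hausdorff_pre_le_cost; rewrite diam0 leNye.
pose B k := nth set0 [seq A i | i <- s] k.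
have -> : \big[setU/set0]_(i <- s) A i = \bigcup_k B k.
  rewrite -bigcup_seq; apply/seteqP; split=> [x [i /= si Aix]|x [k _]].
    exists (index i s) => //; rewrite /B (nth_map i) ?nth_index//.
    by rewrite index_mem.
  rewrite /B; have [ks|sk] := ltnP k (size s); last by rewrite nth_default ?size_map.
  case: s ks @B => // i0 s ks _; rewrite (nth_map i0)// => h.
  by exists (nth i0 (i0 :: s) k) => //=; apply: mem_nth.
apply: le_trans (hausdorff_pre_sigma_subadditive _ _ _) _.
rewrite (nneseries_split _ (size s)); last by move=> *; exact: hausdorff_pre_ge0.
rewrite add0n [X in (_ + X)%E]eseries0 => [|k sk _]; last first.
  by rewrite /B nth_default ?size_map.
rewrite adde0 big_mkord -(big_map A xpredT (fun C => hausdorff_pre m d C)).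
by rewrite (big_nth set0) size_map big_mkord.
Qed.

(** A grid of [N ^ m] cells, each of diameter at most [m * s / N], has a total cost bounded
    independently of [N]. *)
Lemma hausdorff_cube_fin (s : R) : 0 < s -> (mu (cube s) < +oo)%E.
Proof.
move=> s0.
suff : (mu (cube s) <= (ball_volume R m / 2 ^+ m * (m%:R * s) ^+ m)%:E)%E.
  by move/le_lt_trans; apply; exact: ltry.
apply: ge_ereal_sup => _ [d /= d0 <-].
(* [N] is large enough for every cell to have diameter at most [d]. *)
pose N := (Num.trunc (m%:R * s / d)).+1; pose h := s / N%:R.
have N0 : 0 < N%:R :> R by rewrite ltr0n.
have h0 : 0 < h by rewrite divr_gt0.
have sN : s = N%:R * h by rewrite /h mulrC divfK// gt_eqF.
have hd : m%:R * h <= d.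
  rewrite /h mulrA ler_pdivrMr// [d * _]mulrC -ler_pdivrMr//.
  by apply: ltW; exact: truncnS_gt.
pose Z := enum {: {ffun 'I_m -> 'I_N}}.
have cov : cube s `<=` \big[setU/set0]_(z <- Z) grid_cell h z.
  rewrite sN => x /(grid_cell_cover h0)[z xz]; rewrite -bigcup_seq; exists z => //=.
  by rewrite mem_enum.
have pre_mono (A B : set 'rV[R]_m) : A `<=` B ->
    (hausdorff_pre m d A <= hausdorff_pre m d B)%E.
  move=> AB; apply: ereal_inf_le_tmp => _ [F [BF dF] <-]; exists F => //.
  by split => //; exact: subset_trans BF.
apply: le_trans (pre_mono _ _ cov) _.
apply: le_trans (hausdorff_pre_bigsetU _ _ _) _.
have dc (z : {ffun 'I_m -> 'I_N}) : (diam (grid_cell h z) <= (m%:R * h)%:E)%E.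
  by apply: diam_box => //; exact: ltW.
have cz (z : {ffun 'I_m -> 'I_N}) : (hausdorff_pre m d (grid_cell h z) <=
    (ball_volume R m / 2 ^+ m * (m%:R * h) ^+ m)%:E)%E.
  apply: le_trans (hausdorff_pre_le_cost _) _.
    by apply: le_trans (dc z) _; rewrite lee_fin.
  have ne : grid_cell h z !=set0.
    exists (\row_i ((z i)%:R * h)) => i; rewrite mxE lexx/= ltrDl//.
  rewrite hausdorff_costE// [leRHS]EFinM [in leRHS]EFin_expe lee_pmul2l//; last first.
    by rewrite lte_fin divr_gt0 ?exprn_gt0 ?ball_volume_gt0.
  by apply: le_expe; [exact: diam_ge0|exact: dc].
apply: le_trans (lee_sum _ (fun z _ => cz z)) _.
rewrite sumEFin lee_fin big_tnth sumr_const card_ord -cardE card_ffun !card_ord.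
have -> : m%:R * s = N%:R * (m%:R * h) by rewrite {1}sN mulrCA.
by rewrite (exprMn _ N%:R) -(natrX _ N) [leRHS]mulrCA [leRHS]mulr_natl.
Qed.

End boxes.

Section box_volume.
Context {R : realType} {m : nat}.
Implicit Types (a l : 'I_m -> R) (x : 'rV[R]_m).
Local Notation mu := (@hausdorff R m m).

Definition upd l i (s : R) : 'I_m -> R := fun j => if j == i then s else l j.

Definition box_vol l : R := fine (mu (box (fun=> 0) l)).

(** Left unevaluated: it is a factor common to the measures of all boxes, so it cancels when a box
    is compared with a dilated one. *)
Definition unit_cube_vol : R := box_vol (fun=> 1).

Lemma box_fin a l : mu (box a l) \is a fin_num.
Proof.
rewrite box_translate ge0_fin_numE ?hausdorff_ge0//.
pose s : R := 1 + \sum_i `|l i|.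
have s0 : 0 < s by rewrite ltr_pwDl// sumr_ge0.
apply: le_lt_trans (hausdorff_cube_fin s0); apply: hausdorff_mono => x h i.
have /andP[-> /= xl] := h i; apply: lt_le_trans xl _; rewrite lerD2l.
apply: le_trans (ler_norm _) _; rewrite /s (bigD1 i)//= addrCA lerDl.
by rewrite addr_ge0// sumr_ge0.
Qed.

Lemma box_volE a l : mu (box a l) = (box_vol l)%:E.
Proof. by rewrite box_translate -[LHS]fineK// box_fin. Qed.

Lemma box_vol_ge0 l : 0 <= box_vol l.
Proof. by rewrite fine_ge0// hausdorff_ge0. Qed.

(** The half-space [x ord0 i < s] is measurable and cuts the box in two; the upper piece is a
    translate of a box based at the origin. This is the functional equation that makes [box_vol]
    linear in each side. *)
Lemma box_vol_additive l i s t : 0 <= s -> 0 <= t ->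
  box_vol (upd l i (s + t)) = box_vol (upd l i s) + box_vol (upd l i t).
Proof.
move=> s0 t0; apply: EFin_inj; rewrite EFinD -(box_volE (fun=> 0)).
rewrite (halfspace_caratheodory i s).
rewrite -(box_volE (fun=> 0)) -(box_volE (upd (fun=> 0) i s)).
congr (mu _ + mu _)%E; apply/seteqP; split=> x; rewrite /box/=.
- move=> [h xs] j; have := h j; rewrite /upd; case: eqVneq => // -> /andP[-> _].
  by rewrite add0r.
- move=> h; split=> [j|]; last by have := h i; rewrite /upd eqxx add0r => /andP[].
  have := h j; rewrite /upd; case: eqVneq => // _ /andP[-> /= xs].
  by apply: lt_le_trans xs _; rewrite !add0r lerDl.
- move=> [h /negP xs] j; have := h j; rewrite /upd; case: eqVneq => // -> /andP[_].
  by rewrite add0r leNgt xs => ->.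
- move=> h; split=> [j|]; last first.
    by apply/negP; rewrite -leNgt; have := h i; rewrite /upd eqxx => /andP[].
  have := h j; rewrite /upd; case: eqVneq => // _ /andP[xs xt].
  by rewrite add0r xt (le_trans s0 xs).
Qed.

Lemma box_vol_upd l i s : 0 <= s -> box_vol (upd l i s) = s * box_vol (upd l i 1).
Proof.
move=> s0; apply: (additive_nonneg_linear (f := fun s => box_vol (upd l i s))) => //.
  exact: box_vol_additive.
by move=> *; exact: box_vol_ge0.
Qed.

Lemma box_vol_prod l : (forall i, 0 <= l i) ->
  box_vol l = (\prod_i l i) * unit_cube_vol.
Proof.
move=> l0.
suff h (r : seq 'I_m) : uniq r -> box_vol (fun j => if j \in r then l j else 1) =
    (\prod_(j <- r) l j) * unit_cube_vol.
  have := h _ (index_enum_uniq 'I_m); rewrite -!/(index_enum _) => <-.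
  by congr box_vol; apply/funext => j; rewrite mem_index_enum.
elim: r => [_|i r IH /= /andP[ir ur]]; first by rewrite big_nil mul1r.
rewrite big_cons -mulrA -IH//.
transitivity (box_vol (upd (fun j => if j \in r then l j else 1) i (l i))).
  congr box_vol; apply/funext => j; rewrite /upd in_cons.
  by case: eqVneq => [->|].
rewrite box_vol_upd//; congr (_ * box_vol _); apply/funext => j; rewrite /upd.
by case: eqVneq => // ->; rewrite (negbTE ir).
Qed.

Definition dilation l x : 'rV[R]_m := \row_i (l i * x ord0 i).

Lemma dilation_box l a (b : 'I_m -> R) : (forall i, 0 < l i) ->
  dilation l @` box a b `<=` box (fun i => l i * a i) (fun i => l i * b i).
Proof.
by move=> l0 _ [x h <-] i; rewrite mxE ler_pM2l// -mulrDr ltr_pM2l.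
Qed.

Lemma hausdorff_dilation_box l a (b : 'I_m -> R) : (forall i, 0 < l i) ->
  (forall i, 0 <= b i) ->
  (mu (dilation l @` box a b) <= (\prod_i l i)%:E * mu (box a b))%E.
Proof.
move=> l0 b0.
apply: (@le_trans _ _ (mu (box (fun i => l i * a i) (fun i => l i * b i)))).
  by apply: hausdorff_mono; exact: dilation_box.
rewrite !box_volE !box_vol_prod// => [|i]; last by rewrite mulr_ge0// ltW.
by rewrite -EFinM big_split/= mulrA.
Qed.

(* K is the intersection of its neighbourhoods, each of which contains a finite
   union of grid cells that covers K. *)
Lemma hausdorff_dilation_compact l (K : set 'rV[R]_m) : (forall i, 0 < l i) ->
  compact K -> (mu (dilation l @` K) <= (\prod_i l i)%:E * mu K)%E.
Proof.
move=> l0 cK.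
have P0 : 0 < \prod_i l i by rewrite prodr_gt0.
have [K0|/set0P/negP/negPn/eqP->] := pselect (K !=set0); last first.
  by rewrite image_set0 hausdorff0 mule_ge0// lee_fin ltW.
(* The cubes of the grid have a corner at the origin, so [K] is first translated into the
   nonnegative orthant; the dilation turns this into another translation. *)
wlog Kpos : K cK K0 / forall x, K x -> forall i, 0 <= x ord0 i.
  move=> main; have /bounded_enormP[M KM] : bounded_set K by exact: compact_bounded.
  pose v : 'rV[R]_m := const_mx M.
  have -> : mu (dilation l @` K) = mu (dilation l @` ((fun x => x + v) @` K)).
    rewrite -(hausdorff_translate _ (dilation l @` K) (dilation l v)); congr (mu _).
    rewrite !image_comp; apply: eq_imagel => x _ /=.
    by apply/rowP => i; rewrite !mxE mulrDr.
  rewrite -(hausdorff_translate _ K v); apply: main.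
  - apply: continuous_compact => //; apply: continuous_subspaceT => x.
    apply/continuous_enormP => e e0; exists e => // y.
    rewrite opprD addrACA subrr addr0; apply: le_lt_trans.
    exact: norm_le_enorm.
  - by case: K0 => x Kx; exists (x + v), x.
  - move=> _ [x Kx <-] i; rewrite !mxE -lerBlDr sub0r.
    have := le_trans (coord_le_enorm x i) (KM x Kx); rewrite ler_norml => /andP[//].
have /bounded_enormP[M0 KM0] : bounded_set K by exact: compact_bounded.
pose M := M0 + 1.
have M1 x : K x -> enorm x + 1 <= M by move=> Kx; rewrite lerD2r KM0.
have M_gt0 : 0 < M.
  by case: K0 => x /M1; apply: lt_le_trans; rewrite ltr_wpDl// enorm_ge0.
have clK : closed K by exact: compact_closed.
pose F k := cube M `&` [set x | edist K x - k.+1%:R^-1 <= 0].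
have mF k : mu.-caratheodory (F k).
  apply: caratheodory_measurable_setI; first exact: box_caratheodory.
  apply: sublevel_measurable => x y; rewrite opprB addrA subrK.
  exact: edist_lipschitz1.
have F0fin : (mu (F 0%N) < +oo)%E.
  by apply: le_lt_trans (hausdorff_cube_fin M_gt0); apply: hausdorff_mono => x [].
have Fdec i j : (i <= j)%N -> F j `<=` F i.
  move=> ij x [xM /=]; rewrite !subr_le0 => h; split=> //=; rewrite subr_le0.
  by apply: le_trans h _; rewrite lef_pV2 ?posrE// ler_nat.
have FK : \bigcap_i F i `<=` K.
  move=> x h; rewrite -(edist_le0 clK K0) /=; apply/ler_addgt0Pr => e e0; rewrite add0r.
  have [_ /=] := h (Num.trunc e^-1) I; rewrite subr_le0 => /le_trans; apply.
  by rewrite invf_ple ?posrE//; apply/ltW; exact: truncnS_gt.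
have cvF := hausdorff_cvg_decreasing F0fin mF Fdec.
have finK : mu (\bigcap_i F i) \is a fin_num.
  rewrite ge0_fin_numE ?hausdorff_ge0//; apply: le_lt_trans F0fin.
  by apply: hausdorff_mono => x /(_ 0%N I).
apply: (@le_trans _ _ ((\prod_i l i)%:E * mu (\bigcap_i F i))%E); last first.
  by rewrite lee_pmul2l ?lte_fin//; exact: hausdorff_mono.
have main k : (mu (dilation l @` K) <= (\prod_i l i)%:E * mu (F k))%E.
  (* The cells are so small that a cell meeting [K] lies within distance [1 / (k + 1)] of [K], hence
     in the neighbourhood [F k]. *)
  have [N [N0 NM]] : exists N, (0 < N)%N /\ m%:R * (M / N%:R) <= k.+1%:R^-1.
    exists (Num.trunc (m%:R * M * k.+1%:R)).+1; split=> //.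
    rewrite mulrA ler_pdivrMr// ler_pdivlMl// mulrC.
    by apply/ltW; exact: truncnS_gt.
  pose h := M / N%:R.
  have N0' : 0 < N%:R :> R by rewrite ltr0n.
  have h0 : 0 < h by rewrite divr_gt0.
  have MN : M = N%:R * h by rewrite /h mulrC divfK// gt_eqF.
  pose Z := [seq z <- enum {: {ffun 'I_m -> 'I_N}} | `[< grid_cell h z `&` K !=set0 >]].
  have KZ : K `<=` \big[setU/set0]_(z <- Z) grid_cell h z.
    move=> x Kx; have [|z xz] := @grid_cell_cover _ _ h N x h0.
      rewrite -MN => i; rewrite Kpos//= add0r.
      have := coord_le_enorm x i => /(le_trans (ler_norm _)) h1.
      by have := M1 x Kx; lra.
    rewrite -bigcup_seq; exists z => //=; rewrite mem_filter mem_enum andbT.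
    by apply/asboolP; exists x.
  have ZF : \big[setU/set0]_(z <- Z) grid_cell h z `<=` F k.
    move=> x; rewrite -bigcup_seq => -[z /=]; rewrite mem_filter => /andP[/asboolP[y [yz Ky]] _] xz.
    split.
      move=> i; have /andP[h1 h2] := xz i; rewrite add0r; apply/andP; split.
        by apply: le_trans h1; rewrite mulr_ge0// ltW.
      apply: lt_le_trans h2 _; rewrite MN -[X in _ + X]mul1r -mulrDl natr1.
      by rewrite ler_pM2r// ler_nat.
    rewrite /= subr_le0; apply: le_trans (edist_le _ Ky) _; apply: le_trans NM.
    rewrite -lee_fin; apply: le_trans (diam_ub xz yz) _.
    by apply: diam_box => //; exact: ltW.
  have uZ : uniq Z by rewrite filter_uniq// enum_uniq.
  apply: (@le_trans _ _ (mu (\big[setU/set0]_(z <- Z) (dilation l @` grid_cell h z)))).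
    apply: hausdorff_mono => _ [x /KZ + <-]; rewrite -!bigcup_seq => -[z zZ xz].
    by exists z => //; exists x.
  apply: le_trans (outer_measure_bigsetU _ _ _) _.
  apply: (@le_trans _ _ (\sum_(z <- Z) (\prod_i l i)%:E * mu (grid_cell h z))%E).
    by apply: lee_sum => z _; apply: hausdorff_dilation_box => // _; exact: ltW.
  rewrite -ge0_sume_distrr; last by move=> *; exact: hausdorff_ge0.
  rewrite lee_pmul2l ?lte_fin// -caratheodory_bigsetU//.
  - exact: hausdorff_mono.
  - by move=> z; exact: box_caratheodory.
  - by move=> z z'; exact: grid_cell_disjoint.
rewrite -lee_pdivrMl// -(cvg_lim _ cvF)//; apply: lime_ge.
  by apply: cvgP; exact: cvF.
by apply: nearW => k; rewrite lee_pdivrMl.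
Qed.

End box_volume.

Section cube_positive.
Context {R : realType}.
Local Open Scope ereal_scope.

(* Induction on the dimension: integrate the (m-1)-dimensional inequality over
   the first coordinate. *)
Lemma boxes_cover_cube (m : nat) (S : nat -> bool) (a l : nat -> 'I_m -> R) :
  (forall k i, (0 <= l k i)%R) ->
  (forall x : 'I_m -> R, (forall i, (0 <= x i <= 1)%R) ->
    exists k, S k /\ forall i, (a k i <= x i <= a k i + l k i)%R) ->
  1 <= \sum_(k <oo) ((S k)%:R * \prod_i l k i)%:E.
Proof.
elim: m S a l => [|m IH] S a l l0 cov.
  have [|k [Sk _]] := cov (fun=> 0%R); first by case.
  have term0 j : 0 <= ((S j)%:R * \prod_i l j i)%:E.
    by rewrite lee_fin mulr_ge0// prodr_ge0.
  apply: le_trans (nneseries_lim_ge k.+1 _) => //.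
  rewrite big_nat_recr//= Sk big_ord0 mul1r leeDr// sume_ge0//.
pose mu := @lebesgue_measure R.
pose I k : set R := [set` `[a k ord0, (a k ord0 + l k ord0)%R]].
pose v k : R := ((S k)%:R * \prod_(i < m) l k (lift ord0 i))%R.
have v0 k : (0 <= v k)%R by rewrite mulr_ge0// prodr_ge0.
pose D : set R := [set` `[0%R, 1%R]].
have mD : measurable D by exact: measurable_itv.
have mI k : measurable (I k) by exact: measurable_itv.
have slice t : D t -> 1 <= \sum_(k <oo) ((v k)%:E * (\1_(I k) t)%:E).
  move=> /= Dt.
  (* The mask [S] now also discards the boxes whose first side misses [t]; the remaining ones cover
     the slice at height [t]. *)
  have := @IH (fun k => S k && (t \in I k)) (fun k i => a k (lift ord0 i))
    (fun k i => l k (lift ord0 i)) (fun k i => l0 k _).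
  rewrite (eq_eseriesr (g := fun k => (v k)%:E * (\1_(I k) t)%:E)); last first.
    move=> k _; rewrite /v indicE -EFinM; congr (_%:E).
    by case: (S k); case: (t \in I k); rewrite ?mulr0 ?mul0r ?mulr1.
  apply=> x x01; have [|k [Sk kx]] := cov (fun i => oapp x t (unlift ord0 i)).
    move=> i; case: unliftP => [j _|_] /=; first exact: x01.
    by move: Dt; rewrite /D/= in_itv.
  exists k; split=> [|i]; last by have := kx (lift ord0 i); rewrite liftK.
  rewrite Sk/= inE /I /= in_itv/=; have := kx ord0.
  by rewrite unlift_none.
have mf k : measurable_fun D (fun t => (v k)%:E * (\1_(I k) t)%:E).
  by apply/measurable_EFinP/measurable_funM => //; exact: measurable_indic.
have f0 k t : D t -> 0 <= (v k)%:E * (\1_(I k) t)%:E.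
  by move=> _; rewrite mule_ge0// lee_fin.
have : \int[mu]_(t in D) (cst 1 t) <=
    \int[mu]_(t in D) (\sum_(k <oo) ((v k)%:E * (\1_(I k) t)%:E)).
  apply: ge0_le_integral => //.
  by apply: ge0_emeasurable_sum => [k t Dt _|k _]; [exact: f0|exact: mf].
have muD : mu D = 1.
  by have := @lebesgue_measure_itv R `[0%R, 1%R]; rewrite /= lte_fin ltr01 oppr0 adde0.
have muI k : mu (I k) <= (l k ord0)%:E.
  have := @lebesgue_measure_itv R `[a k ord0, (a k ord0 + l k ord0)%R].
  rewrite /= lte_fin ltrDl => e; have -> : mu (I k) = _ := e; case: ifP => _; last by rewrite lee_fin.
  by rewrite -EFinB addrAC subrr add0r.
have -> : \int[mu]_(t in D) (cst 1 t) = 1 by rewrite integral_cst// mul1e; exact: muD.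
rewrite integral_nneseries// => /le_trans; apply; apply: lee_nneseries => [k _ _|k _].
  by apply: integral_ge0 => t; exact: f0.
rewrite ge0_integralZl//; last 2 first.
  by apply/measurable_EFinP; apply: measurable_indic; exact: mI.
  by rewrite lee_fin.
have -> : ((S k)%:R * \prod_i l k i = v k * l k ord0)%R.
  by rewrite big_ord_recl mulrCA mulrC.
rewrite integral_indic//; last exact: mI.
rewrite [leRHS](EFinM (v k)).
apply: lee_pmul => //; first by rewrite lee_fin.
apply: le_trans (muI k).
apply: le_measure; rewrite ?inE; last by move=> t [].
  by apply: measurableI => //; exact: mI.
exact: mI.
Qed.

(** A covering set of diameter [D] lies in the box of side [2 * D] centred at one of its points, so
    the costs of a cover dominate [c] times the volumes of boxes covering the cube. One factor
    [2 ^+ m] in [c] comes from the normalization of [hausdorff_cost], the other from doubling the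
    side. *)
Lemma hausdorff_cube_gt0 (m : nat) : 0 < @hausdorff R m m (cube 1).
Proof.
pose A := [set x : 'rV[R]_m | forall i, (0 <= x ord0 i <= 1)%R].
pose c : R := (ball_volume R m / 2 ^+ m / 2 ^+ m)%R.
have c0 : (0 < c)%R by rewrite !divr_gt0 ?exprn_gt0 ?ball_volume_gt0.
have preA : c%:E <= hausdorff_pre m 1 A.
  apply: le_ereal_inf_tmp => _ [F [AF dF] <-].
  pose P k := F k !=set0.
  pose D k := fine (diam (F k)).
  have DE k : P k -> diam (F k) = (D k)%:E.
    move=> Pk; rewrite fineK// ge0_fin_numE ?diam_ge0//.
    by apply: le_lt_trans (dF k) _; exact: ltry.
  have D0 k : P k -> (0 <= D k)%R by move=> Pk; rewrite -lee_fin -DE ?diam_ge0.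
  pose p k := get (F k).
  have pF k : P k -> F k (p k) by move=> [x Fx]; exact: (getPex (ex_intro _ x Fx)).
  (* Empty members of the cover have diameter -oo; they get side 0 and are masked out. *)
  pose l k (i : 'I_m) := if `[<P k>] then (2 * D k)%R else 0%R.
  have l0 k i : (0 <= l k i)%R by rewrite /l; case: asboolP => // /D0 ?; rewrite mulr_ge0.
  have := @boxes_cover_cube m (fun k => `[<P k>]) (fun k i => (p k ord0 i - D k)%R) l l0.
  have -> : \sum_(k <oo) hausdorff_cost m (F k) =
      \sum_(k <oo) c%:E * ((`[<P k>] : bool)%:R * \prod_i l k i)%:E.
    apply: eq_eseriesr => k _; case: asboolP => Pk; last first.
      rewrite mul0r mule0 (_ : F k = set0) ?hausdorff_cost0//.
      by apply/eqP/negPn/negP => /set0P.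
    rewrite hausdorff_costE// DE// -EFin_expe -!EFinM mul1r; congr (_%:E).
    rewrite (eq_bigr (fun=> (2 * D k)%R)) => [|i _]; last by rewrite /l asboolT.
    rewrite prodr_const card_ord exprMn /c.
    have : (2 ^+ m != 0 :> R)%R by rewrite expf_neq0.
    by move: (2 ^+ m)%R (D k ^+ m)%R => s t s0; field.
  rewrite nneseriesZl; last first.
    by move=> k _; rewrite lee_fin mulr_ge0// prodr_ge0.
  move=> h; rewrite -[leLHS]mule1 lee_pmul2l ?lte_fin//; apply: h => x x01.
  have [|k _ Fx] := AF (\row_i x i); first by move=> i; rewrite mxE.
  have Pk : P k by exists (\row_i x i).
  exists k; split=> [|i]; first exact/asboolP.
  rewrite /l asboolT//; have := diam_ub Fx (pF k Pk); rewrite DE// lee_fin.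
  move/(le_trans (coord_le_enorm _ i)); rewrite !mxE ler_norml => /andP[h1 h2].
  by apply/andP; split; lra.
have muA : 0 < @hausdorff R m m A.
  apply: (@lt_le_trans _ _ c%:E); first by rewrite lte_fin.
  by apply: (le_trans preA); apply: ereal_sup_ubound; exists 1%R => /=.
(* The closed cube [A] is not contained in the half-open [cube 1], so positivity is obtained for
   [cube 2] and scaled back. *)
have A2 : A `<=` cube 2.
  by move=> x h i; have /andP[-> /= h2] := h i; rewrite add0r; lra.
have c2 := lt_le_trans muA (hausdorff_mono A2).
move: c2; rewrite /cube (box_volE (fun=> 0%R) (fun=> 2%R)) box_vol_prod//.
rewrite (box_volE (fun=> 0%R) (fun=> 1%R)) !lte_fin -/unit_cube_vol.
by rewrite pmulr_rgt0// prodr_gt0.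
Qed.

Lemma hausdorff_box_gt0 (m : nat) (a l : 'I_m -> R) : (forall i, (0 < l i)%R) ->
  0 < @hausdorff R m m (box a l).
Proof.
move=> l0; rewrite box_volE box_vol_prod => [|i]; last exact: ltW.
have := @hausdorff_cube_gt0 m; rewrite (box_volE (fun=> 0%R) (fun=> 1%R)) !lte_fin.
by move=> u0; rewrite mulr_gt0// prodr_gt0.
Qed.

End cube_positive.

(** * Strict differentiability *)

Section slopes.
Context {R : realType} {n : nat} {T : Type} (F : set_system T) {FF : Filter F}.
Variable D : T -> 'rV[R]_n.
Implicit Types (a b : T -> R) (c : R) (g : 'I_n -> R).

(* Hadamard form of strict differentiability: [a] and [b] are the values of a
   function at two points with difference [D], and [g] is the limit slope. *)
Definition hslope a b c g : Prop :=
  [/\ a z @[z --> F] --> c, b z @[z --> F] --> c &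
    exists G : 'I_n -> T -> R, (forall i, G i z @[z --> F] --> g i) /\
      \forall z \near F, a z - b z = \sum_i G i z * D z ord0 i].

Lemma hslope_ext a b c g g' : g =1 g' -> hslope a b c g -> hslope a b c g'.
Proof. by move=> /funext ->. Qed.

Lemma hslopeM a b c g a' b' c' g' : hslope a b c g -> hslope a' b' c' g' ->
  hslope (fun z => a z * a' z) (fun z => b z * b' z) (c * c')
    (fun i => c * g' i + c' * g i).
Proof.
move=> [ac bc [G [Gg eG]]] [ac' bc' [G' [Gg' eG']]]; split.
- exact: cvgM.
- exact: cvgM.
exists (fun i z => a z * G' i z + b' z * G i z); split=> [i|].
  by apply: cvgD; apply: cvgM.
apply: filterS2 eG eG' => z e e'.
transitivity (a z * (a' z - b' z) + b' z * (a z - b z)); first by ring.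
rewrite e e' !mulr_sumr -big_split; apply: eq_bigr => i _ /=; ring.
Qed.

Lemma hslope0 : hslope (fun=> 0) (fun=> 0) 0 (fun=> 0).
Proof.
split; try exact: cvg_cst.
exists (fun _ _ => 0); split=> [i|]; first exact: cvg_cst.
by apply: nearW => z; rewrite subrr big1// => i _; rewrite mul0r.
Qed.

Lemma hslopeD a b c g a' b' c' g' : hslope a b c g -> hslope a' b' c' g' ->
  hslope (fun z => a z + a' z) (fun z => b z + b' z) (c + c')
    (fun i => g i + g' i).
Proof.
move=> [ac bc [G [Gg eG]]] [ac' bc' [G' [Gg' eG']]]; split.
- exact: cvgD.
- exact: cvgD.
exists (fun i z => G i z + G' i z); split=> [i|]; first exact: cvgD.
apply: filterS2 eG eG' => z e e'.
rewrite opprD addrACA e e' -big_split; apply: eq_bigr => i _ /=; ring.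
Qed.

Lemma hslope_sum (I : Type) (r : seq I) (a b : I -> T -> R) (c : I -> R)
    (g : I -> 'I_n -> R) : (forall j, hslope (a j) (b j) (c j) (g j)) ->
  hslope (fun z => \sum_(j <- r) a j z) (fun z => \sum_(j <- r) b j z)
    (\sum_(j <- r) c j) (fun i => \sum_(j <- r) g j i).
Proof.
move=> h; elim: r => [|j r IH].
  under eq_fun do rewrite big_nil; under [X in hslope _ X]eq_fun do rewrite big_nil.
  rewrite big_nil; apply: hslope_ext hslope0 => i; by rewrite big_nil.
under eq_fun do rewrite big_cons; under [X in hslope _ X]eq_fun do rewrite big_cons.
rewrite big_cons; apply: hslope_ext (hslopeD (h j) IH) => i; by rewrite big_cons.
Qed.

Lemma hslopeV a b c g : c != 0 -> hslope a b c g ->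
  hslope (fun z => (a z)^-1) (fun z => (b z)^-1) c^-1 (fun i => - (c^-1 * c^-1 * g i)).
Proof.
move=> c0 [ac bc [G [Gg eG]]].
have aV : (a z)^-1 @[z --> F] --> c^-1 by exact: cvgV.
have bV : (b z)^-1 @[z --> F] --> c^-1 by exact: cvgV.
split; [by []|by []|].
exists (fun i z => - ((a z)^-1 * (b z)^-1 * G i z)); split=> [i|].
  by apply: cvgN; apply: cvgM => //; apply: cvgM.
have a0 : \forall z \near F, a z != 0.
  by move: ac => /cvgrPdist_lt /(_ `|c|); rewrite normr_gt0 => /(_ c0);
    apply: filterS => z; apply: contraTneq => ->; rewrite subr0 ltxx.
have b0 : \forall z \near F, b z != 0.
  by move: bc => /cvgrPdist_lt /(_ `|c|); rewrite normr_gt0 => /(_ c0);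
    apply: filterS => z; apply: contraTneq => ->; rewrite subr0 ltxx.
apply: filterS3 a0 b0 eG => z az bz e.
transitivity (- ((a z)^-1 * (b z)^-1) * (a z - b z)); first by field; rewrite az bz.
by rewrite e mulr_sumr; apply: eq_bigr => i _; ring.
Qed.

Lemma hslope_sqrt a b c g : 0 < c -> hslope a b c g ->
  hslope (fun z => Num.sqrt (a z)) (fun z => Num.sqrt (b z)) (Num.sqrt c)
    (fun i => (2 * Num.sqrt c)^-1 * g i).
Proof.
move=> c0 [ac bc [G [Gg eG]]].
have s0 : 0 < Num.sqrt c by rewrite sqrtr_gt0.
have aS : Num.sqrt (a z) @[z --> F] --> Num.sqrt c.
  by apply: continuous_cvg => //; exact: sqrt_continuous.
have bS : Num.sqrt (b z) @[z --> F] --> Num.sqrt c.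
  by apply: continuous_cvg => //; exact: sqrt_continuous.
split; [by []|by []|].
exists (fun i z => (Num.sqrt (a z) + Num.sqrt (b z))^-1 * G i z); split=> [i|].
  apply: cvgM => //; apply: cvgV; first by rewrite mulf_neq0 ?gt_eqF.
  by rewrite mulr_natl mulr2n; apply: cvgD.
have a0 : \forall z \near F, 0 < a z by exact: (cvgr_gt _ ac).
have b0 : \forall z \near F, 0 < b z by exact: (cvgr_gt _ bc).
apply: filterS3 a0 b0 eG => z az bz e.
have sa : 0 < Num.sqrt (a z) by rewrite sqrtr_gt0.
have sb : 0 < Num.sqrt (b z) by rewrite sqrtr_gt0.
transitivity ((Num.sqrt (a z) + Num.sqrt (b z))^-1 * (a z - b z)).
  rewrite (_ : a z - b z = Num.sqrt (a z) ^+ 2 - Num.sqrt (b z) ^+ 2); last first.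
    by rewrite !sqr_sqrtr ?ltW.
  rewrite subr_sqr.
  by rewrite mulrCA mulVf ?mulr1// gt_eqF// addr_gt0.
by rewrite e mulr_sumr; apply: eq_bigr => i _; ring.
Qed.

End slopes.

Section strict_derivative.
Context {R : realType} {n : nat}.
Implicit Types (p x y v : 'rV[R]_n).

Definition pair_nbhs p : set_system ('rV[R]_n * 'rV[R]_n) :=
  filter_from [set d : R | 0 < d]
    (fun d => [set z | enorm (z.1 - p) < d /\ enorm (z.2 - p) < d]).

Global Instance pair_nbhs_filter p : Filter (pair_nbhs p).
Proof.
apply: filter_from_filter; first by exists 1; rewrite /= ltr01.
move=> d e /= d0 e0; exists (Num.min d e); first by rewrite /= lt_min d0.
by move=> [x y] /=; rewrite !lt_min => -[/andP[-> ->] /andP[-> ->]].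
Qed.

Definition has_slope (f : 'rV[R]_n -> R) p (g : 'I_n -> R) :=
  hslope (pair_nbhs p) (fun z => z.1 - z.2) (fun z => f z.1) (fun z => f z.2) (f p) g.

(** Strict differentiability: both points move, so the derivative at [p] controls increments between
    any two points near [p]. Derivatives act on row vectors from the right. *)
Definition sdiff {k : nat} (f : 'rV[R]_n -> 'rV[R]_k) p (J : 'M[R]_(n, k)) :=
  forall e, 0 < e -> exists2 d, 0 < d & forall x y,
    enorm (x - p) < d -> enorm (y - p) < d ->
    enorm (f x - f y - (x - y) *m J) <= e * enorm (x - y).

Lemma has_slope_estimate (f : 'rV[R]_n -> R) p g : has_slope f p g ->
  forall e, 0 < e -> exists2 d, 0 < d & forall x y,
    enorm (x - p) < d -> enorm (y - p) < d ->
    `|f x - f y - \sum_i g i * (x - y) ord0 i| <= e * enorm (x - y).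
Proof.
move=> [_ _ [G [Gg eG]]] e e0; pose e' := e / n.+1%:R.
have e'0 : 0 < e' by rewrite divr_gt0.
have h i : \forall z \near pair_nbhs p, `|g i - G i z| < e'.
  by move: (Gg i) => /cvgrPdist_lt; apply.
have h' : \forall z \near pair_nbhs p, forall i, `|g i - G i z| < e'.
  exact: filter_forall.
have [d /= d0 hd] := filterI eG h'; exists d => // x y xp yp.
have [/= -> hG] := hd (x, y) (conj xp yp).
rewrite -sumrB; apply: le_trans (ler_norm_sum _ _ _) _.
apply: (@le_trans _ _ (\sum_(i < n) e' * enorm (x - y))).
  apply: ler_sum => i _; rewrite -mulrBl normrM distrC.
  by apply: ler_pM => //; [exact/ltW/hG|exact: coord_le_enorm].
rewrite sumr_const card_ord -mulr_natl mulrA ler_wpM2r ?enorm_ge0//.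
by rewrite /e' mulrA ler_pdivrMr// mulrC ler_pM2l// ler_nat.
Qed.

Lemma sdiff_components {k : nat} (f : 'rV[R]_n -> 'rV[R]_k) p (J : 'M[R]_(n, k)) :
  (forall j, has_slope (fun x => f x ord0 j) p (fun i => J i j)) -> sdiff f p J.
Proof.
move=> h e e0; pose e' := e / k.+1%:R.
have e'0 : 0 < e' by rewrite divr_gt0.
have h' j := has_slope_estimate (h j) e'0.
have : \forall z \near pair_nbhs p, forall j : 'I_k,
    `|f z.1 ord0 j - f z.2 ord0 j - \sum_i J i j * (z.1 - z.2) ord0 i| <=
      e' * enorm (z.1 - z.2).
  apply: filter_forall => j; have [d d0 hd] := h' j; exists d => // -[x y] [xp yp].
  exact: hd.
move=> [d /= d0 hd]; exists d => // x y xp yp.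
apply: le_trans (enorm_le_bound (a := e' * enorm (x - y)) _) _ => [j|].
  have := hd (x, y) (conj xp yp) j; rewrite /= !mxE.
  by under eq_bigr do rewrite mulrC.
rewrite mulrA ler_wpM2r ?enorm_ge0//.
by rewrite /e' mulrA ler_pdivrMr// mulrC ler_pM2l// ler_nat.
Qed.

Lemma mulmx_lipschitz {k : nat} (J : 'M[R]_(n, k)) :
  exists C, 0 <= C /\ forall v : 'rV[R]_n, enorm (v *m J) <= C * enorm v.
Proof.
exists (\sum_i enorm (row i J)); split; first by apply: sumr_ge0 => i _; exact: enorm_ge0.
move=> v; rewrite mulmx_sum_row mulr_suml.
apply: le_trans (ler_enorm_sum _ _ _) _; apply: ler_sum => i _.
by rewrite enormZ mulrC ler_wpM2l ?enorm_ge0// coord_le_enorm.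
Qed.

Lemma sdiff_continuous {k : nat} (f : 'rV[R]_n -> 'rV[R]_k) p (J : 'M[R]_(n, k)) :
  sdiff f p J -> forall e, 0 < e -> exists2 d, 0 < d &
    forall x, enorm (x - p) < d -> enorm (f x - f p) < e.
Proof.
move=> fJ e e0; have [C [C0 hC]] := mulmx_lipschitz J.
have [d d0 hd] := fJ 1 ltr01; pose d' := Num.min d (e / (C + 1 + 1)).
have C1 : 0 < C + 1 + 1 by lra.
exists d' => [|x]; first by rewrite lt_min d0 divr_gt0.
rewrite lt_min ltr_pdivlMr// => /andP[xd xe].
have := hd x p xd; rewrite subrr enorm0 => /(_ d0) h.
rewrite -(subrK ((x - p) *m J) (f x - f p)).
apply: le_lt_trans (ler_enormD _ _) _; apply: le_lt_trans (lerD h (hC _)) _.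
have := enorm_ge0 (x - p); move: xe; move: (enorm _) => t; nra.
Qed.

Lemma sdiff_derive {k : nat} (f : 'rV[R]_n -> 'rV[R]_k) p (J : 'M[R]_(n, k)) v :
  sdiff f p J -> 'D_v f p = v *m J.
Proof.
move=> fJ; apply: cvg_lim => //; apply/cvgrPdist_le => e e0.
pose e' := e / (enorm v + 1).
have v1 : 0 < enorm v + 1 by rewrite ltr_wpDl ?enorm_ge0.
have [d d0 hd] := fJ e' (divr_gt0 e0 v1).
apply/nbhs_ballP; exists (d / (enorm v + 1)) => /=; first by rewrite divr_gt0.
move=> h; rewrite -ball_normE/= sub0r normrN ltr_pdivlMr// => hh h0.
apply: le_trans (norm_le_enorm _) _; rewrite -enormN opprB.
have hvd : enorm (h *: v + p - p) < d.
  by rewrite addrK enormZ; apply: le_lt_trans hh; rewrite ler_wpM2l// lerDl.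
have := hd (h *: v + p) p hvd; rewrite addrK subrr enorm0 => /(_ d0).
rewrite enormZ -scalemxAl => H.
have -> : h^-1 *: (f (h *: v + p) - f p) - v *m J =
    h^-1 *: (f (h *: v + p) - f p - h *: (v *m J)).
  by rewrite [RHS]scalerBr scalerA mulVf// scale1r.
rewrite enormZ normfV ler_pdivrMl ?normr_gt0//; apply: le_trans H _.
rewrite mulrCA ler_wpM2l// /e' -mulrA ger_pMr// ler_pdivrMl// mulr1 lerDl//.
Qed.

(** Strict differentiability at [p] forces continuity of the derivative at [p]: the increment from
    [q] along a short multiple of [v] is estimated by both derivatives. *)
Lemma sdiff_near {k : nat} (f : 'rV[R]_n -> 'rV[R]_k) p (J : 'M[R]_(n, k)) e :
  sdiff f p J -> 0 < e -> exists2 d, 0 < d & forall q J', enorm (q - p) < d ->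
    sdiff f q J' -> forall v, enorm (v *m J' - v *m J) <= e * enorm v.
Proof.
move=> fJ e0; have e2 : 0 < e / 2 by rewrite divr_gt0.
have [d d0 hd] := fJ _ e2; exists d => // q J' qp fJ' v.
have [d' d'0 hd'] := fJ' _ e2.
have v1 : 0 < enorm v + 1 by rewrite ltr_wpDl ?enorm_ge0.
pose t := Num.min d' (d - enorm (q - p)) / 2 / (enorm v + 1).
have t0 : 0 < t by rewrite !divr_gt0// lt_min d'0 subr_gt0.
have tv : enorm (t *: v) < Num.min d' (d - enorm (q - p)).
  rewrite enormZ gtr0_norm// /t mulrAC ltr_pdivrMr//.
  have : 0 < Num.min d' (d - enorm (q - p)) by rewrite lt_min d'0 subr_gt0.
  by have := enorm_ge0 v; move: (enorm v) (Num.min _ _) => a b; nra.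
have /andP[tv1 tv2] : (enorm (t *: v) < d') && (enorm (t *: v) < d - enorm (q - p)).
  by rewrite -lt_min.
have h1 : enorm (t *: v + q - p) < d.
  by rewrite -addrA; apply: le_lt_trans (ler_enormD _ _) _; rewrite -ltrBrDr.
have := hd (t *: v + q) q h1 qp; have := hd' (t *: v + q) q.
rewrite addrK subrr enorm0 => /(_ tv1 d'0) H1 H2.
rewrite -(@ler_pM2l _ t)// mulrCA -[t in leLHS](gtr0_norm t0) -[t in leRHS](gtr0_norm t0).
rewrite -!enormZ scalerBr !scalemxAl.
set X := (t *: v) *m J' in H1 *; set Y := (t *: v) *m J in H2 *.
set Z := f _ - f _ in H1 H2.
have -> : X - Y = (Z - Y) - (Z - X) by rewrite [RHS]addrC opprB addrA subrK.
apply: le_trans (ler_enormB _ _) _; apply: le_trans (lerD H2 H1) _.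
by rewrite -mulrDl -splitr.
Qed.

End strict_derivative.

Section calculus.
Context {R : realType} {n : nat}.
Implicit Types (U : set 'rV[R]_n) (f phi : 'rV[R]_n -> R) (p x y v w : 'rV[R]_n).

Lemma smooth_differentiable U phi x : smooth_on U phi -> U x -> differentiable phi x.
Proof. by move=> /(_ 1%N)[h _]; exact: h. Qed.

Lemma smooth_derive U phi v : smooth_on U phi -> smooth_on U ('D_v phi).
Proof. by move=> h k; case: (h k.+1) => _; exact. Qed.

Lemma smooth_continuous U phi x : smooth_on U phi -> U x -> {for x, continuous phi}.
Proof. by move=> /(_ 0%N); exact. Qed.

Lemma eball_convex p d x y (t : R) : 0 <= t <= 1 -> enorm (x - p) < d ->
  enorm (y - p) < d -> enorm (y + t *: (x - y) - p) < d.
Proof.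
move=> /andP[t0 t1] xd yd.
have -> : y + t *: (x - y) - p = (1 - t) *: (y - p) + t *: (x - p).
  by apply/rowP => i; rewrite !mxE; ring.
apply: le_lt_trans (ler_enormD _ _) _; rewrite !enormZ !ger0_norm ?subr_ge0//.
move: xd yd; move: (enorm _) (enorm _) => a b bd ad.
apply: (@le_lt_trans _ _ (Num.max a b)); last by rewrite gt_max ad.
have : a <= Num.max a b by rewrite le_max lexx.
have : b <= Num.max a b by rewrite le_max lexx orbT.
by move: (Num.max a b) => M; nra.
Qed.

Lemma line_derive f y v (t : R) : differentiable f (y + t *: v) ->
  is_derive t 1 (fun s : R => f (y + s *: v)) ('D_v f (y + t *: v)).
Proof.
move=> df.
have E : (fun h : R => h^-1 *: ((fun s : R => f (y + s *: v)) (h *: 1 + t) - f (y + t *: v)))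
       = (fun h : R => h^-1 *: (f (h *: v + (y + t *: v)) - f (y + t *: v))).
  apply/funext => h; congr (_ *: (f _ - _)).
  by rewrite scalerDl addrCA /GRing.scale/= mulr1.
apply: DeriveDef; last first.
  by rewrite /derive; apply: (congr1 (fun G : R -> R => lim (G @ 0^'))); exact: E.
have h : derivable f (y + t *: v) v by exact: diff_derivable.
move: h; rewrite /derivable => h.
by apply: (eq_ind_r (fun G : R -> R => cvg (G @ 0^')) h); exact: E.
Qed.

Lemma derive_gradient f x v : differentiable f x -> 'D_v f x = dot (gradient f x) v.
Proof.
move=> df; rewrite deriveE// {1}(row_sum_delta v) linear_sum; apply: eq_bigr => i _.
by rewrite linearZ /= mxE deriveE// mulrC.
Qed.

Lemma mvt01 (h dh : R -> R) : (forall t : R, 0 <= t <= 1 -> is_derive t 1 h (dh t)) ->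
  exists2 c, 0 < c < 1 & h 1 - h 0 = dh c.
Proof.
move=> hd; have [||c] := @MVT R h dh 0 1 ltr01.
- by move=> t; rewrite in_itv/= => /andP[t0 t1]; apply: hd; rewrite !ltW.
- apply: derivable_within_continuous => t; rewrite in_itv/= => t01.
  by have [] := hd t t01.
by rewrite in_itv/= => c01; rewrite subr0 mulr1; exists c.
Qed.

Lemma mvt_segment f x y :
  (forall t : R, 0 <= t <= 1 -> differentiable f (y + t *: (x - y))) ->
  exists2 t : R, 0 < t < 1 & f x - f y = dot (gradient f (y + t *: (x - y))) (x - y).
Proof.
move=> df.
have [|c c01] := @mvt01 (fun s : R => f (y + s *: (x - y)))
  (fun t => 'D_(x - y) f (y + t *: (x - y))).
  by move=> t t01; apply: line_derive; exact: df.
rewrite scale1r scale0r addr0 subrKC => ->; exists c => //.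
by rewrite derive_gradient//; apply: df; case/andP: c01 => *; rewrite !ltW.
Qed.

Lemma cvg_pair_nbhs f p : {for p, continuous f} ->
  f z.1 @[z --> pair_nbhs p] --> f p /\ f z.2 @[z --> pair_nbhs p] --> f p.
Proof.
move=> /continuous_enormP fp.
by split; apply/cvgrPdist_lt => e e0; have [d d0 hd] := fp e e0;
  exists d => // z [z1 z2]; rewrite /= distrC; apply: hd.
Qed.

Lemma C1_has_slope U f p : open U -> U p -> (forall x, U x -> differentiable f x) ->
  (forall i, {for p, continuous ('D_(delta_mx ord0 i) f)}) ->
  has_slope f p (fun i => 'D_(delta_mx ord0 i) f p).
Proof.
move=> /open_enormP oU Up df cf; have [d0 d00 pU] := oU p Up.
have fp : {for p, continuous f} by apply: differentiable_continuous; exact: df.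
have [h1 h2] := cvg_pair_nbhs fp; split => //.
(* [xi] is a mean value point of the segment. Lying in every ball around [p] that contains both
   ends, it tends to [p] with them, so the partial derivatives at [xi] serve as slopes. *)
pose P (z : 'rV[R]_n * 'rV[R]_n) xi :=
  (enorm (z.1 - p) < d0 /\ enorm (z.2 - p) < d0) ->
  f z.1 - f z.2 = dot (gradient f xi) (z.1 - z.2) /\
  forall d, enorm (z.1 - p) < d -> enorm (z.2 - p) < d -> enorm (xi - p) < d.
have [xi hxi] : {xi & forall z, P z (xi z)}.
  apply: (@choice _ _ P) => -[x y]; rewrite /P /=.
  have [[xd yd]|nz] := pselect (enorm (x - p) < d0 /\ enorm (y - p) < d0); last by exists p.
  have [t t01|t t01 e] := @mvt_segment f x y.
    by apply: df; apply: pU; exact: eball_convex.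
  exists (y + t *: (x - y)) => _; split => // d xd' yd'.
  by apply: eball_convex => //; case/andP: t01 => *; rewrite !ltW.
exists (fun i z => 'D_(delta_mx ord0 i) f (xi z)); split=> [i|].
  apply/cvgrPdist_lt => e e0; have /continuous_enormP/(_ e e0)[d dgt hd] := cf i.
  exists (Num.min d d0); first by rewrite /= lt_min dgt.
  move=> z /=; rewrite !lt_min => -[/andP[a1 a2] /andP[b1 b2]]; rewrite distrC.
  by apply: hd; have [] := hxi z; [|move=> _; apply].
exists d0 => // z /= hz; have [-> _] := hxi z hz.
by apply: eq_bigr => i _; rewrite mxE.
Qed.

Lemma smooth_has_slope U phi p : open U -> U p -> smooth_on U phi ->
  has_slope phi p (fun i => 'D_(delta_mx ord0 i) phi p).
Proof.
move=> oU Up sphi; apply: (C1_has_slope oU Up) => [x Ux|i].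
  exact: smooth_differentiable Ux.
exact: smooth_continuous (smooth_derive _ sphi) Up.
Qed.

Lemma gradient_estimate U phi p e : open U -> U p -> smooth_on U phi -> 0 < e ->
  exists2 d, 0 < d & forall x y, enorm (x - p) < d -> enorm (y - p) < d ->
    `|phi x - phi y - dot (gradient phi p) (x - y)| <= e * enorm (x - y).
Proof.
move=> oU Up sphi e0; have [d d0 hd] := has_slope_estimate (smooth_has_slope oU Up sphi) e0.
exists d => // x y xp yp.
have -> : dot (gradient phi p) (x - y) =
    \sum_i 'D_(delta_mx ord0 i) phi p * (x - y) ord0 i.
  by apply: eq_bigr => i _; rewrite mxE.
exact: hd.
Qed.

(** The mean value theorem in the direction [v] reduces the second difference to an increment of
    ['D_v phi] along [h *: w], to which strict differentiability applies. *)
Lemma second_difference U phi p v w e : open U -> U p -> smooth_on U phi -> 0 < e ->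
  exists2 d, 0 < d & forall h, 0 < h < d ->
    `|phi (p + h *: w + h *: v) - phi (p + h *: w) - (phi (p + h *: v) - phi p)
      - h * (h * 'D_w ('D_v phi) p)| <= e * (h * h).
Proof.
move=> oU Up sphi e0.
have w1 : 0 < enorm w + 1 by rewrite ltr_wpDl ?enorm_ge0.
have vw1 : 0 < enorm v + enorm w + 1 by rewrite ltr_wpDl ?addr_ge0 ?enorm_ge0.
have [d1 d10 hd1] := gradient_estimate oU Up (smooth_derive v sphi) (divr_gt0 e0 w1).
have [d2 d20 pU] := (open_enormP U).1 oU p Up.
exists (Num.min d1 d2 / (enorm v + enorm w + 1)).
  by rewrite divr_gt0// lt_min d10.
move=> h /andP[h0]; rewrite ltr_pdivlMr// lt_min => /andP[hd1' hd2'].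
have near a b : 0 <= a <= 1 -> 0 <= b <= 1 ->
    enorm (p + a *: (h *: w) + b *: (h *: v) - p) <= h * (enorm v + enorm w + 1).
  move=> /andP[a0 a1] /andP[b0 b1]; rewrite -(addrA p) addrAC subrr add0r.
  apply: le_trans (ler_enormD _ _) _; rewrite !enormZ !(gtr0_norm h0) !ger0_norm//.
  have := enorm_ge0 v; have := enorm_ge0 w; move: (enorm v) (enorm w) => s t t0 s0.
  have : h * (a * t) <= h * t by rewrite ler_pM2l//; nra.
  have : h * (b * s) <= h * s by rewrite ler_pM2l//; nra.
  by nra.
have t11 : 0 <= (1 : R) <= 1 by rewrite ler01 lexx.
have t00 : 0 <= (0 : R) <= 1 by rewrite ler01 lexx.
have dphi a b : 0 <= a <= 1 -> 0 <= b <= 1 ->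
    differentiable phi (p + a *: (h *: w) + b *: (h *: v)).
  move=> a01 b01; apply: (smooth_differentiable sphi); apply: pU.
  by apply: le_lt_trans (near _ _ a01 b01) _.
have [|c c01] := @mvt01
   (fun t : R => phi (p + h *: w + t *: (h *: v)) - phi (p + t *: (h *: v)))
   (fun t => 'D_(h *: v) phi (p + h *: w + t *: (h *: v)) - 'D_(h *: v) phi (p + t *: (h *: v))).
  move=> t t01; apply: is_deriveB; apply: line_derive.
    by have := dphi 1 t t11 t01; rewrite scale1r.
  by have := dphi 0 t t00 t01; rewrite scale0r addr0.
rewrite scale1r scale0r !addr0 => e1.
have c01' : 0 <= c <= 1 by case/andP: c01 => *; rewrite !ltW.
rewrite [X in `|X - _|](_ : _ = h * ('D_v phi (p + h *: w + c *: (h *: v)) - 'D_v phi (p + c *: (h *: v)))); last first.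
  transitivity (phi (p + h *: w + h *: v) - phi (p + h *: v) - (phi (p + h *: w) - phi p)).
    by ring.
  have d1' := dphi 1 c t11 c01'; have d0' := dphi 0 c t00 c01'.
  rewrite scale1r in d1'; rewrite scale0r addr0 in d0'.
  by rewrite e1 !derive_gradient// !dotZr mulrBr.
have := hd1 (p + h *: w + c *: (h *: v)) (p + c *: (h *: v)).
have n1 := near 1 c t11 c01'; have n0 := near 0 c t00 c01'.
rewrite scale1r in n1; rewrite scale0r addr0 in n0.
move=> /(_ (le_lt_trans n1 hd1') (le_lt_trans n0 hd1')).
have -> : p + h *: w + c *: (h *: v) - (p + c *: (h *: v)) = h *: w.
  by apply/rowP => i; rewrite !mxE; ring.
move=> H.
have dv : differentiable ('D_v phi) p.
  exact: smooth_differentiable (smooth_derive v sphi) Up.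
rewrite ['D_w _ p]derive_gradient// -(dotZr h) -mulrBr normrM (gtr0_norm h0).
rewrite mulrCA ler_pM2l//; apply: le_trans H _.
rewrite enormZ (gtr0_norm h0) mulrCA [leRHS]mulrC ler_pM2l// -mulrA ger_pMr//.
by rewrite ler_pdivrMl// mulr1 lerDl.
Qed.

(** The second difference is symmetric in [v] and [w], so its two limits agree. *)
Lemma schwarz U phi p v w : open U -> U p -> smooth_on U phi ->
  'D_v ('D_w phi) p = 'D_w ('D_v phi) p.
Proof.
move=> oU Up sphi; apply/eqP; rewrite -subr_eq0 -normr_le0.
apply/ler_addgt0Pr => e e0; rewrite add0r; have e2 : 0 < e / 2 by rewrite divr_gt0.
have [d1 d10 h1] := second_difference v w oU Up sphi e2.
have [d2 d20 h2] := second_difference w v oU Up sphi e2.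
have m0 : 0 < Num.min d1 d2 by rewrite lt_min d10.
have [h [h0 hd1 hd2]] : exists h, [/\ 0 < h, h < d1 & h < d2].
  exists (Num.min d1 d2 / 2).
  have : Num.min d1 d2 / 2 < Num.min d1 d2 by rewrite ltr_pdivrMr// ltr_pMr// ltr1n.
  by rewrite lt_min => /andP[-> ->]; rewrite divr_gt0.
have := h1 h; rewrite h0 hd1 => /(_ isT).
have := h2 h; rewrite h0 hd2 => /(_ isT).
rewrite [p + h *: v + h *: w]addrAC => H2 H1.
move: H1 H2 h0; clear; set P := phi _ - phi _ - _; set Q := phi _ - phi _ - _.
have -> : P = Q by rewrite /P /Q; ring.
move: ('D_v _ _) ('D_w _ _) Q => A B {}Q H1 H2 h0.
have hh : 0 < h * h by rewrite mulr_gt0.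
rewrite -(@ler_pM2l _ (h * h))// -[X in X * `|_|](gtr0_norm hh) -normrM.
rewrite [X in `|X|](_ : _ = (Q - h * (h * B)) - (Q - h * (h * A))); last by ring.
apply: le_trans (ler_normB _ _) _; apply: le_trans (lerD H1 H2) _.
by rewrite -mulrDl -splitr mulrC.
Qed.

Definition hess phi p : 'M[R]_n :=
  \matrix_(i, j) 'D_(delta_mx ord0 i) ('D_(delta_mx ord0 j) phi) p.

Lemma hess_sym U phi p : open U -> U p -> smooth_on U phi -> (hess phi p)^T = hess phi p.
Proof. by move=> oU Up s; apply/matrixP => i j; rewrite !mxE; exact: (schwarz _ _ oU Up s). Qed.

Lemma gradient_sdiff U phi p : open U -> U p -> smooth_on U phi ->
  sdiff (gradient phi) p (hess phi p).
Proof.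
move=> oU Up s; apply: sdiff_components => j.
have := smooth_has_slope oU Up (smooth_derive (delta_mx ord0 j) s); congr has_slope.
  by apply/funext => x; rewrite mxE.
by apply/funext => i; rewrite mxE.
Qed.

(** The full differential of [unit_gradient phi]: the Hessian divided by the norm of the gradient,
    followed by the projection orthogonal to the normal. On tangent vectors it is the shape
    operator. *)
Definition shape phi p : 'M[R]_n := (enorm (gradient phi p))^-1 *:
  (hess phi p *m (1%:M - (unit_gradient phi p)^T *m unit_gradient phi p)).

Lemma unit_gradient_sdiff U phi p : open U -> U p -> smooth_on U phi ->
  gradient phi p != 0 -> sdiff (unit_gradient phi) p (shape phi p).
Proof.
move=> oU Up s g0; apply: sdiff_components => j.
pose g i x := 'D_(delta_mx ord0 i) phi x.
have gs i : has_slope (g i) p (fun k => hess phi p k i).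
  have := smooth_has_slope oU Up (smooth_derive (delta_mx ord0 i) s).
  by apply: hslope_ext => k; rewrite mxE.
have N0 : enorm (gradient phi p) != 0 by rewrite enorm_eq0.
have gg : \sum_i g i p * g i p = dot (gradient phi p) (gradient phi p).
  by apply: eq_bigr => i _; rewrite mxE.
have sq0 : 0 < \sum_i g i p * g i p.
  by rewrite gg lt_def dot_ge0 dot_eq0 g0.
have FF := pair_nbhs_filter p.
have := hslope_sqrt sq0 (hslope_sum (index_enum 'I_n) (fun i => hslopeM (gs i) (gs i))).
move=> /(_ FF FF FF).
have Ne : Num.sqrt (\sum_i g i p * g i p) = enorm (gradient phi p) by rewrite gg.
rewrite Ne => h; have h' := hslopeV N0 h.
have {h'} := hslopeM (h' FF) (gs j) => /(_ FF).
have ue x : unit_gradient phi x ord0 j = (Num.sqrt (\sum_i g i x * g i x))^-1 * g j x.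
  rewrite !mxE /enorm /dot; congr ((Num.sqrt _)^-1 * _); apply: eq_bigr => i _.
  by rewrite !mxE.
rewrite /has_slope ue Ne.
under [X in _ -> hslope _ _ X _ _ _]eq_fun do rewrite ue.
under [X in _ -> hslope _ _ _ X _ _]eq_fun do rewrite ue.
apply: hslope_ext => i; set N := enorm (gradient phi p).
have -> : shape phi p i j = N^-1 * (hess phi p i j -
    N^-1 * N^-1 * g j p * \sum_k g k p * hess phi p i k).
  rewrite /shape mulmxBr mulmx1 mulmxA mxE; congr (_ * _).
  rewrite mxE; congr (_ + _); rewrite mxE; congr (- _).
  rewrite mxE big_ord1 mxE mulr_suml mulr_sumr; apply: eq_bigr => k _.
  by rewrite !mxE -/N /g; ring.
rewrite -/N big_split/= -mulr2n -mulr_natr; set S := \sum_(k < n) _.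
by field.
Qed.

(** The mean value theorem is applied on [0, 1] to [phi (p + t *: v)] minus its candidate Taylor
    polynomial; the resulting derivative is controlled by strict differentiability of the
    gradient. *)
Lemma taylor2 U phi p e : open U -> U p -> smooth_on U phi -> 0 < e ->
  exists2 d, 0 < d & forall v, enorm v < d ->
    `|phi (p + v) - phi p - dot (gradient phi p) v - 2^-1 * dot (v *m hess phi p) v|
      <= e * enorm v ^+ 2.
Proof.
move=> oU Up s e0.
have [d1 d10 hd1] := gradient_sdiff oU Up s e0.
have [d2 d20 pU] := (open_enormP U).1 oU p Up.
exists (Num.min d1 d2); first by rewrite lt_min d10.
move=> v; rewrite lt_min => /andP[v1 v2].
have pv t : 0 <= t <= 1 -> enorm (p + t *: v - p) <= enorm v.
  move=> /andP[t0 t1]; rewrite addrAC subrr add0r enormZ ger0_norm//.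
  by rewrite ler_piMl ?enorm_ge0.
pose A := dot (gradient phi p) v; pose q := dot (v *m hess phi p) v.
have [|c c01] := @mvt01 (fun t : R => phi (p + t *: v) - (A * t + 2^-1 * q * t ^+ 2))
  (fun t => 'D_v phi (p + t *: v) - (A + q * t)).
  move=> t t01; apply: is_deriveB; first apply: line_derive.
    apply: (smooth_differentiable s); apply: pU.
    by apply: le_lt_trans v2; exact: pv.
  by apply: is_derive_eq; rewrite /GRing.scale/=; field.
have c01' : 0 <= c <= 1 by case/andP: c01 => *; rewrite !ltW.
rewrite scale1r scale0r addr0 => E.
have -> : phi (p + v) - phi p - A - 2^-1 * q = 'D_v phi (p + c *: v) - (A + q * c).
  by rewrite -E; ring.
rewrite derive_gradient; last first.
  by apply: (smooth_differentiable s); apply: pU; apply: le_lt_trans v2; exact: pv.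
have := hd1 (p + c *: v) p (le_lt_trans (pv _ c01') v1).
rewrite subrr enorm0 [p + _]addrC addrK => /(_ d10) H.
rewrite [X in `|X|](_ : _ = dot (gradient phi (c *: v + p) - gradient phi p - c *: v *m hess phi p) v); last first.
  by rewrite !dotBl -scalemxAl dotZl -/A -/q; ring.
apply: le_trans (ler_abs_dot _ _) _.
apply: le_trans (ler_wpM2r (enorm_ge0 v) H) _.
rewrite -mulrA ler_pM2l// expr2 ler_wpM2r ?enorm_ge0// enormZ.
case/andP: c01' => a b; rewrite ger0_norm// -[leRHS]mul1r.
by rewrite ler_wpM2r ?enorm_ge0.
Qed.

End calculus.

(** * Charts of the boundary *)

Section charts.
Context {R : realType} {m : nat}.
Local Notation V := 'rV[R]_m.+1.
Implicit Types (Omega U : set V) (phi : V -> R) (p q x y v w : V).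

Lemma enorm_unit_gradient phi p : gradient phi p != 0 -> enorm (unit_gradient phi p) = 1.
Proof.
move=> g0; rewrite /unit_gradient enormZ ger0_norm ?invr_ge0 ?enorm_ge0//.
by rewrite mulVf// enorm_eq0.
Qed.

Lemma gradient_unit_gradient phi p : gradient phi p != 0 ->
  gradient phi p = enorm (gradient phi p) *: unit_gradient phi p.
Proof. by move=> g0; rewrite /unit_gradient scalerA mulfV ?scale1r// enorm_eq0. Qed.

Lemma chart_recenter Omega p q U phi : local_defining_function Omega p U phi -> U q ->
  local_defining_function Omega q U phi.
Proof. by case=> *; split. Qed.

Section at_point.
Variables (Omega U : set V) (phi : V -> R) (p : V).
Hypothesis chart : local_defining_function Omega p U phi.

Let oU : open U. Proof. by case: chart. Qed.
Let Up : U p. Proof. by case: chart. Qed.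
Let sphi : smooth_on U phi. Proof. by case: chart. Qed.
Let g0 : gradient phi p != 0. Proof. by case: chart => _ _ _ h _; exact: h. Qed.
Let OU x : U x -> (Omega x <-> phi x < 0). Proof. by case: chart => _ _ _ _; apply. Qed.

Local Notation nu := (unit_gradient phi p).
Local Notation g := (gradient phi p).

Let nu1 : enorm nu = 1. Proof. exact: enorm_unit_gradient. Qed.
Let N0 : 0 < enorm g. Proof. by rewrite enorm_gt0. Qed.

Lemma chart_ball : exists2 d, 0 < d & forall x, enorm (x - p) < d -> U x.
Proof. by have [d d0 h] := (open_enormP U).1 oU p Up; exists d. Qed.

Lemma phi_continuous_at x : U x -> {for x, continuous phi}.
Proof. exact: smooth_continuous. Qed.

Lemma dot_nu_nu : dot nu nu = 1. Proof. by rewrite -sqr_enorm nu1 expr1n. Qed.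

Lemma dot_gradient_nu v : dot g v = enorm g * dot v nu.
Proof. by rewrite {1}(gradient_unit_gradient g0) dotZl dotC. Qed.

(** To first order [phi (p + t *: v)] is [t * enorm g * dot v nu], and [e] keeps the error below
    half of that; so [v] leaves or enters [Omega] according to the sign of [dot v nu]. *)
Lemma phi_direction v : phi p = 0 -> dot v nu != 0 ->
  exists2 d, 0 < d & forall t, 0 < t < d ->
    [/\ U (p + t *: v) & 0 < phi (p + t *: v) * dot v nu].
Proof.
move=> p0 vn; have [d1 d10 dU] := chart_ball.
have v0 : 0 < enorm v + 1 by rewrite ltr_wpDl ?enorm_ge0.
pose e := enorm g * `|dot v nu| / 2 / (enorm v + 1).
have vn0 : 0 < `|dot v nu| by rewrite normr_gt0.
have e0 : 0 < e by rewrite !divr_gt0// mulr_gt0.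
have [d2 d20 hd] := gradient_estimate oU Up sphi e0.
exists (Num.min d1 d2 / (enorm v + 1)); first by rewrite divr_gt0// lt_min d10.
move=> t /andP[t0]; rewrite ltr_pdivlMr// lt_min => /andP[t1 t2].
have tv : enorm (p + t *: v - p) <= t * (enorm v + 1).
  by rewrite addrAC subrr add0r enormZ gtr0_norm// ler_pM2l// lerDl.
split; first by apply: dU; exact: le_lt_trans t1.
have := hd (p + t *: v) p; rewrite subrr enorm0 => /(_ (le_lt_trans tv t2) d20).
rewrite p0 subr0 addrAC subrr add0r dot_gradient_nu dotZl enormZ (gtr0_norm t0) => H.
have {}H : `|phi (p + t *: v) - enorm g * (t * dot v nu)| <= t * (enorm g * `|dot v nu| / 2).
  apply: le_trans H _; rewrite mulrCA ler_pM2l// /e mulrAC ler_pdivrMr//.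
  by rewrite ler_wpM2l ?lerDl// divr_ge0// mulr_ge0 ?enorm_ge0.
move: H N0 t0 vn0; move: (phi _) (enorm g) (dot v nu) => a b c.
move=> H b0 t0 c0; have bt : 0 < b * t by rewrite mulr_gt0.
move: H; rewrite ler_norml => /andP[H1 H2]; move: c0 H1 H2.
have [c0|c0|<-] := ltgtP 0 c; last by rewrite normr0 ltxx.
- rewrite (gtr0_norm c0) => _ H1 H2; apply: mulr_gt0 => //.
  have : 0 < b * t * c by rewrite mulr_gt0.
  by nra.
- rewrite (ltr0_norm c0) => _ H1 H2; rewrite nmulr_lgt0//.
  have : b * t * c < 0 by rewrite pmulr_rlt0.
  by nra.
Qed.

(** Where [phi] is nonzero its sign is locally constant, which excludes boundary points; from a zero
    of [phi], a small step along [- nu] enters [Omega]. *)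
Lemma chart_boundary : boundary Omega p <-> phi p = 0.
Proof.
have [d0 d00 dU] := chart_ball.
have /continuous_enormP cp := phi_continuous_at Up.
split=> [[cl nint]|p0].
  apply/eqP; rewrite eq_le !leNgt; apply/andP; split; apply/negP => pp.
    have [d dgt hd] := cp _ pp.
    have [|x Ox] := (closure_enormP Omega p).1 cl (Num.min d d0).
      by rewrite lt_min dgt.
    rewrite lt_min => /andP[xd xd0].
    move/(OU (dU _ xd0)): Ox => xn; have := hd x xd.
    by rewrite ltr_norml => /andP[]; lra.
  apply: nint; apply/nbhs_enormP; have [|d dgt hd] := cp (- phi p); first by rewrite oppr_gt0.
  exists (Num.min d d0); first by rewrite lt_min dgt.
  move=> x; rewrite /eball/= lt_min => /andP[xd xd0]; apply/(OU (dU _ xd0)).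
  by have := hd x xd; rewrite ltr_norml => /andP[_]; lra.
split=> [|]; last first.
  by move=> /interior_subset/(OU Up); rewrite p0 ltxx.
apply/closure_enormP => r r0.
have [|d dgt hd] := @phi_direction (- nu) p0; first by rewrite dotNl dot_nu_nu oppr_eq0 oner_eq0.
pose t := Num.min d r / 2.
have t0 : 0 < t by rewrite divr_gt0// lt_min dgt.
have : t < Num.min d r by rewrite /t ltr_pdivrMr ?ltr_pMr ?ltr1n// lt_min dgt.
rewrite lt_min => /andP[td tr].
have [|Ut] := hd t; first by rewrite t0.
rewrite dotNl dot_nu_nu mulrN1 oppr_gt0 => pt; exists (p + t *: - nu).
  exact/(OU Ut).
by rewrite addrAC subrr add0r enormZ enormN nu1 mulr1 gtr0_norm.
Qed.

End at_point.

Section at_boundary.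
Variables (Omega U : set V) (phi : V -> R) (p : V).
Hypothesis chart : local_defining_function Omega p U phi.
Hypothesis bp : boundary Omega p.

Let oU : open U. Proof. by case: chart. Qed.
Let Up : U p. Proof. by case: chart. Qed.
Let sphi : smooth_on U phi. Proof. by case: chart. Qed.
Let g0 : gradient phi p != 0. Proof. by case: chart => _ _ _ h _; exact: h. Qed.
Let OU x : U x -> (Omega x <-> phi x < 0). Proof. by case: chart => _ _ _ _; apply. Qed.

Local Notation nu := (unit_gradient phi p).
Local Notation g := (gradient phi p).

Let nu1 : enorm nu = 1. Proof. exact: enorm_unit_gradient. Qed.
Let N0 : 0 < enorm g. Proof. by rewrite enorm_gt0. Qed.
Let p0 : phi p = 0. Proof. exact/(chart_boundary chart). Qed.
Let nn : dot nu nu = 1. Proof. exact: dot_nu_nu chart. Qed.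

Lemma boundary_at x : U x -> (boundary Omega x <-> phi x = 0).
Proof. by move=> Ux; exact: chart_boundary (chart_recenter chart Ux). Qed.

(** If [w] were not [nu], the direction [w - nu] would have a negative product with [nu], hence
    enter [Omega], and a positive product with [w], against the hypothesis. *)
Lemma support_normal w r : 0 < r -> enorm w = 1 ->
  (forall x, Omega x -> enorm (x - p) < r -> dot (x - p) w <= 0) -> w = nu.
Proof.
move=> r0 w1 hw; apply/eqP/negPn/negP => wn.
have wn0 : 0 < 1 - dot w nu.
  have : 0 < enorm (w - nu) ^+ 2 by rewrite exprn_gt0// enorm_gt0 subr_eq0.
  rewrite sqr_enorm !(dotBl, dotBr) nn -sqr_enorm w1 expr1n (dotC nu); lra.
have vn : dot (w - nu) nu < 0 by rewrite dotBl nn; lra.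
have [|d dgt hd] := phi_direction chart (v := w - nu) p0; first by rewrite lt_eqF.
have v0 : 0 < enorm (w - nu) + 1 by rewrite ltr_wpDl ?enorm_ge0.
pose t := Num.min d (r / (enorm (w - nu) + 1)) / 2.
have t0 : 0 < t by rewrite divr_gt0// lt_min dgt divr_gt0.
have : t < Num.min d (r / (enorm (w - nu) + 1)).
  by rewrite /t ltr_pdivrMr ?ltr_pMr ?ltr1n// lt_min dgt divr_gt0.
rewrite lt_min ltr_pdivlMr// => /andP[td tr].
have [|Ut pt] := hd t; first by rewrite t0.
have Ot : Omega (p + t *: (w - nu)) by apply/(OU Ut); rewrite -(nmulr_lgt0 _ vn).
have e : p + t *: (w - nu) - p = t *: (w - nu) by rewrite addrAC subrr add0r.
have := hw _ Ot; rewrite e enormZ gtr0_norm// dotZl pmulr_rle0// => /(_ _).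
have -> : t * enorm (w - nu) < r.
  by apply: le_lt_trans tr; rewrite ler_pM2l// lerDl.
move=> /(_ isT); rewrite dotBl -sqr_enorm w1 expr1n (dotC nu); lra.
Qed.

(** Intermediate value theorem along the normal: above the tangent vector [v], [phi] is negative at
    height [- e * enorm v] and positive at height [e * enorm v]. *)
Lemma boundary_graph e : 0 < e -> exists2 d, 0 < d & forall v, dot v nu = 0 ->
  enorm v < d -> exists s, `|s| <= e * enorm v /\ boundary Omega (p + v + s *: nu).
Proof.
move=> e0; have [d1 d10 dU] := chart_ball chart.
pose e' := enorm g * e / (1 + e) / 2.
have e1 : 0 < 1 + e by rewrite addr_gt0.
have e'0 : 0 < e' by rewrite !divr_gt0// mulr_gt0.
have [d2 d20 hd] := gradient_estimate oU Up sphi e'0.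
exists (Num.min d1 d2 / (1 + e)); first by rewrite divr_gt0// lt_min d10.
move=> v vn; rewrite ltr_pdivlMr// lt_min => /andP[v1 v2].
have [->|vneq0] := eqVneq v 0.
  by exists 0; rewrite normr0 enorm0 mulr0 scale0r !addr0.
have ev0 : 0 < enorm v by rewrite enorm_gt0.
pose a := e * enorm v.
have a0 : 0 < a by rewrite mulr_gt0.
have near s : `|s| <= a -> enorm (p + v + s *: nu - p) <= enorm v * (1 + e).
  move=> sa; rewrite -(addrA p) addrAC subrr add0r.
  apply: le_trans (ler_enormD _ _) _; rewrite enormZ nu1 mulr1 mulrDr mulr1.
  by rewrite lerD2l mulrC.
have est s : `|s| <= a -> `|phi (p + v + s *: nu) - enorm g * s| <= enorm g * a / 2.
  move=> sa; have := hd (p + v + s *: nu) p.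
  rewrite subrr enorm0 => /(_ (le_lt_trans (near s sa) v2) d20).
  rewrite p0 subr0 => /le_trans; rewrite (dot_gradient_nu chart).
  have -> : dot (p + v + s *: nu - p) nu = s.
    by rewrite -(addrA p) addrAC subrr add0r dotDl dotZl vn nn add0r mulr1.
  apply; apply: le_trans (ler_wpM2l (ltW e'0) (near s sa)) _.
  rewrite le_eqVlt; apply/orP; left; apply/eqP; rewrite /e' /a; field.
  by rewrite gt_eqF.
have aa : - a <= a by lra.
have normLe s : - a <= s <= a -> `|s| <= a by rewrite ler_norml.
have cont : {within `[- a, a], continuous (fun s : R => phi (p + v + s *: nu))}.
  apply: derivable_within_continuous => s; rewrite in_itv/= => /normLe sa.
  have Us : U (p + v + s *: nu) by apply: dU; exact: le_lt_trans (near s sa) v1.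
  by have [] := line_derive (smooth_differentiable sphi Us).
have la : phi (p + v + (- a) *: nu) < 0.
  have := est (- a); rewrite normrN (gtr0_norm a0) => /(_ (lexx _)).
  have := mulr_gt0 N0 a0; rewrite ler_norml => h /andP[]; rewrite mulrN; lra.
have ra : 0 < phi (p + v + a *: nu).
  have := est a; rewrite (gtr0_norm a0) => /(_ (lexx _)).
  have := mulr_gt0 N0 a0; rewrite ler_norml => h /andP[]; lra.
have [|s sa ps] := IVT aa cont (v := 0).
  by rewrite ge_min le_max (ltW la) (ltW ra) orbT.
rewrite in_itv/= in sa; have {}sa := normLe s sa.
exists s; split=> //; apply/boundary_at => //.
by apply: dU; exact: le_lt_trans (near s sa) v1.
Qed.

Lemma boundary_tangency e : 0 < e -> exists2 d, 0 < d & forall x y,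
  boundary Omega x -> boundary Omega y -> enorm (x - p) < d -> enorm (y - p) < d ->
  `|dot (x - y) nu| <= e * enorm (x - y).
Proof.
move=> e0; have [d1 d10 dU] := chart_ball chart.
have [d2 d20 hd] := gradient_estimate oU Up sphi (mulr_gt0 N0 e0).
exists (Num.min d1 d2); first by rewrite lt_min d10.
move=> x y bx by_; rewrite !lt_min => /andP[x1 x2] /andP[y1 y2].
have := hd x y x2 y2.
rewrite (boundary_at (dU _ x1)).1// (boundary_at (dU _ y1)).1// subrr sub0r normrN.
by rewrite (dot_gradient_nu chart) normrM gtr0_norm// -mulrA ler_pM2l.
Qed.

(** A boundary point above [t *: v] replaces [p + t *: v] with an error that is small compared with
    [t]. Applied to the difference of two extensions of the normal field, this gives them the same
    tangential derivative. *)
Lemma tangent_derivative0 {k : nat} (f : V -> 'rV[R]_k) (J : 'M[R]_(m.+1, k)) r v :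
  sdiff f p J -> 0 < r -> (forall x, boundary Omega x -> enorm (x - p) < r -> f x = 0) ->
  dot v nu = 0 -> v *m J = 0.
Proof.
move=> fJ r0 f0 vn; apply/eqP; rewrite -enorm_eq0 eq_le enorm_ge0 andbT.
have [C [C0 hC]] := mulmx_lipschitz J.
apply/ler_addgt0Pr => e e0; rewrite add0r.
have v1 : 0 < enorm v + 1 by rewrite ltr_wpDl ?enorm_ge0.
have K0 : 0 < (C + 2) * (enorm v + 1) by rewrite mulr_gt0// ltr_wpDl.
(* In [C + 2], the 2 comes from [enorm (x - p) <= 2 * (t * enorm v)] in the estimate for [f], and
   [C] from applying [J] to the normal offset of [x]. *)
pose a := Num.min 1 (e / ((C + 2) * (enorm v + 1))).
have a0 : 0 < a by rewrite lt_min ltr01 divr_gt0.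
have a1 : a <= 1 by rewrite ge_min lexx.
have ae : a * ((C + 2) * (enorm v + 1)) <= e.
  by rewrite -ler_pdivlMr// ge_min lexx orbT.
have [d1 d10 hd1] := fJ a a0; have [d2 d20 hd2] := boundary_graph a0.
have M0 : 0 < Num.min d2 (Num.min d1 r) by rewrite !lt_min d20 d10.
pose t := Num.min d2 (Num.min d1 r) / (2 * (enorm v + 1)).
have t0 : 0 < t by rewrite divr_gt0// mulr_gt0.
have tv2 : 2 * (t * enorm v) < Num.min d2 (Num.min d1 r).
  rewrite /t mulrCA mulrAC ltr_pdivrMr; last by rewrite mulr_gt0.
  by have := enorm_ge0 v; move: (Num.min _ _) M0 (enorm v) => M M_ b; nra.
have tv : enorm (t *: v) = t * enorm v by rewrite enormZ gtr0_norm.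
have tvpos : 0 <= t * enorm v by rewrite mulr_ge0 ?enorm_ge0// ltW.
have /andP[l1] : (2 * (t * enorm v) < d2) && (2 * (t * enorm v) < Num.min d1 r).
  by rewrite -lt_min.
rewrite lt_min => /andP[l2 l3].
have [||s [sa bs]] := hd2 (t *: v); [by rewrite dotZl vn mulr0|by rewrite tv; lra|].
set x := p + t *: v + s *: nu in bs.
have xp : x - p = t *: v + s *: nu by rewrite /x -(addrA p) addrAC subrr add0r.
have xpl : enorm (x - p) <= 2 * (t * enorm v).
  rewrite xp; apply: le_trans (ler_enormD _ _) _; rewrite tv enormZ nu1 mulr1.
  by apply: le_trans (lerD (lexx _) sa) _; rewrite tv; nra.
have := hd1 x p (le_lt_trans xpl l2); rewrite subrr enorm0 => /(_ d10).
rewrite f0//; last exact: le_lt_trans xpl l3.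
rewrite f0// ?subrr ?enorm0// sub0r enormN => H.
have : enorm (t *: (v *m J)) <= a * (2 * (t * enorm v)) + a * (t * enorm v) * C.
  have -> : t *: (v *m J) = (x - p) *m J - s *: (nu *m J).
    by rewrite xp mulmxDl -(scalemxAl s) -(scalemxAl t) addrK.
  apply: le_trans (ler_enormB _ _) _; apply: lerD.
    by apply: le_trans H _; rewrite ler_wpM2l// ltW.
  rewrite enormZ; apply: ler_pM; rewrite ?enorm_ge0//; first by rewrite -tv.
  by apply: le_trans (hC _) _; rewrite nu1 mulr1.
rewrite enormZ gtr0_norm// => {}H.
rewrite -(ler_pM2l t0); apply: le_trans H _.
apply: (@le_trans _ _ (t * (a * ((C + 2) * (enorm v + 1))))); last by rewrite ler_pM2l.
have -> : a * (2 * (t * enorm v)) + a * (t * enorm v) * C = t * (a * ((C + 2) * enorm v)).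
  by ring.
by rewrite !ler_pM2l// ?lerDl// ltr_wpDl.
Qed.

Lemma shape_normal : shape phi p *m nu^T = 0.
Proof.
rewrite /shape -scalemxAl -mulmxA mulmxBl mul1mx -mulmxA.
have -> : nu *m nu^T = 1%:M.
  by apply/matrixP => i j; rewrite !ord1 -dotE nn mxE eqxx.
by rewrite mulmx1 subrr mulmx0 scaler0.
Qed.

Lemma dot_shape v w : dot w nu = 0 ->
  dot (v *m shape phi p) w = (enorm g)^-1 * dot (v *m hess phi p) w.
Proof.
move=> wn; rewrite /shape -scalemxAr dotZl; congr (_ * _).
rewrite mulmxA mulmxBr mulmx1 dotBl [X in _ - X](_ : _ = 0) ?subr0//.
rewrite mulmxA dot_mul_tr (_ : w *m nu^T = 0) ?dot0r//.
by apply/matrixP => i j; rewrite !ord1 -dotE wn mxE.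
Qed.

Lemma shape_derive v : 'D_v (unit_gradient phi) p = v *m shape phi p.
Proof. exact: sdiff_derive (unit_gradient_sdiff oU Up sphi g0). Qed.

(** If the boundary near [p] stays on one side of its tangent plane with a quadratic gap [c], the
    normal curvatures towards that side are at least [2 * c]. The case [c = 0] is a supporting
    hyperplane; [c = 1 / (2 * rho)] comes from an enclosing sphere of radius [rho]. The sign [sg]
    tells whether the outer normal or its opposite is used. *)
Lemma second_order_contact sg c r v : sg ^+ 2 = 1 -> 0 <= c -> 0 < r ->
  (forall x, boundary Omega x -> enorm (x - p) < r ->
     dot (x - p) (sg *: nu) <= - c * enorm (x - p) ^+ 2) ->
  dot v nu = 0 -> enorm v = 1 ->
  2 * c <= sg * dot (v *m shape phi p) v.
Proof.
move=> sg2 c0 r0 hx vn v1; rewrite dot_shape//.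
set H := hess phi p.
have HT : H^T = H by exact: hess_sym sphi.
pose A := `|dot (v *m H) nu|; pose B := `|dot (nu *m H) nu|.
have A0 : 0 <= A by exact: normr_ge0.
have B0 : 0 <= B by exact: normr_ge0.
have [d3 d30 dU] := chart_ball chart.
rewrite mulrCA -ler_pdivrMl ?invr_gt0// invrK.
apply/ler_addgt0Pr => e' e'0.
have K0 : 0 < 2 * (A + B + 2) by lra.
(* The height [s] above [t *: v] is at most [e * t], so the mixed and normal Hessian terms are of
   size [e * t ^+ 2] times [A] and [B]; the added 2 absorbs the Taylor remainder. *)
pose e := Num.min 1 (e' / (2 * (A + B + 2))).
have e0 : 0 < e by rewrite lt_min ltr01 divr_gt0.
have e1 : e <= 1 by rewrite ge_min lexx.
have ee : e * (2 * (A + B + 2)) <= e'.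
  by rewrite -ler_pdivlMr// ge_min lexx orbT.
have [d1 d10 hd1] := taylor2 oU Up sphi e0; have [d2 d20 hd2] := boundary_graph e0.
have M0 : 0 < Num.min d2 (Num.min d1 (Num.min r d3)) by rewrite !lt_min d20 d10 r0.
have [t t0 t2] : exists2 t, 0 < t & 2 * t < Num.min d2 (Num.min d1 (Num.min r d3)).
  exists (Num.min d2 (Num.min d1 (Num.min r d3)) / 4); first by rewrite divr_gt0.
  by move: (Num.min _ _) M0 => M M0; lra.
move: t2; rewrite !lt_min => /and4P[l1 l2 l3 l4].
have tv : enorm (t *: v) = t by rewrite enormZ gtr0_norm// v1 mulr1.
have [||s [sa bs]] := hd2 (t *: v); [by rewrite dotZl vn mulr0|by rewrite tv; lra|].
rewrite tv in sa; set x := p + t *: v + s *: nu in bs.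
have xp : x - p = t *: v + s *: nu by rewrite /x -(addrA p) addrAC subrr add0r.
have xpl : enorm (x - p) <= 2 * t.
  rewrite xp; apply: le_trans (ler_enormD _ _) _; rewrite tv enormZ nu1 mulr1.
  by nra.
have xp2 : enorm (x - p) ^+ 2 = t ^+ 2 + s ^+ 2.
  rewrite sqr_enorm xp !(dotDl, dotDr) !(dotZl t, dotZl s, dotZr t, dotZr s) nn (dotC nu) vn -sqr_enorm v1.
  by ring.
have := hd1 (x - p) (le_lt_trans xpl l2); have := hx x bs (le_lt_trans xpl l3).
have Ux : phi (p + (x - p)) = 0.
  rewrite subrKC; apply/boundary_at => //.
  by apply: dU; exact: le_lt_trans xpl l4.
rewrite Ux p0 xp2 (dot_gradient_nu chart) (dotZr sg).
have -> : dot (x - p) nu = s by rewrite xp dotDl (dotZl t) (dotZl s) vn nn; ring.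
have -> : dot ((x - p) *m H) (x - p) =
    t ^+ 2 * dot (v *m H) v + 2 * t * s * dot (v *m H) nu + s ^+ 2 * dot (nu *m H) nu.
  have sym : dot (nu *m H) v = dot (v *m H) nu by rewrite dot_mul_tr HT dotC.
  by rewrite xp mulmxDl -(scalemxAl t) -(scalemxAl s) !(dotDl, dotDr) !(dotZl t, dotZl s, dotZr t, dotZr s) sym; ring.
move: N0 sa t0 e0 e1 ee sg2 c0 A0 B0; rewrite /A /B.
move: (dot (v *m H) v) (dot (v *m H) nu) (dot (nu *m H) nu) (enorm g) => q al be b.
clear; move=> b0 sa t0 e0 e1 ee sg2 c0 A0 B0 h1 h2.
set T := t ^+ 2 in h1 h2 *; have T0 : 0 < T by rewrite exprn_gt0.
have S1 : s ^+ 2 <= e * T.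
  have : `|s| ^+ 2 <= (e * t) ^+ 2 by rewrite ler_pXn2r ?nnegrE ?mulr_ge0// ltW.
  rewrite real_normK ?num_real// => /le_trans; apply.
  by rewrite exprMn expr2 -mulrA ler_piMl// mulr_ge0 ?ltW.
have S2 : `|t * s * al| <= e * T * `|al|.
  rewrite 2!normrM (gtr0_norm t0) ler_wpM2r// /T expr2 mulrCA ler_pM2l//.
have S3 : `|s ^+ 2 * be| <= e * T * `|be|.
  by rewrite normrM ler_wpM2r// ger0_norm ?sqr_ge0.
have S4 : e * s ^+ 2 <= e * T.
  rewrite ler_pM2l//; apply: le_trans S1 _; rewrite ler_piMl// ltW//.
have S5 : e * T * (2 * (`|al| + `|be| + 2)) <= T * e'.
  by rewrite mulrAC [leRHS]mulrC ler_pM2r.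
have S6 : 0 <= e * T * `|be| by apply: mulr_ge0 => //; apply: mulr_ge0; exact: ltW.
rewrite -(ler_pM2l T0).
have hb : b * (sg * s) <= - (T * (b * c)).
  have h : sg * s <= - c * T.
    by apply: le_trans h1 _; rewrite mulrDr gerDl mulNr oppr_le0 mulr_ge0 ?sqr_ge0.
  by rewrite (_ : - _ = b * (- c * T)) ?ler_pM2l//; ring.
move: S2 S3 h2; rewrite !ler_norml => /andP[S2 S2'] /andP[S3 S3'] /andP[h2 h2'].
have : sg = 1 \/ sg = -1.
  by move/eqP: sg2; rewrite sqrf_eq1 => /orP[] /eqP ->; [left|right].
rewrite mulrDr in h2 h2'; rewrite !mulrDr in S5; rewrite mulrDr.
by move=> [] sge; rewrite sge in hb *; lra.
Qed.

End at_boundary.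
End charts.

(** * Mean curvature as the trace of the shape operator *)

Section mean_curvature.
Context {R : realType} {m : nat}.
Local Notation V := 'rV[R]_m.+1.
Implicit Types (Omega U : set V) (phi psi : V -> R) (p q x y v w : V).

Lemma sdiffB {k : nat} (f h : V -> 'rV[R]_k) p J J' : sdiff f p J -> sdiff h p J' ->
  sdiff (fun x => f x - h x) p (J - J').
Proof.
move=> fJ hJ e e0; have e2 : 0 < e / 2 by rewrite divr_gt0.
have [d1 d10 h1] := fJ _ e2; have [d2 d20 h2] := hJ _ e2.
exists (Num.min d1 d2); first by rewrite lt_min d10.
move=> x y; rewrite !lt_min => /andP[x1 x2] /andP[y1 y2].
have -> : f x - h x - (f y - h y) - (x - y) *m (J - J') =
    (f x - f y - (x - y) *m J) - (h x - h y - (x - y) *m J').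
  by rewrite mulmxBr; move: (_ *m J) (_ *m J') => a b; apply/rowP => i; rewrite !mxE; ring.
apply: le_trans (ler_enormB _ _) _; apply: le_trans (lerD (h1 _ _ x1 y1) (h2 _ _ x2 y2)) _.
by rewrite -mulrDl -splitr.
Qed.

(** If the two normals [a] and [b] differed, a small step along [b - a] would enter [Omega]
    according to one chart and leave it according to the other. *)
Lemma unit_gradient_indep Omega U U' phi psi p :
  local_defining_function Omega p U phi -> local_defining_function Omega p U' psi ->
  boundary Omega p -> unit_gradient phi p = unit_gradient psi p.
Proof.
move=> ch ch' bp.
have p0 : phi p = 0 by apply/(chart_boundary ch).
have q0 : psi p = 0 by apply/(chart_boundary ch').
have [_ _ _ _ OU] := ch; have [_ _ _ _ OU'] := ch'.
have nn := dot_nu_nu ch; have nn' := dot_nu_nu ch'.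
move: (unit_gradient phi p) (unit_gradient psi p) nn nn'
  (fun v => phi_direction ch (v := v) p0) (fun v => phi_direction ch' (v := v) q0).
move=> a b aa bb ha hb; apply/eqP/negPn/negP => ab.
have c1 : dot a b < 1.
  have : 0 < enorm (a - b) ^+ 2 by rewrite exprn_gt0// enorm_gt0 subr_eq0.
  by rewrite sqr_enorm !(dotBl, dotBr) aa bb (dotC b); lra.
have va : dot (b - a) a < 0 by rewrite dotBl aa (dotC b); lra.
have vb : 0 < dot (b - a) b by rewrite dotBl bb; lra.
have [|d1 d10 h1] := ha (b - a); first by rewrite lt_eqF.
have [|d2 d20 h2] := hb (b - a); first by rewrite gt_eqF.
have m0 : 0 < Num.min d1 d2 by rewrite lt_min d10.
pose t := Num.min d1 d2 / 2.
have t0 : 0 < t by rewrite divr_gt0.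
have : t < Num.min d1 d2 by rewrite /t ltr_pdivrMr// ltr_pMr// ltr1n.
rewrite lt_min => /andP[t1 t2].
have [|U1 P1] := h1 t; first by rewrite t0.
have [|U2 P2] := h2 t; first by rewrite t0.
rewrite nmulr_lgt0// in P1; rewrite pmulr_lgt0// in P2.
by move/(OU _ U1)/(OU' _ U2): P1; rewrite ltNge (ltW P2).
Qed.

Section at_boundary.
Variables (Omega U : set V) (phi : V -> R) (p : V).
Hypothesis chart : local_defining_function Omega p U phi.
Hypothesis bp : boundary Omega p.
Local Notation nu := (unit_gradient phi p).
Local Notation J := (shape phi p).

Let oU : open U. Proof. by case: chart. Qed.
Let Up : U p. Proof. by case: chart. Qed.
Let sphi : smooth_on U phi. Proof. by case: chart. Qed.
Let g0 : gradient phi p != 0. Proof. by case: chart => _ _ _ h _; exact: h. Qed.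
Let nu1 : enorm nu = 1. Proof. exact: enorm_unit_gradient. Qed.

Lemma normal_tangential_derivative (f : V -> V) J' r v : sdiff f p J' -> 0 < r ->
  (forall x U' psi, boundary Omega x -> enorm (x - p) < r ->
     local_defining_function Omega x U' psi -> f x = unit_gradient psi x) ->
  dot v nu = 0 -> v *m J' = v *m J.
Proof.
move=> fJ r0 fE vn; have [d d0 dU] := chart_ball chart.
apply/eqP; rewrite -subr_eq0 -mulmxBr; apply/eqP.
have sh := sdiffB fJ (unit_gradient_sdiff oU Up sphi g0).
have m0 : 0 < Num.min r d by rewrite lt_min r0.
apply: (tangent_derivative0 chart bp sh m0 _ vn) => x bx.
rewrite lt_min => /andP[xr xd]; apply/eqP; rewrite subr_eq0; apply/eqP.
by apply: fE => //; apply: chart_recenter chart _; exact: dU.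
Qed.

Lemma shape_frame (e : 'M[R]_(m, m.+1)) : e *m e^T = 1%:M ->
  (forall i, dot (row i e) nu = 0) -> J = J *m e^T *m e.
Proof.
move=> ee en; apply/row_matrixP => i; rewrite 2!row_mul.
rewrite {1}(frame_decomp (row i J) ee en nu1).
have -> : dot (row i J) nu = (J *m nu^T) i ord0.
  by rewrite dotE -row_mul mxE.
by rewrite (shape_normal chart) mxE scale0r addr0.
Qed.

Lemma curvature_sum (e : 'M[R]_(m, m.+1)) (k : 'rV[R]_m) : e *m e^T = 1%:M ->
  (forall i, dot (row i e) nu = 0) -> (forall i, row i e *m J = k ord0 i *: row i e) ->
  \sum_i k ord0 i = \tr J.
Proof.
move=> ee en ek; rewrite (shape_frame ee en) mxtrace_mulC mulmxA /mxtrace.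
apply: eq_bigr => i _.
have -> : (e *m J *m e^T) i i = (row i e *m J *m e^T) ord0 i by rewrite -!row_mul [RHS]mxE.
by rewrite ek mul_trE dotZl dot_rows// eqxx mulr1.
Qed.

(** Between tangent vectors the projection in [shape] disappears, so its compression to the tangent
    space is a multiple of the compressed Hessian; this is symmetric and can be diagonalized. *)
Lemma curvature_frame : exists (e : 'M[R]_(m, m.+1)) (k : 'rV[R]_m),
  [/\ e *m e^T = 1%:M, forall i, dot (row i e) nu = 0 &
      forall i, row i e *m J = k ord0 i *: row i e].
Proof.
have [e ee en] := orthonormal_completion nu1.
have ne : nu *m e^T = 0 by apply/rowP => i; rewrite mul_trE dotC en mxE.
pose A := e *m J *m e^T.
have AE : A = (enorm (gradient phi p))^-1 *: (e *m hess phi p *m e^T).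
  rewrite /A /shape -scalemxAr -scalemxAl; congr (_ *: _).
  rewrite -!mulmxA; congr (_ *m (_ *m _)).
  by rewrite mulmxBl mul1mx -mulmxA ne mulmx0 subr0.
have [|Q [k [QQ Qk]]] := @symmetric_diagonalizable R m A.
  rewrite AE linearZ/=; congr (_ *: _).
  by rewrite !trmx_mul trmxK (hess_sym oU Up sphi) mulmxA.
exists (Q *m e), k; split.
- by rewrite trmx_mul mulmxA -(mulmxA Q) ee mulmx1.
- by move=> i; rewrite row_mul dot_frame_normal.
move=> i; rewrite row_mul {1}(shape_frame ee en) !mulmxA.
have -> : row i Q *m e *m J *m e^T = row i Q *m A by rewrite /A !mulmxA.
by rewrite Qk scalemxAl.
Qed.

Lemma principal_curvature_shape k : principal_curvatures Omega p k ->
  exists e : 'M[R]_(m, m.+1), [/\ e *m e^T = 1%:M, forall i, dot (row i e) nu = 0 &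
    forall i, row i e *m J = k ord0 i *: row i e].
Proof.
move=> [U' [psi [e [ch' ee en ek]]]]; have uE := unit_gradient_indep ch' chart bp.
exists e; split=> // [i|i]; first by rewrite -uE.
rewrite -ek; have [oU' Up' sp' gp' _] := ch'.
have gp0 : gradient psi p != 0 by exact: gp'.
rewrite (shape_derive ch'); have [d d0 dU] := chart_ball ch'.
symmetry.
apply: (normal_tangential_derivative (unit_gradient_sdiff oU' Up' sp' gp0) d0).
  move=> x W chi bx xd chx; apply: unit_gradient_indep chx bx.
  by apply: chart_recenter ch' _; exact: dU.
by rewrite -uE.
Qed.

(** Every family of principal curvatures sums to the trace, and [curvature_frame] provides a family,
    so [xget] does not fall back on its default 0. *)
Lemma mean_curvatureE : mean_curvature Omega p = \tr J.
Proof.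
rewrite /mean_curvature; set S := [set _ | _ in _].
have SE s : S s -> s = \tr J.
  move=> [k pk <-]; have [e [ee en ek]] := principal_curvature_shape pk.
  exact: curvature_sum ek.
apply: SE; apply: xgetPex; have [e [k [ee en ek]]] := curvature_frame.
exists (\sum_i k ord0 i), k => //; exists U, phi, e; split=> // i.
by rewrite (shape_derive chart).
Qed.

End at_boundary.

(** One chart serves all nearby boundary points; in it [H] is the trace of [shape phi], whose
    continuity at [p] comes from strict differentiability. *)
Lemma mean_curvature_continuous_at Omega U phi p e :
  local_defining_function Omega p U phi -> boundary Omega p -> 0 < e ->
  exists2 d, 0 < d & forall q, boundary Omega q -> enorm (q - p) < d ->
    `|mean_curvature Omega q - mean_curvature Omega p| < e.
Proof.
move=> chart bp e0; pose e' := e / m.+2%:R.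
have e'0 : 0 < e' by rewrite divr_gt0.
have [d1 d10 dU] := chart_ball chart.
have [oU Up sphi g0 _] := chart.
have [d2 d20 hd] := sdiff_near (unit_gradient_sdiff oU Up sphi (g0 _ Up)) e'0.
exists (Num.min d1 d2); first by rewrite lt_min d10.
move=> q bq; rewrite lt_min => /andP[q1 q2].
have Uq := dU _ q1; have chq := chart_recenter chart Uq.
have h := hd q _ q2 (unit_gradient_sdiff oU Uq sphi (g0 _ Uq)).
rewrite (mean_curvatureE chq bq) (mean_curvatureE chart bp) /mxtrace -sumrB.
apply: le_lt_trans (ler_norm_sum _ _ _) _.
apply: (@le_lt_trans _ _ (\sum_(i < m.+1) e')).
  apply: ler_sum => i _; have := h (delta_mx ord0 i).
  move: (shape phi q) (shape phi p) => A B.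
  rewrite enorm_delta mulr1 -2!rowE; apply: le_trans.
  have := coord_le_enorm (row i A - row i B) i.
  by rewrite 4!mxE.
rewrite sumr_const card_ord -mulr_natl /e' mulrA ltr_pdivrMr// mulrC ltr_pM2l//.
by rewrite ltr_nat.
Qed.

End mean_curvature.

Section compact_covers.
Context {R : realType} {n : nat}.
Implicit Types (K : set 'rV[R]_n).

Lemma compact_eball_cover K (P : 'rV[R]_n -> R -> Prop) : compact K ->
  (forall p, K p -> exists2 r, 0 < r & P p r) ->
  exists s : seq ('rV[R]_n * R),
    (forall z, z \in s -> [/\ K z.1, 0 < z.2 & P z.1 z.2]) /\
    forall x, K x -> exists2 z, z \in s & eball z.1 z.2 x.
Proof.
rewrite compact_cover => cK hK.
pose D := [set z : 'rV[R]_n * R | [/\ K z.1, 0 < z.2 & P z.1 z.2]].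
have [||D' D'D KD'] := @cK _ D (fun z => eball z.1 z.2).
- by move=> z _; exact: open_eball.
- move=> x Kx; have [r r0 Pr] := hK x Kx; exists (x, r); first by split.
  exact: eball_center.
exists (finmap.enum_fset D'); split=> [z /D'D|x /KD'[z zD' xz]]; first by rewrite inE.
by exists z.
Qed.

Lemma compact_proj {k : nat} (e : 'M[R]_(n, k)) K : compact K ->
  compact ((fun x : 'rV[R]_n => x *m e) @` K).
Proof.
move=> cK; apply: continuous_compact => //; apply: continuous_subspaceT => x.
apply/continuous_enormP => d d0.
have [C [C0 hC]] := mulmx_lipschitz e.
exists (d / (C + 1)); first by rewrite divr_gt0// ltr_wpDl.
move=> y; rewrite ltr_pdivlMr ?ltr_wpDl// => yx.
rewrite -mulmxBl; apply: le_lt_trans (norm_le_enorm _) _.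
apply: le_lt_trans (hC _) _; apply: le_lt_trans yx.
by rewrite mulrC ler_wpM2l ?enorm_ge0// lerDl.
Qed.

End compact_covers.

Section dilation_norm.
Context {R : realType} {m : nat}.

Lemma dilationB (l : 'I_m -> R) x y : dilation l (x - y) = dilation l x - dilation l y.
Proof. by apply/rowP => i; rewrite !mxE mulrBr. Qed.

Lemma enorm_dilation_le (l l' : 'I_m -> R) x : (forall i, 0 <= l i <= l' i) ->
  enorm (dilation l x) <= enorm (dilation l' x).
Proof.
move=> ll'; rewrite /enorm ler_wsqrtr//; apply: ler_sum => i _; rewrite !mxE -!expr2.
have /andP[l0 l1] := ll' i; rewrite !exprMn ler_wpM2r ?sqr_ge0//.
by rewrite ler_pXn2r// nnegrE// (le_trans l0).
Qed.

Lemma dilation_frame {n : nat} (e : 'M[R]_(m, n)) (J : 'M[R]_n) (k : 'rV[R]_m) y :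
  (forall i, row i e *m J = k ord0 i *: row i e) ->
  y *m e *m J = dilation (fun i => k ord0 i) y *m e.
Proof.
move=> ek; rewrite -mulmxA !mulmx_sum_row; apply: eq_bigr => i _.
by rewrite row_mul ek scalerA mxE mulrC.
Qed.

End dilation_norm.

(** * Area of small boundary patches and of their Gauss images *)

Section patches.
Context {R : realType} {m : nat}.
Local Notation V := 'rV[R]_m.+1.
Variables (Omega U : set V) (phi : V -> R) (p : V).
Hypothesis chart : local_defining_function Omega p U phi.
Hypothesis bp : boundary Omega p.
Local Notation nu := (unit_gradient phi p).
Local Notation J := (shape phi p).
Variable e : 'M[R]_(m, m.+1).
Hypothesis ee : e *m e^T = 1%:M.
Hypothesis en : forall i, dot (row i e) nu = 0.

Let oU : open U. Proof. by case: chart. Qed.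
Let Up : U p. Proof. by case: chart. Qed.
Let sphi : smooth_on U phi. Proof. by case: chart. Qed.
Let g0 : gradient phi p != 0. Proof. by case: chart => _ _ _ h _; exact: h. Qed.
Let nu1 : enorm nu = 1. Proof. exact: enorm_unit_gradient. Qed.

Lemma patch_surjective r : 0 < r -> exists2 d, 0 < d & forall y : 'rV[R]_m,
  enorm y < d -> exists x, [/\ boundary Omega x, enorm (x - p) < r & (x - p) *m e^T = y].
Proof.
move=> r0; have [d d0 hd] := boundary_graph chart bp ltr01.
exists (Num.min d (r / 2)); first by rewrite lt_min d0 divr_gt0.
move=> y; rewrite lt_min => /andP[yd yr].
have [||s [sy bs]] := hd (y *m e); [exact: dot_frame_normal|by rewrite enorm_frame|].
rewrite mul1r enorm_frame// in sy.
have xp : p + y *m e + s *: nu - p = y *m e + s *: nu.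
  by rewrite -(addrA p) addrAC subrr add0r.
exists (p + y *m e + s *: nu); split=> //; rewrite xp.
  apply: le_lt_trans (ler_enormD _ _) _; rewrite enorm_frame// enormZ nu1 mulr1.
  by apply: le_lt_trans (lerD (lexx _) sy) _; lra.
have ne : nu *m e^T = 0 by apply/rowP => i; rewrite mul_trE dotC en mxE.
by rewrite mulmxDl -mulmxA ee mulmx1 -(scalemxAl s) ne scaler0 addr0.
Qed.

(** With tangency constant 1/2 the normal part of [x - y] carries at most a quarter of its squared
    length. The tangential projection, already a contraction, is thus bi-Lipschitz on a small
    patch. *)
Lemma patch_injective : exists2 d, 0 < d & forall x y, boundary Omega x ->
  boundary Omega y -> enorm (x - p) < d -> enorm (y - p) < d ->
  enorm (x - y) <= 2 * enorm ((x - y) *m e^T).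
Proof.
have h2 : 0 < 2^-1 :> R by rewrite invr_gt0.
have [d d0 hd] := boundary_tangency chart h2.
exists d => // x y bx by_ xd yd; have := hd x y bx by_ xd yd.
have := frame_pythagoras (x - y) ee en nu1.
have := enorm_ge0 (x - y); have := enorm_ge0 ((x - y) *m e^T).
move: (enorm (x - y)) (enorm _) (dot _ _) => a b c b0 a0 e1.
move=> ca; have : `|c| ^+ 2 <= (2^-1 * a) ^+ 2.
  by rewrite ler_pXn2r// nnegrE// mulr_ge0// invr_ge0.
rewrite real_normK ?num_real// => c2.
rewrite -(@ler_pXn2r _ 2)// ?nnegrE ?mulr_ge0//.
by move: c2 e1; rewrite !exprMn; have := sqr_ge0 b; lra.
Qed.

(** The tangential projection is a contraction and its image of the patch contains a box, which has
    positive measure. *)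
Lemma hausdorff_patch_gt0 r : 0 < r ->
  (0 < hausdorff m (boundary Omega `&` eball p r))%E.
Proof.
move=> r0; have [d d0 hd] := patch_surjective r0.
pose A := boundary Omega `&` eball p r.
pose s := d / m.+1%:R; have s0 : 0 < s by rewrite divr_gt0.
have : (0 < hausdorff m (box (fun _ : 'I_m => 0%R) (fun=> s)))%E by exact: hausdorff_box_gt0.
move/lt_le_trans; apply.
apply: (@le_trans _ _ (hausdorff m ((fun x => (x - p) *m e^T) @` A))).
  apply: hausdorff_mono => y ys.
  have yd : enorm y < d.
    apply: (@le_lt_trans _ _ (m%:R * s)).
      apply: enorm_le_bound => i; have /andP[y0] := ys i; rewrite add0r => y1.
      by rewrite ger0_norm// ltW.
    by rewrite /s mulrA ltr_pdivrMr// mulrC ltr_pM2l// ltr_nat.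
  by have [x [bx xr <-]] := hd y yd; exists x.
rewrite -/A -[X in (_ <= hausdorff _ X)%E](image_id A).
apply: hausdorff_contraction => x y _ _.
by rewrite -mulmxBl opprB addrA subrK enorm_proj_le.
Qed.

Lemma hausdorff_patch_fin : exists2 d, 0 < d &
  (hausdorff m (boundary Omega `&` eball p d) < +oo)%E.
Proof.
have [d d0 hd] := patch_injective; exists d => //.
pose A := boundary Omega `&` eball p d.
have h : (hausdorff m (id @` A) <= (2 ^+ m)%:E * hausdorff m ((fun x => (x - p) *m e^T) @` A))%E.
  apply: le_hausdorff_lipschitz => // x y [bx xd] [by_ yd].
  by rewrite -mulmxBl opprB addrA subrK; exact: hd.
rewrite image_id in h; apply: le_lt_trans h _.
have sub : (fun x => (x - p) *m e^T) @` A `<=` box (fun=> - d) (fun=> 2 * d).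
  move=> _ [x [_ xd] <-] i.
  have := le_lt_trans (coord_le_enorm _ i) (le_lt_trans (enorm_proj_le (x - p) ee) xd).
  by rewrite ltr_norml => /andP[a b]; apply/andP; split; lra.
apply: (@le_lt_trans _ _ ((2 ^+ m)%:E * hausdorff m (box (fun _ : 'I_m => (- d)%R) (fun=> (2 * d)%R)))%E).
  by rewrite lee_pmul2l ?lte_fin ?exprn_gt0//; exact: hausdorff_mono.
by rewrite -(fineK (box_fin _ _)) -EFinM ltry.
Qed.

(** The Gauss map is compared with [Phi], the tangential projection followed by the dilation by
    [k ord0 i + eta]: on a small patch its increments are at most [1 + eta] times those of [Phi].
    Adding [eta] keeps the dilation nondegenerate at vanishing curvatures and lets the increments of
    [Phi] absorb the errors. *)
Lemma gauss_map_density (k : 'rV[R]_m) (a : R) :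
  (forall i, row i e *m J = k ord0 i *: row i e) -> (forall i, 0 <= k ord0 i) ->
  \prod_i k ord0 i < a ->
  exists2 d, 0 < d & forall K, compact K -> K `<=` boundary Omega ->
    K `<=` eball p d -> (hausdorff m (unit_gradient phi @` K) <= a%:E * hausdorff m K)%E.
Proof.
move=> ek k0 ka.
have [eta eta0 etaa] : exists2 eta, 0 < eta &
    (1 + eta) ^+ m * \prod_i (k ord0 i + eta) < a.
  pose F (t : R) := (1 + t) ^+ m * \prod_i (k ord0 i + t).
  have cF : F t @[t --> (0 : R)] --> F 0.
    apply: cvgM.
      apply: (@cvg_comp _ _ _ (fun t : R => 1 + t) (fun t => t ^+ m) _ (nbhs (1 + 0 : R))).
        by apply: cvgD; [exact: cvg_cst|exact: cvg_id].
      exact: exprn_continuous.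
    apply: cvg_big => [y|i _]; first exact: mul_continuous.
    by apply: cvgD; [exact: cvg_cst|exact: cvg_id].
  have F0 : F 0 < a.
    rewrite /F addr0 expr1n mul1r; apply: le_lt_trans ka.
    by rewrite le_eqVlt; apply/orP; left; apply/eqP; apply: eq_bigr => i _; rewrite addr0.
  have near0 : nbhs (0 : R) [set t | F t < a] by exact: cvgr_lt cF _ F0.
  have [d /= d0 hd] := (nbhs_ballP _ _).1 near0.
  exists (d / 2); first by rewrite divr_gt0.
  apply: hd; rewrite -ball_normE/= sub0r normrN gtr0_norm ?divr_gt0//.
  by rewrite ltr_pdivrMr// ltr_pMr// ltr1n.
have P0 : 0 < \prod_i (k ord0 i + eta).
  by apply: prodr_gt0 => i _; rewrite ltr_wpDl.
have sh := unit_gradient_sdiff oU Up sphi g0.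
have [C [C0 hC]] := mulmx_lipschitz J.
have C1 : 0 < C + 1 by rewrite ltr_wpDl.
(* The error [eps * (C + 1) * enorm dl] is at most [eps * (C + 1) * 2 * enorm z], hence at most
   [eta * eta * enorm z], and [eta * enorm z] is bounded by the increment of [Phi]. *)
pose eps := Num.min 2^-1 (eta * eta / (2 * (C + 1))).
have eps0 : 0 < eps by rewrite lt_min invr_gt0 ltr0n/= divr_gt0 ?mulr_gt0.
have eps1 : eps <= 2^-1 by rewrite ge_min lexx.
have eps2 : eps * (2 * (C + 1)) <= eta * eta.
  by rewrite -ler_pdivlMr ?mulr_gt0// ge_min lexx orbT.
have [d1 d10 hd1] := sh _ eps0; have [d2 d20 hd2] := boundary_tangency chart eps0.
have [d3 d30 hd3] := patch_injective.
exists (Num.min d1 (Num.min d2 d3)); first by rewrite !lt_min d10 d20.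
move=> K cK Kb Kd.
pose l i := k ord0 i + eta.
have l0 i : 0 < l i by rewrite /l ltr_wpDl.
pose Phi (x : V) := dilation l (x *m e^T).
have lip x y : K x -> K y ->
    enorm (unit_gradient phi x - unit_gradient phi y) <= (1 + eta) * enorm (Phi x - Phi y).
  move=> Kx Ky; have := Kd _ Ky; have := Kd _ Kx.
  rewrite /eball/= !lt_min => /and3P[x1 x2 x3] /and3P[y1 y2 y3].
  have H1 := hd1 x y x1 y1; have H2 := hd2 x y (Kb _ Kx) (Kb _ Ky) x2 y2.
  have H3 := hd3 x y (Kb _ Kx) (Kb _ Ky) x3 y3.
  rewrite /Phi -dilationB -mulmxBl; set dl := x - y in H1 H2 H3 *.
  set z := dl *m e^T in H3 *; set X := enorm (dilation l z).
  have etaX : eta * enorm z <= X.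
    rewrite -[eta]gtr0_norm// -enormZ.
    have -> : eta *: z = dilation (fun=> eta) z by apply/rowP => i; rewrite !mxE.
    by apply: enorm_dilation_le => i; rewrite ltW//= /l lerDr.
  have dJ : enorm (dl *m J) <= X + eps * enorm dl * C.
    rewrite {1}(frame_decomp dl ee en nu1) mulmxDl -(scalemxAl (dot dl nu)).
    apply: le_trans (ler_enormD _ _) _; apply: lerD.
      rewrite (dilation_frame _ ek) enorm_frame//; apply: enorm_dilation_le => i.
      by rewrite k0/= /l lerDl ltW.
    rewrite enormZ; apply: ler_pM => //; first exact: enorm_ge0.
    by apply: le_trans (hC _) _; rewrite nu1 mulr1.
  rewrite -(subrK (dl *m J) (unit_gradient phi x - unit_gradient phi y)).
  apply: le_trans (ler_enormD _ _) _; apply: le_trans (lerD H1 dJ) _.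
  have : eps * enorm dl * (C + 1) <= eta * X.
    apply: (@le_trans _ _ (eps * (2 * enorm z) * (C + 1))).
      by rewrite ler_pM2r// ler_pM2l.
    have -> : eps * (2 * enorm z) * (C + 1) = eps * (2 * (C + 1)) * enorm z by ring.
    apply: le_trans (ler_wpM2r (enorm_ge0 z) eps2) _.
    by rewrite -mulrA ler_pM2l.
  by lra.
have e1 : 0 < 1 + eta by rewrite addr_gt0.
apply: le_trans (le_hausdorff_lipschitz m e1 lip) _.
have PhiK : Phi @` K = dilation l @` ((fun x : V => x *m e^T) @` K) by rewrite image_comp.
apply: (@le_trans _ _ (((1 + eta) ^+ m)%:E * ((\prod_i l i)%:E * hausdorff m K))%E).
  rewrite lee_pmul2l ?lte_fin ?exprn_gt0// PhiK.
  apply: (@le_trans _ _ ((\prod_i l i)%:E *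
      hausdorff m ((fun x : V => x *m e^T) @` K))%E).
    by apply: hausdorff_dilation_compact => //; exact: compact_proj.
  rewrite lee_pmul2l ?lte_fin// -[X in (_ <= hausdorff _ X)%E](image_id K).
  by apply: hausdorff_contraction => x y _ _; rewrite -mulmxBl enorm_proj_le.
rewrite muleA -EFinM; apply: lee_pmul => //.
- by rewrite lee_fin ltW// mulr_gt0// exprn_gt0.
- exact: hausdorff_ge0.
by rewrite lee_fin ltW.
Qed.

End patches.

(** * The integral inequality *)

Section density.
Context {R : realType} {m : nat}.
Local Notation V := 'rV[R]_m.+1.
Local Notation T := (caratheodory_type (@hausdorff R m.+1 m)).
Local Notation mu := (area R m.+1).
Implicit Types (S K : set V) (g : V -> R).

Definition continuous_within S g := forall p, S p -> forall e, 0 < e ->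
  exists2 d, 0 < d & forall q, S q -> enorm (q - p) < d -> `|g q - g p| < e.

Lemma continuous_within_measurable S g : closed S -> continuous_within S g ->
  measurable_fun (S : set T) (g : T -> R).
Proof.
move=> cS cg; apply: (measurability _ (RGenOpens.measurableE R)).
move=> _ [_ [a [b ->]] <-].
(* [g] is continuous only relative to [S]; [O] is an open set of the whole space whose trace on [S]
   is the preimage. *)
pose O := [set x : V | exists2 r, 0 < r & forall q, S q -> enorm (q - x) < r -> a < g q < b].
have oO : open O.
  apply/open_enormP => x [r r0 hr]; exists (r / 2); first by rewrite divr_gt0.
  move=> y yx; exists (r / 2); first by rewrite divr_gt0.
  move=> q Sq qy; apply: hr => //; apply: le_lt_trans (ler_enorm_dist y _ _) _.
  by rewrite (splitr r) ltrD.
have -> : (S : set T) `&` g @^-1` `]a, b[%classic = S `&` O.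
  apply/seteqP; split=> x [Sx].
    rewrite /= in_itv/= => /andP[ax xb]; split=> //.
    have [|d d0 hd] := cg x Sx (Num.min (g x - a) (b - g x)).
      by rewrite lt_min !subr_gt0 ax.
    exists d => // q Sq qx; have := hd q Sq qx.
    by rewrite lt_min !ltr_norml => /andP[/andP[h1 h2] /andP[h3 h4]]; apply/andP; split; lra.
  by move=> [r r0 hr]; split => //=; rewrite in_itv/= hr// subrr enorm0.
apply: caratheodory_measurable_setI; first exact: closed_caratheodory.
exact: open_caratheodory.
Qed.

Variable rel : V -> V -> Prop.
Definition rel_image K : set V := [set w | exists2 p, K p & rel p w].

Lemma rel_image_mono K K' : K `<=` K' -> rel_image K `<=` rel_image K'.
Proof. by move=> KK' w [p Kp pw]; exists p => //; exact: KK'. Qed.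

Lemma rel_imageU K K' : rel_image (K `|` K') = rel_image K `|` rel_image K'.
Proof.
apply/seteqP; split=> w.
  by move=> [p [Kp|Kp] pw]; [left|right]; exists p.
by move=> [] [p Kp pw]; exists p => //; [left|right].
Qed.

(** Closed balls of radius [d - d / (k + 1)] exhaust the open ball. The images of their compact
    intersections with [S] are compact, hence measurable, and the bound passes to the increasing
    limit. *)
Lemma rel_image_ball_bound S p (d c : R) : compact S -> 0 < d -> 0 <= c ->
  (forall K, compact K -> K `<=` S -> compact (rel_image K)) ->
  (forall K, compact K -> K `<=` S -> K `<=` eball p d ->
     (mu (rel_image K) <= c%:E * mu K)%E) ->
  (mu (rel_image (S `&` eball p d)) <= c%:E * mu (S `&` eball p d))%E.
Proof.
move=> cS d0 c0 cG hK.
pose C k := [set x : V | enorm (x - p) <= d - d * k.+1%:R^-1].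
have clC k : closed (C k).
  apply/closed_enormP => x h; apply/ler_addgt0Pr => e e0.
  have [y Cy yx] := h e e0; apply: le_trans (ler_enorm_dist y _ _) _.
  by rewrite addrC lerD// enormB ltW.
have CB k : C k `<=` eball p d.
  by move=> x h; apply: le_lt_trans h _; rewrite ltrBlDr ltrDl mulr_gt0.
have cSC k : compact (S `&` C k).
  apply: (@subclosed_compact _ _ S) => //.
  by apply: closedI => //; exact: compact_closed.
have SCS k : S `&` C k `<=` S by move=> x [].
have SB : S `&` eball p d = \bigcup_k (S `&` C k).
  apply/seteqP; split=> [x [Sx xd]|x [k _ [Sx /CB]]//].
  exists (Num.trunc (d / (d - enorm (x - p)))) => //; split => //.
  rewrite /C/= lerBrDr -lerBrDl ler_pdivrMr// mulrC -ler_pdivrMr ?subr_gt0//.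
  exact/ltW/truncnS_gt.
have SBG : rel_image (S `&` eball p d) = \bigcup_k rel_image (S `&` C k).
  rewrite SB; apply/seteqP; split=> [w [x [k _ xk] xw]|w [k _ [x xk xw]]].
    by exists k => //; exists x.
  by exists x => //; exists k.
have mono i j : (i <= j)%N -> S `&` C i `<=` S `&` C j.
  move=> ij x [Sx Cx]; split=> //; apply: le_trans Cx _.
  by rewrite lerD2l lerN2 ler_pM2l// lef_pV2 ?posrE// ler_nat.
have cvG : mu (rel_image (S `&` C k)) @[k --> \oo] --> mu (rel_image (S `&` eball p d)).
  rewrite SBG; apply: hausdorff_cvg_increasing => [k|i j ij].
    by apply: compact_caratheodory; apply: cG.
  by apply: rel_image_mono; exact: mono.
rewrite -(cvg_lim _ cvG)//; apply: lime_le; first by apply: cvgP; exact: cvG.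
apply: nearW => k; apply: le_trans (hK _ (cSC k) (SCS k) _) _; first by move=> x [_ /CB].
rewrite lee_wpmul2l ?lee_fin//; apply: hausdorff_mono => x [Sx Cx].
by split => //; exact: (CB k).
Qed.

(* S is cut into differences of balls on which g is nearly constant. *)
Lemma rel_image_integral_bound S g : compact S -> (mu S < +oo)%E ->
  (forall p, S p -> 0 <= g p) -> continuous_within S g ->
  (forall K, compact K -> K `<=` S -> compact (rel_image K)) ->
  (forall p, S p -> forall e, 0 < e -> exists2 d, 0 < d &
     forall K, compact K -> K `<=` S -> K `<=` eball p d ->
       (mu (rel_image K) <= (g p + e)%:E * mu K)%E) ->
  (mu (rel_image S) <= \int[mu]_(p in S) (g p)%:E)%E.
Proof.
move=> cS finS gpos cg cG dens.
have clS : closed S by exact: compact_closed.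
have mg : measurable_fun (S : set T) (g : T -> R) by exact: continuous_within_measurable.
have mS : measurable (S : set T) by exact: closed_caratheodory.
have finSE : mu S \is a fin_num by rewrite ge0_fin_numE// measure_ge0.
apply/lee_addgt0Pr => e0 e00.
(* The integrand will be [g + 2 * e]: one [e] for the density hypothesis and one for the oscillation
   of [g] on a ball. The added 1 covers the case where [mu S] is 0. *)
pose e := e0 / (2 * (fine (mu S) + 1)).
have S1 : 0 < fine (mu S) + 1 by rewrite ltr_wpDl// fine_ge0// measure_ge0.
have e_gt0 : 0 < e by rewrite divr_gt0// mulr_gt0.
pose P p r := (forall K, compact K -> K `<=` S -> K `<=` eball p r ->
    (mu (rel_image K) <= (g p + e)%:E * mu K)%E) /\
  (forall q, S q -> enorm (q - p) < r -> `|g q - g p| < e).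
have [|s [sP sc]] := @compact_eball_cover R m.+1 S P cS.
  move=> p Sp; have [d1 d10 h1] := dens p Sp e e_gt0.
  have [d2 d20 h2] := cg p Sp e e_gt0.
  exists (Num.min d1 d2); first by rewrite lt_min d10.
  split=> [K cK KS Kp|q Sq]; last by rewrite lt_min => /andP[_]; exact: h2.
  by apply: h1 => // x /Kp; rewrite /eball/= lt_min => /andP[].
have mg2 : measurable_fun (S : set T) (fun p : T => (g p + 2 * e)%:E).
  by apply/measurable_EFinP; apply: measurable_funD => //; exact: measurable_cst.
have gpos2 x : S x -> 0 <= g x + 2 * e.
  by move=> Sx; apply: addr_ge0; [exact: gpos|rewrite mulr_ge0// ltW].
have key : (mu (rel_image S) <= \int[mu]_(p in S) (g p + 2 * e)%:E)%E.
  (* Induction on the list of balls: the part [A] of [C] in the first open ball is handled by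
     exhaustion, and the rest [B] is again compact and covered by the remaining balls. *)
  have : forall C : set V, compact C -> C `<=` S ->
      (forall x, C x -> exists2 z, z \in s & eball z.1 z.2 x) ->
      (mu (rel_image C) <= \int[mu]_(p in C) (g p + 2 * e)%:E)%E.
    elim: s sP {sc} => [|[p r] s IH] sP C cC CS Cs.
      have -> : rel_image C = set0.
        by rewrite -subset0 => w [x /Cs[z]]; rewrite in_nil.
      rewrite measure0; apply: integral_ge0 => x Cx.
      by rewrite lee_fin; apply: gpos2; exact: CS.
    have [|/= Sp r0 [Pd Pg]] := sP (p, r); first by rewrite mem_head.
    pose A := C `&` eball p r; pose B := C `\` eball p r.
    have cB : compact B.
      apply: (@subclosed_compact _ _ C); [|exact: cC|by move=> x []].
      apply: closedI; first exact: compact_closed.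
      by apply: open_closedC; apply: open_eball.
    have AB : C = A `|` B by rewrite /A /B setUIDK.
    have AS : A `<=` S by move=> x [/CS].
    have BS : B `<=` S by move=> x [/CS].
    have mA : measurable (A : set T).
      apply: (@caratheodory_measurable_setI R V (@hausdorff R m.+1 m) C (eball p r)).
        exact: compact_caratheodory.
      apply: open_caratheodory. exact: open_eball.
    have mB : measurable (B : set T) by exact: compact_caratheodory.
    have hB : (mu (rel_image B) <= \int[mu]_(p in B) (g p + 2 * e)%:E)%E.
      apply: IH => // [z zs|x [Cx xp]]; first by apply: sP; rewrite in_cons zs orbT.
      have [z] := Cs x Cx; rewrite in_cons => /orP[/eqP->//|zs zx].
      by exists z.
    have gp0 := gpos p Sp.
    have hA : (mu (rel_image A) <= \int[mu]_(p in A) (g p + 2 * e)%:E)%E.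
      have : (mu (rel_image A) <= (g p + e)%:E * mu A)%E.
        apply: rel_image_ball_bound => //; first by rewrite addr_ge0// ltW.
          by move=> K cK KC; apply: cG => //; exact: subset_trans CS.
        by move=> K cK KC Kp; apply: Pd => //; exact: subset_trans CS.
      move=> /le_trans; apply; rewrite -integral_cst//; apply: (ge0_le_integral (area R m.+1) mA).
      - by move=> x _; rewrite lee_fin addr_ge0// ltW.
      - exact: measurable_cst.
      - exact: (measurable_funS mS AS mg2).
      - move=> x [Cx xp]; rewrite lee_fin; have := Pg x (CS _ Cx) xp.
        by rewrite ltr_norml => /andP[]; lra.
    rewrite AB rel_imageU; apply: le_trans (outer_measureU2 (@hausdorff R m.+1 m) _ _) _.
    rewrite (ge0_integral_setU (area R m.+1) mA mB).
    - exact: leeD.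
    - rewrite -AB; exact: (measurable_funS mS CS mg2).
    - by move=> x; rewrite -AB => /CS Sx; rewrite lee_fin gpos2.
    - by apply/disj_setPS => x [[_ ?] [_]].
  by apply.
apply: (le_trans key).
have -> : (\int[mu]_(p in S) (g p + 2 * e)%:E =
    \int[mu]_(p in S) (g p)%:E + \int[mu]_(p in S) (cst (2 * e)%:E p))%E.
  rewrite -(ge0_integralD (area R m.+1) mS)//.
  - exact/measurable_EFinP.
  - by move=> x Sx; rewrite lee_fin mulr_ge0// ltW.
have -> : (\int[mu]_(p in S) (cst (2 * e)%:E p) = (2 * e * fine (mu S))%:E)%E.
  by rewrite (integral_cst (area R m.+1) mS) [RHS]EFinM fineK.
rewrite leeD2l// lee_fin /e.
rewrite [leLHS](_ : _ = e0 * (fine (mu S) / (fine (mu S) + 1))); last first.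
  by field; rewrite gt_eqF.
apply: ler_piMr; first exact: ltW.
by rewrite ler_pdivrMr// mul1r lerDl.
Qed.

End density.

(** * Supporting hyperplanes and the curvature integrand *)

Section contact.
Context {R : realType} {m : nat}.
Local Notation V := 'rV[R]_m.+1.
Local Notation mu := (area R m.+1).
Variable Omega : set V.
Hypothesis m_gt0 : (0 < m)%N.
Hypothesis Omega_domain : bounded_domain Omega.
Hypothesis Omega_smooth : smooth_boundary Omega.
Local Notation Sigma := (boundary Omega).
Local Notation H := (mean_curvature Omega).

Let oO : open Omega. Proof. by case: Omega_domain. Qed.

Lemma boundary_notin p : Sigma p -> ~ Omega p.
Proof. by move=> [_ ni] Op; apply: ni; move/interior_id: oO => ->. Qed.

Lemma boundary_closed : closed Sigma.
Proof.
rewrite /boundary setDE; apply: closedI; first exact: closed_closure.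
by apply: open_closedC; exact: open_interior.
Qed.

Lemma closure_compact : compact (closure Omega).
Proof.
have [_ _ _ /bounded_enormP[M hM]] := Omega_domain.
apply: (@compact_closed_bounded _ _ _ (M + 1)); first exact: closed_closure.
move=> x /closure_enormP/(_ 1 ltr01)[y Oy yx].
rewrite -(subrK y x); apply: le_trans (ler_enormD _ _) _.
by rewrite addrC lerD ?hM// enormB ltW.
Qed.

Lemma boundary_compact : compact Sigma.
Proof.
apply: (subclosed_compact boundary_closed closure_compact).
by move=> x [].
Qed.

Definition supports p w := enorm w = 1 /\ forall x, Omega x -> dot (x - p) w <= 0.

Lemma supports_closure p w x : supports p w -> closure Omega x -> dot (x - p) w <= 0.
Proof.
move=> [w1 hw] /closure_enormP cx; apply/ler_addgt0Pr => e e0; rewrite add0r.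
have [y Oy yx] := cx e e0; rewrite -(subrK y x) -addrA dotDl.
rewrite -[e]addr0; apply: lerD; last exact: hw.
by apply: le_trans (ler_dot _ _) _; rewrite w1 mulr1 enormB ltW.
Qed.

(** [dot w] has a maximum on the compact closure; the maximizer is not interior, since a step along
    [w] would increase the value. *)
Lemma supports_sphere : rel_image supports Sigma = unit_sphere.
Proof.
apply/seteqP; split=> [w [p _ []]//|w /= w1].
have [_ _ [x0 Ox0] _] := Omega_domain.
have C0 : closure Omega !=set0 by exists x0; exact: subset_closure.
have [p pC pmax] := @EVT_max_rV _ _ (dot w) _ C0 closure_compact
  (continuous_subspaceT (@dot_continuous _ _ w)).
rewrite inE in pC.
have hw x : closure Omega x -> dot (x - p) w <= 0.
  by move=> Cx; rewrite dotC dotBr subr_le0; apply: pmax; rewrite inE.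
exists p; last by split=> // x Ox; apply: hw; exact: subset_closure.
split=> //; rewrite -/(Omega°) => /nbhs_enormP[r r0 pr].
have : Omega (p + (r / 2) *: w).
  apply: pr; rewrite /eball/= addrAC subrr add0r enormZ w1 mulr1 gtr0_norm ?divr_gt0//.
  by rewrite ltr_pdivrMr// ltr_pMr// ltr1n.
move=> /subset_closure/hw; rewrite addrAC subrr add0r dotZl -sqr_enorm w1 expr1n mulr1.
by rewrite leNgt divr_gt0.
Qed.

Lemma seq_min_pos (s : seq (V * R)) : (forall z, z \in s -> 0 < z.2) ->
  exists2 r : R, 0 < r & forall z, z \in s -> r <= z.2.
Proof.
elim: s => [|z s IH] h; first by exists 1.
have [|r r0 hr] := IH; first by move=> y ys; apply: h; rewrite in_cons ys orbT.
exists (Num.min z.2 r); first by rewrite lt_min r0 h ?mem_head.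
move=> y; rewrite in_cons => /orP[/eqP->|ys]; first by rewrite ge_min lexx.
by rewrite ge_min hr ?orbT.
Qed.

(** If [w] supports at no point of [K], each [p] in [K] has a point of [Omega] beyond its
    hyperplane. This persists for nearby points and normals, and compactness of [K] yields one
    radius around [w] free of supporting normals. *)
Lemma supports_compact K : compact K -> compact (rel_image supports K).
Proof.
move=> cK; apply: (@compact_closed_bounded _ _ _ 1); last by move=> w [p _ [->]].
apply/closed_enormP => w hw.
have w1 : enorm w = 1.
  have /closed_enormP cS : closed (@unit_sphere R m.+1).
    by apply: compact_closed => //; exact: sphere_compact.
  by apply: cS => r r0; have [w' [p _ [w'1 _]] w'w] := hw r r0; exists w'.
apply: contrapT => nw.
have nK p : K p -> exists2 x, Omega x & 0 < dot (x - p) w.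
  move=> Kp; apply: contrapT => nx; apply: nw; exists p => //; split=> // x Ox.
  by rewrite leNgt; apply/negP => h; apply: nx; exists x.
pose P p r := exists2 x, Omega x & forall p' w', enorm (p' - p) < r ->
  enorm (w' - w) < r -> 0 < dot (x - p') w'.
have [|s [sP sc]] := @compact_eball_cover R m.+1 K P cK.
  move=> p Kp; have [x Ox xw] := nK p Kp.
  (* Moving [p] and [w] by less than [r <= 1] changes the product by less than [r * L]; the 2 bounds
     [enorm w']. *)
  pose L := enorm (x - p) + 2.
  have L0 : 0 < L by rewrite ltr_wpDl ?enorm_ge0.
  exists (Num.min 1 (dot (x - p) w / L)); first by rewrite lt_min ltr01 divr_gt0.
  exists x => // p' w'; rewrite !lt_min !ltr_pdivlMr// => /andP[p1 p2] /andP[v1 v2].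
  have -> : dot (x - p') w' = dot (x - p) w + dot (x - p) (w' - w) - dot (p' - p) w'.
    by rewrite dotBr (_ : x - p' = (x - p) - (p' - p)) ?dotBl; [ring|rewrite opprB addrA subrK].
  have h1 := ler_abs_dot (x - p) (w' - w); have h2 := ler_abs_dot (p' - p) w'.
  have h3 : enorm w' <= 2.
    rewrite -(subrK w w'); apply: le_trans (ler_enormD _ _) _; rewrite w1; lra.
  have h4 : enorm (p' - p) * enorm w' <= enorm (p' - p) * 2.
    by rewrite ler_wpM2l ?enorm_ge0.
  move: h1 h2 p2 v2; rewrite /L !ler_norml => /andP[h1 _] /andP[_ h2] p2 v2.
  move: h1 h2 p2 v2 h4 (enorm_ge0 (x - p)).
  move: (enorm (x - p)) (enorm (w' - w)) (enorm (p' - p)) (enorm w') => X b a c.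
  move=> h1 h2 p2 v2 h4 X0; have [ab|/ltW ba] := leP a b; first by lra.
  have : X * b <= X * a by rewrite ler_wpM2l.
  by lra.
have [|r r0 hr] := @seq_min_pos s; first by move=> z /sP[].
have [w' [p Kp [_ sw']] w'w] := hw r r0.
have [z zs pz] := sc p Kp; have [_ _ [x Ox hx]] := sP z zs.
have := hx p w' pz (lt_le_trans w'w (hr z zs)).
by rewrite ltNge sw'.
Qed.

Definition willmore p : R := (`|H p| / m%:R) ^+ m.

Lemma willmore_ge0 p : 0 <= willmore p.
Proof. by rewrite exprn_ge0// divr_ge0. Qed.

Lemma willmore_eq0 p : willmore p = 0 -> H p = 0.
Proof.
move/eqP; rewrite expf_eq0 mulf_eq0 invr_eq0 pnatr_eq0 normr_eq0 => /andP[_].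
by rewrite -[m == 0%N]negbK -lt0n m_gt0 orbF => /eqP.
Qed.

Lemma willmore_continuous : continuous_within Sigma willmore.
Proof.
move=> p Sp e e0.
pose F (t : R) := (`|t| / m%:R) ^+ m.
have cF : F t @[t --> H p] --> F (H p).
  apply: (@cvg_comp _ _ _ (fun t : R => `|t| / m%:R) (fun t => t ^+ m) _
    (nbhs (`|H p| / m%:R))); last exact: exprn_continuous.
  by apply: cvgM; [exact: norm_continuous|exact: cvg_cst].
have /cvgrPdist_lt/(_ e e0)/nbhs_ballP[eta /= eta0 heta] := cF.
have [U [phi chart]] := Omega_smooth Sp.
have [d d0 hd] := mean_curvature_continuous_at chart Sp eta0.
exists d => // q Sq qp; rewrite distrC; apply: heta; rewrite -ball_normE/= distrC.
exact: hd.
Qed.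

Lemma hausdorff_boundary_fin : (mu Sigma < +oo)%E.
Proof.
pose P (p : V) r := (hausdorff m (Sigma `&` eball p r) < +oo)%E.
have [|s [sP sc]] := @compact_eball_cover R m.+1 _ P boundary_compact.
  move=> p Sp; have [U [phi chart]] := Omega_smooth Sp.
  have [e [k [ee en ek]]] := curvature_frame chart.
  have [d d0 hd] := hausdorff_patch_fin chart ee en; exists d => //.
have sub : Sigma `<=` \big[setU/set0]_(z <- s) (Sigma `&` eball z.1 z.2).
  by move=> x Sx; have [z zs xz] := sc x Sx; rewrite -bigcup_seq; exists z.
apply: le_lt_trans (hausdorff_mono sub) _.
apply: le_lt_trans (outer_measure_bigsetU _ _ _) _.
rewrite big_seq; apply: lte_sum_pinfty => z /sP[_ _]; exact.
Qed.

Lemma willmore_bounded : exists2 M, 0 <= M & forall p, Sigma p -> willmore p <= M.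
Proof.
have cW := willmore_continuous.
pose P (p : V) r := forall q, Sigma q -> enorm (q - p) < r -> willmore q <= willmore p + 1.
have [|s [sP sc]] := @compact_eball_cover R m.+1 _ P boundary_compact.
  move=> p Sp; have [d d0 hd] := cW p Sp 1 ltr01; exists d => // q Sq qp.
  have := hd q Sq qp; rewrite ltr_norml => /andP[_].
  by rewrite ltrBlDr addrC => /ltW.
suff [M M0 hM] : exists2 M, 0 <= M & forall z, z \in s -> willmore z.1 + 1 <= M.
  exists M => // p Sp; have [z zs pz] := sc p Sp; have [_ _ hP] := sP z zs.
  exact: le_trans (hP p Sp pz) (hM z zs).
elim: (s) => [|z r [M M0 hM]]; first by exists 0.
exists (Num.max (willmore z.1 + 1) M); first by rewrite le_max M0 orbT.
move=> y; rewrite in_cons => /orP[/eqP->|yr]; first by rewrite le_max lexx.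
by rewrite le_max (hM y yr) orbT.
Qed.

End contact.

Lemma max0_lipschitz {R : realDomainType} (s t : R) :
  `|Num.max 0 s - Num.max 0 t| <= `|s - t|.
Proof.
have h1 := ler_norm (s - t); have h2 := ler_norm (t - s).
rewrite (distrC t) in h2; rewrite ler_norml.
by case: (leP 0 s) => s0; case: (leP 0 t) => t0; apply/andP; split; lra.
Qed.

Section willmore_inequality.
Context {R : realType} {m : nat}.
Local Notation V := 'rV[R]_m.+1.
Local Notation mu := (area R m.+1).
Variable Omega : set V.
Hypothesis m_gt0 : (0 < m)%N.
Hypothesis Omega_domain : bounded_domain Omega.
Hypothesis Omega_smooth : smooth_boundary Omega.
Local Notation Sigma := (boundary Omega).
Local Notation H := (mean_curvature Omega).
Local Notation f := (willmore Omega).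

Definition umbilic_contact (U : set V) (phi : V -> R) (p : V) : Prop :=
  [/\ supports Omega p (unit_gradient phi p), 0 < H p &
      forall v, dot v (unit_gradient phi p) = 0 ->
        v *m shape phi p = (H p / m%:R) *: v].

(** [D] bounds the local ratio of the area of normals to the area of the boundary. It is 0 when the
    tangent plane at [p] does not support [Omega], a condition that persists nearby so that no
    normals are produced, and the product of the principal curvatures otherwise. The last clause is
    the equality case of AM-GM. *)
Lemma local_density U phi p : local_defining_function Omega p U phi -> Sigma p ->
  exists D, [/\ 0 <= D, D <= f p,
    forall e, 0 < e -> exists2 d, 0 < d & forall K, compact K -> K `<=` Sigma ->
      K `<=` eball p d -> (mu (rel_image (supports Omega) K) <= (D + e)%:E * mu K)%E &
    D = f p -> H p = 0 \/ umbilic_contact U phi p].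
Proof.
move=> chart Sp.
have [oU Up sphi g0 _] := chart.
have nu1 : enorm (unit_gradient phi p) = 1 by exact: enorm_unit_gradient (g0 _ Up).
have sup_nu q w : Sigma q -> U q -> supports Omega q w -> w = unit_gradient phi q.
  move=> Sq Uq [w1 hw].
  apply: (support_normal (chart_recenter chart Uq) Sq ltr01 w1) => x Ox _.
  exact: hw.
have [d0 d00 dU] := chart_ball chart.
have [sup|nsup] := pselect (supports Omega p (unit_gradient phi p)); last first.
  exists 0; split=> //; first exact: willmore_ge0.
    move=> e e0.
    have [x Ox xn] : exists2 x, Omega x & 0 < dot (x - p) (unit_gradient phi p).
      apply: contrapT => nx; apply: nsup; split=> // x Ox.
      by rewrite leNgt; apply/negP => h; apply: nx; exists x.
    pose L := enorm (x - p) + 1.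
    have L0 : 0 < L by rewrite ltr_wpDl ?enorm_ge0.
    (* [x] lies beyond the tangent plane with a margin [2 * a]; one [a] is spent on the variation of
       the normal, the other on the displacement of the point. *)
    pose a := dot (x - p) (unit_gradient phi p) / 2.
    have a0 : 0 < a by rewrite divr_gt0.
    have [d1 d10 hd1] := sdiff_continuous (unit_gradient_sdiff oU Up sphi (g0 _ Up)) (divr_gt0 a0 L0).
    exists (Num.min d0 (Num.min d1 a)); first by rewrite !lt_min d00 d10.
    move=> K cK KS Kd; rewrite (_ : rel_image _ K = set0).
      by rewrite measure0 mule_ge0// ?measure_ge0// lee_fin addr_ge0// ltW.
    rewrite -subset0 => w [q Kq sq]; have := Kd q Kq.
    rewrite /eball/= !lt_min => /and3P[q0 q1 q2].
    have wE := sup_nu q w (KS q Kq) (dU _ q0) sq.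
    have [w1 /(_ x Ox)] := sq; rewrite leNgt => /negP; apply.
    have := hd1 q q1; rewrite -wE => h1.
    have h2 := ler_abs_dot (x - p) (w - unit_gradient phi p).
    have h3 := ler_abs_dot (q - p) w.
    have -> : dot (x - q) w = dot (x - p) (unit_gradient phi p) +
        dot (x - p) (w - unit_gradient phi p) - dot (q - p) w.
      rewrite dotBr (_ : x - q = (x - p) - (q - p)) ?dotBl; first by ring.
      by rewrite opprB addrA subrK.
    rewrite ltr_pdivlMr// in h1; rewrite w1 mulr1 in h3.
    have e2 : dot (x - p) (unit_gradient phi p) = 2 * a by rewrite /a mulrC divfK.
    rewrite e2; move: h1 h2 h3 q2 a0 (enorm_ge0 (w - unit_gradient phi p)).
    rewrite /L; move: (enorm (x - p)) (enorm (w - _)) (enorm (q - p)) (dot (x - p) (w - _)) (dot (q - p) w) (a).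
    clear=> X b c s t a h1 h2 h3 h4 a0 b0.
    move: h2 h3; rewrite !ler_norml => /andP[h2 _] /andP[_ h3].
    by lra.
  by move=> e; left; apply: (willmore_eq0 m_gt0).
have [e [k [ee en ek]]] := curvature_frame chart.
have Hk : H p = \sum_i k ord0 i.
  by rewrite (mean_curvatureE chart Sp) (curvature_sum chart ee en ek).
have k0 i : 0 <= k ord0 i.
  have hc x : Sigma x -> enorm (x - p) < 1 ->
      dot (x - p) (1 *: unit_gradient phi p) <= - 0 * enorm (x - p) ^+ 2.
    move=> [Cx _] _; rewrite scale1r oppr0 mul0r; exact: supports_closure sup Cx.
  have := second_order_contact chart Sp (expr1n _ 2) (lexx 0) ltr01 hc (en i) (enorm_row i ee).
  by rewrite ek mulr0 mul1r dotZl dot_rows// eqxx mulr1.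
have Hp0 : 0 <= H p by rewrite Hk sumr_ge0.
have [AGM1 AGM2] := @leif_AGM R 'I_m predT (fun i => k ord0 i) (fun i _ => k0 i).
have cardm : #|[pred _ : 'I_m | true]| = m by rewrite -[RHS]card_ord; apply: eq_card.
have fE : f p = ((\sum_(i in predT) k ord0 i) / #|(predT : pred 'I_m)|%:R) ^+ #|(predT : pred 'I_m)|.
  rewrite /willmore (ger0_norm Hp0) Hk.
  by rewrite (_ : #|_| = m) ?cardm.
exists (\prod_i k ord0 i); split.
- exact: prodr_ge0.
- by rewrite fE; exact: AGM1.
- move=> eps eps0; have [|d dgt hd] := gauss_map_density chart ee en ek k0 (a := \prod_i k ord0 i + eps).
    by rewrite ltrDl.
  exists (Num.min d d0); first by rewrite lt_min dgt.
  move=> K cK KS Kd; have KU q : K q -> U q.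
    by move=> /Kd; rewrite /eball/= lt_min => /andP[_]; exact: dU.
  apply: (@le_trans _ _ (mu (unit_gradient phi @` K))).
    apply: hausdorff_mono => w [q Kq sq]; exists q => //.
    by rewrite (sup_nu q w)//; [exact: KS|exact: KU].
  by apply: hd => // q /Kd; rewrite /eball/= lt_min => /andP[].
move=> eD; have [H0|H0] := eqVneq (H p) 0; [by left|right].
split=> //; first by rewrite lt_def H0.
have keq i j : k ord0 i = k ord0 j.
  have : \prod_(i in predT) k ord0 i == ((\sum_(i in predT) k ord0 i) / #|(predT : pred 'I_m)|%:R) ^+ #|(predT : pred 'I_m)|.
    by rewrite -fE -eD.
  by rewrite AGM2 => /forallP/(_ i)/forallP/(_ j)/eqP.
have kH i : k ord0 i = H p / m%:R.
  rewrite Hk (eq_bigr (fun=> k ord0 i)); last by move=> j _; exact: keq.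
  by rewrite sumr_const card_ord -(mulr_natr (k ord0 i)) mulfK// pnatr_eq0 -lt0n.
move=> v vn; rewrite {1}(frame_decomp v ee en nu1) vn scale0r addr0.
rewrite (dilation_frame _ ek) [in RHS](frame_decomp v ee en nu1) vn scale0r addr0.
rewrite scalemxAl; congr (_ *m _); apply/rowP => i; rewrite !mxE kH; congr (_ * _).
Qed.

Lemma willmore_inequality : (mu unit_sphere <= \int[mu]_(p in Sigma) (f p)%:E)%E.
Proof.
rewrite -(supports_sphere Omega_domain).
apply: rel_image_integral_bound.
- exact: boundary_compact.
- exact: hausdorff_boundary_fin.
- by move=> p _; exact: willmore_ge0.
- exact: willmore_continuous.
- by move=> K cK _; exact: supports_compact.
move=> p Sp e e0; have [U [phi chart]] := Omega_smooth Sp.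
have [D [D0 Df dens _]] := local_density chart Sp.
have [d d0 hd] := dens e e0; exists d => // K cK KS Kd.
apply: le_trans (hd K cK KS Kd) _; apply: lee_wpmul2r; first exact: hausdorff_ge0.
by rewrite lee_fin lerD2r.
Qed.

(** When the local ratio at [p] stays below [f p], subtracting a small bump [b] from [f] near [p]
    preserves the hypotheses of the integral bound. The gain is the integral of [b], positive
    because every boundary patch has positive area. *)
Lemma willmore_strict p D : Sigma p -> 0 <= D -> D < f p ->
  (forall e, 0 < e -> exists2 d, 0 < d & forall K, compact K -> K `<=` Sigma ->
      K `<=` eball p d -> (mu (rel_image (supports Omega) K) <= (D + e)%:E * mu K)%E) ->
  (mu unit_sphere < \int[mu]_(p in Sigma) (f p)%:E)%E.
Proof.
move=> Sp D0 Df dens.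
have cf := willmore_continuous Omega_smooth.
(* Three shares of the gap: the error in the density bound, the oscillation of [f] near [p], and the
   height of the bump. *)
have [eta eta0 etaE] : exists2 eta, 0 < eta & f p = D + 3 * eta.
  exists ((f p - D) / 3); first by rewrite divr_gt0// subr_gt0.
  by rewrite mulrC divfK// addrC subrK.
have [d1 d10 hd1] := dens eta eta0.
have [d2 d20 hd2] := cf p Sp eta eta0.
pose d := Num.min d1 d2; have d0 : 0 < d by rewrite lt_min d10.
(* A cone of height [eta] that vanishes from radius [d / 2] on and is still at least [eta / 2]
   inside radius [d / 4]. *)
pose b (x : V) := Num.max 0 (eta - eta * 2 / d * enorm (x - p)).
have b0 x : 0 <= b x by rewrite le_max lexx.
have ed0 : 0 < eta * 2 / d by rewrite divr_gt0// mulr_gt0.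
have b_le x : b x <= eta.
  by rewrite ge_max ltW//= gerBl mulr_ge0 ?enorm_ge0// ltW.
have b_far x : d <= enorm (x - p) -> b x = 0.
  move=> dx; apply/eqP; rewrite eq_le b0 andbT ge_max lexx/= subr_le0.
  apply: (@le_trans _ _ (eta * 2 / d * d)); first by rewrite divfK ?gt_eqF// ler_pMr// ler1n.
  by rewrite ler_pM2l.
have b_near x : enorm (x - p) < d / 4 -> eta / 2 <= b x.
  move=> dx; rewrite le_max; apply/orP; right.
  have : eta * 2 / d * enorm (x - p) <= eta * 2 / d * (d / 4) by rewrite ler_pM2l// ltW.
  have -> : eta * 2 / d * (d / 4) = eta / 2 by field; rewrite gt_eqF.
  rewrite lerBrDr => h; apply: le_trans (lerD (lexx _) h) _; by rewrite -splitr.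
have b_cont : continuous_within Sigma b.
  move=> q _ e e0; exists (e / (eta * 2 / d)); first by rewrite divr_gt0.
  move=> x _; rewrite ltr_pdivlMr// => h; apply: le_lt_trans h; rewrite /b.
  apply: le_trans (max0_lipschitz _ _) _.
  have -> : eta - eta * 2 / d * enorm (x - p) - (eta - eta * 2 / d * enorm (q - p)) =
     (eta * 2 / d) * (enorm (q - p) - enorm (x - p)) by ring.
  rewrite normrM gtr0_norm// mulrC ler_pM2r//; apply: le_trans (ler_dist_enorm _ _) _.
  by rewrite opprB addrA subrK enormB.
pose g x := f x - b x.
have near_f q : Sigma q -> enorm (q - p) < d -> D + 2 * eta <= f q.
  move=> Sq; rewrite lt_min => /andP[_ qd]; have := hd2 q Sq qd.
  rewrite ltr_norml etaE => /andP[+ _]; rewrite ltrBrDr => /ltW; apply: le_trans.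
  by rewrite (_ : - eta + _ = D + 2 * eta)//; ring.
have g0 q : Sigma q -> 0 <= g q.
  move=> Sq; rewrite /g subr_ge0; have [dq|qd] := leP d (enorm (q - p)).
    rewrite (b_far q dq); exact: willmore_ge0.
  apply: le_trans (b_le q) _; apply: le_trans (near_f q Sq qd).
  by rewrite (_ : D + 2 * eta = eta + (D + eta)) ?lerDl ?addr_ge0 ?(ltW eta0)//; ring.
have g_cont : continuous_within Sigma g.
  move=> q Sq e e0; have e2 : 0 < e / 2 by rewrite divr_gt0.
  have [r1 r10 h1] := cf q Sq _ e2; have [r2 r20 h2] := b_cont q Sq _ e2.
  exists (Num.min r1 r2); first by rewrite lt_min r10.
  move=> x Sx; rewrite lt_min => /andP[x1 x2].
  have -> : g x - g q = (f x - f q) - (b x - b q).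
    by rewrite /g !opprB (addrC (b q)) addrACA (addrC (- b x)) (addrC (b q)).
  rewrite (splitr e); apply: le_lt_trans (ler_normB _ _) _.
  by apply: ltrD; [exact: h1|exact: h2].
have bound : (mu unit_sphere <= \int[mu]_(p in Sigma) (g p)%:E)%E.
  rewrite -(supports_sphere Omega_domain).
  apply: rel_image_integral_bound => //.
  - exact: boundary_compact.
  - exact: hausdorff_boundary_fin.
  - by move=> K cK _; exact: supports_compact.
  move=> q Sq e e0; have [dq|qd] := leP d (enorm (q - p)).
    have [U [phi chart]] := Omega_smooth Sq.
    have [D' [_ Df' dens' _]] := local_density chart Sq.
    have [r r0 hr] := dens' e e0; exists r => // K cK KS Kd.
    apply: le_trans (hr K cK KS Kd) _; apply: lee_wpmul2r; first exact: hausdorff_ge0.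
    by rewrite lee_fin lerD2r /g (b_far q dq) subr0.
  exists (d - enorm (q - p)); first by rewrite subr_gt0.
  move=> K cK KS Kd; apply: (@le_trans _ _ ((D + eta)%:E * mu K)%E).
    apply: hd1 => // x /Kd; rewrite /eball/= => xq.
    apply: le_lt_trans (ler_enorm_dist q _ _) _; rewrite -ltrBrDr.
    by apply: lt_le_trans xq _; rewrite lerD2r /d ge_min lexx.
  apply: lee_wpmul2r; first exact: hausdorff_ge0.
  rewrite lee_fin /g; have := near_f q Sq qd; have := b_le q.
  move=> hb hf; apply: (@le_trans _ _ (f q - b q)); last by rewrite lerDl ltW.
  rewrite lerBrDr; apply: le_trans (lerD (lexx _) hb) _; apply: le_trans hf.
  by rewrite -addrA (_ : eta + eta = 2 * eta)// mulr_natl mulr2n.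
have mS : measurable (Sigma : set (caratheodory_type (@hausdorff R m.+1 m))).
  exact: closed_caratheodory (@boundary_closed R m Omega).
have mg := continuous_within_measurable (@boundary_closed R m Omega) g_cont.
have mb := continuous_within_measurable (@boundary_closed R m Omega) b_cont.
have fgb : (\int[mu]_(x in Sigma) (f x)%:E =
    \int[mu]_(x in Sigma) (g x)%:E + \int[mu]_(x in Sigma) (b x)%:E)%E.
  rewrite -(ge0_integralD mu mS).
  - by apply: eq_integral => x _; rewrite -EFinD /g subrK.
  - by move=> x Sx; rewrite lee_fin; exact: g0.
  - exact/measurable_EFinP.
  - by move=> x Sx; rewrite lee_fin; exact: b0.
  - exact/measurable_EFinP.
(* Finiteness of the integral of [g] is what makes adding a positive integral strict. *)
have gfin : (\int[mu]_(x in Sigma) (g x)%:E < +oo)%E.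
  have [M M0 hM] := willmore_bounded Omega_domain Omega_smooth.
  apply: (@le_lt_trans _ _ (\int[mu]_(x in Sigma) (cst M%:E x))%E).
    apply: (ge0_le_integral mu mS).
    - by move=> x Sx; rewrite lee_fin; exact: g0.
    - exact/measurable_EFinP.
    - exact: measurable_cst.
    move=> x Sx; rewrite lee_fin; apply: le_trans (hM x Sx).
    by rewrite gerBl.
  rewrite (integral_cst mu mS).
  apply: lte_mul_pinfty => //.
  exact: hausdorff_boundary_fin Omega_domain Omega_smooth.
rewrite fgb; apply: (le_lt_trans bound); rewrite lteDl; last first.
  by rewrite ge0_fin_numE// integral_ge0// => x Sx; rewrite lee_fin g0.
have [U [phi chart]] := Omega_smooth Sp.
have [e [k [ee en ek]]] := curvature_frame chart.
have d4 : 0 < d / 4 by rewrite divr_gt0.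
pose N := Sigma `&` eball p (d / 4).
have posN : (0 < mu N)%E by exact: (hausdorff_patch_gt0 chart Sp ee en d4).
have mN : measurable (N : set (caratheodory_type (@hausdorff R m.+1 m))).
  apply: (@caratheodory_measurable_setI R V (@hausdorff R m.+1 m)) => //.
  by apply: open_caratheodory; apply: open_eball.
apply: (@lt_le_trans _ _ (\int[mu]_(x in N) (cst (eta / 2)%:E x))%E).
  by rewrite (integral_cst mu mN) mule_gt0// lte_fin divr_gt0.
apply: (@le_trans _ _ (\int[mu]_(x in N) (b x)%:E)%E).
  apply: (ge0_le_integral mu mN).
  - by move=> x _; rewrite lee_fin divr_ge0// ltW.
  - exact: measurable_cst.
  - apply/measurable_EFinP; apply: (measurable_funS mS _ mb); by move=> x [].
  by move=> x [_ xp]; rewrite lee_fin; exact: b_near.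
apply: (ge0_subset_integral mu mN mS).
- exact/measurable_EFinP.
- by move=> x _; rewrite lee_fin; exact: b0.
- by move=> x [].
Qed.

Lemma willmore_equality : mu unit_sphere = (\int[mu]_(p in Sigma) (f p)%:E)%E ->
  forall U phi p, local_defining_function Omega p U phi -> Sigma p ->
    H p = 0 \/ umbilic_contact U phi p.
Proof.
move=> eqW U phi p chart Sp; have [D [D0 Df dens]] := local_density chart Sp.
apply; apply/eqP; rewrite eq_le Df /= leNgt; apply/negP => Dlt.
by have := willmore_strict Sp D0 Dlt dens; rewrite eqW ltxx.
Qed.

End willmore_inequality.

(** * Rigidity *)

Section small_increments.
Context {R : realType}.

Lemma small_increments_const (f : R -> R) :
  (forall t, 0 <= t <= 1 -> forall e, 0 < e -> exists2 d, 0 < d &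
     forall s, 0 <= s <= 1 -> `|s - t| < d -> `|f s - f t| <= e * `|s - t|) ->
  f 1 = f 0.
Proof.
(* [c] clips the line to [0, 1]. It is 1-Lipschitz, so the composite [f \o c] has derivative 0 on
   the whole line. *)
move=> hf; pose c (t : R) := Num.max 0 (1 - Num.max 0 (1 - t)).
have c01 t : 0 <= c t <= 1.
  by rewrite /c le_max lexx/= ge_max ler01/= gerBl le_max lexx.
have clip s t : `|c s - c t| <= `|s - t|.
  have e (a b : R) : `|1 - a - (1 - b)| = `|a - b|.
    by rewrite (_ : 1 - a - (1 - b) = b - a) ?(distrC b)//; ring.
  apply: le_trans (max0_lipschitz _ _) _; rewrite e.
  by apply: le_trans (max0_lipschitz _ _) _; rewrite e.
have c1 : c 1 = 1 by rewrite /c subrr maxxx subr0 max_r// ler01.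
have c0 : c 0 = 0 by rewrite /c subr0 (max_r ler01) subrr maxxx.
suff h (t : R) : is_derive t (1 : R) (f \o c) (0 : R).
  by have := is_derive_0_is_cst 1 0 h; rewrite /= c1 c0.
have key : (h^-1 *: ((f \o c) (h *: (1 : R) + t) - (f \o c) t)) @[h --> 0^'] --> (0 : R).
  apply/cvgrPdist_le => e e0; have [d d0 hd] := hf (c t) (c01 t) e e0.
  apply/nbhs_ballP; exists d => //= h; rewrite -ball_normE/= sub0r normrN => hh h0.
  rewrite sub0r normrN /GRing.scale/= mulr1 normrM normfV ler_pdivrMl ?normr_gt0//.
  have hc : `|c (h + t) - c t| <= `|h|.
    by apply: le_trans (clip _ _) _; rewrite addrK.
  apply: le_trans (hd _ (c01 _) (le_lt_trans hc hh)) _.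
  by rewrite mulrC ler_wpM2r// ltW.
by apply: DeriveDef; [apply: cvgP; exact: key|apply: cvg_lim => //; exact: key].
Qed.

Lemma small_increments_const_row {k : nat} (f : R -> 'rV[R]_k) :
  (forall t, 0 <= t <= 1 -> forall e, 0 < e -> exists2 d, 0 < d &
     forall s, 0 <= s <= 1 -> `|s - t| < d -> enorm (f s - f t) <= e * `|s - t|) ->
  f 1 = f 0.
Proof.
move=> hf; apply/eqP; rewrite -subr_eq0 -enorm_eq0; apply/eqP.
rewrite -[RHS](@enorm0 R k) -[in RHS](subrr (f 0)).
apply: (small_increments_const (f := fun t => enorm (f t - f 0))) => t t01 e e0.
have [d d0 hd] := hf t t01 e e0; exists d => // s s01 st.
apply: le_trans (hd s s01 st); apply: le_trans (ler_dist_enorm _ _) _.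
by rewrite opprB addrA subrK.
Qed.

End small_increments.

(** * Local rigidity of umbilic boundary pieces *)

Section local_rigidity.
Context {R : realType} {m : nat}.
Local Notation V := 'rV[R]_m.+1.
Variable Omega : set V.
Hypothesis m_gt1 : (1 < m)%N.
Local Notation Sigma := (boundary Omega).
Local Notation H := (mean_curvature Omega).
Variables (U : set V) (phi : V -> R) (p : V) (r0 : R).
Hypothesis chart : local_defining_function Omega p U phi.
Hypothesis Sp : Sigma p.
Hypothesis r0_gt0 : 0 < r0.
Hypothesis umb : forall q, Sigma q -> enorm (q - p) < r0 -> U q ->
  forall v, dot v (unit_gradient phi q) = 0 ->
    v *m shape phi q = (H q / m%:R) *: v.
Local Notation u := (unit_gradient phi).

(** [umb] governs only tangent vectors; by tangency the normal part of [x - q] is negligible, so the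
    increment of the normal is still [H q / m] times [x - q] to first order. *)
Lemma umbilic_increment q : Sigma q -> enorm (q - p) < r0 -> U q ->
  forall e, 0 < e -> exists2 d, 0 < d & forall x, Sigma x -> enorm (x - q) < d ->
    enorm (u x - u q - (H q / m%:R) *: (x - q)) <= e * enorm (x - q).
Proof.
move=> Sq qp Uq e e0; have chq := chart_recenter chart Uq.
have [oU _ sphi g0 _] := chq.
have nu1 : enorm (u q) = 1 by exact: enorm_unit_gradient (g0 _ Uq).
have [C [C0 hC]] := mulmx_lipschitz (shape phi q).
have um := umb Sq qp Uq; move: (H q / m%:R) um => k um.
have K0 : 0 < 1 + C + `|k| by rewrite !ltr_pwDl// addr_ge0.
have e'0 : 0 < e / (1 + C + `|k|) by rewrite divr_gt0.
have [d1 d10 h1] := unit_gradient_sdiff oU Uq sphi (g0 _ Uq) e'0.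
have [d2 d20 h2] := boundary_tangency chq e'0.
exists (Num.min d1 d2); first by rewrite lt_min d10.
move=> x Sx; rewrite lt_min => /andP[x1 x2].
have q1 : enorm (q - q) < d1 by rewrite subrr enorm0.
have q2 : enorm (q - q) < d2 by rewrite subrr enorm0.
have := h1 x q x1 q1; have := h2 x q Sx Sq x2 q2.
set d := x - q; set c := dot d (u q); set a := e / _.
move=> cd du.
have dJ : d *m shape phi q - k *: d = c *: (u q *m shape phi q) - (k * c) *: u q.
  have dt : dot (d - c *: u q) (u q) = 0.
    by rewrite dotBl (dotZl c) -sqr_enorm nu1 expr1n mulr1 subrr.
  have := um _ dt; rewrite mulmxBl -(scalemxAl c) scalerBr scalerA => /eqP.
  rewrite subr_eq => /eqP ->; rewrite addrAC (addrC (k *: d)) addrK.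
  by rewrite addrC.
have -> : u x - u q - k *: d = (u x - u q - d *m shape phi q) +
    (c *: (u q *m shape phi q) - (k * c) *: u q).
  by rewrite -dJ addrA subrK.
apply: le_trans (ler_enormD _ _) _.
have b1 : enorm (c *: (u q *m shape phi q) - (k * c) *: u q) <= a * enorm d * (C + `|k|).
  apply: le_trans (ler_enormB _ _) _; rewrite (enormZ c) (enormZ (k * c)) nu1 mulr1.
  rewrite normrM mulrDr; apply: lerD.
    by apply: ler_pM; rewrite ?enorm_ge0//; apply: le_trans (hC _) _; rewrite nu1 mulr1.
  by rewrite mulrC ler_wpM2r.
apply: le_trans (lerD du b1) _; rewrite -{1}[a * enorm d]mulr1 -mulrDr addrA mulrAC.
by rewrite /a divfK// gt_eqF.
Qed.

(** Constancy of the factor [K] is the content of the Codazzi equations; here it comes from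
    comparing first-order increments. Once [K] is constant, [u x - K x] has derivative zero along
    the boundary. *)
Lemma umbilic_constant : exists2 r, 0 < r & forall x, Sigma x -> enorm (x - p) < r ->
  H x = H p /\ u x - (H p / m%:R) *: x = u p - (H p / m%:R) *: p.
Proof.
have [oU Up sphi g0 _] := chart.
have [e [k [ee en ek]]] := curvature_frame chart.
have [d1 d10 dU] := chart_ball chart.
have [d2 d20 inj] := patch_injective chart ee en.
pose r := Num.min r0 (Num.min d1 d2).
have r_gt0 : 0 < r by rewrite !lt_min r0_gt0 d10.
have rr x : enorm (x - p) < r -> [/\ enorm (x - p) < r0, U x & enorm (x - p) < d2].
  by rewrite !lt_min => /and3P[? /dU ? ?]; split.
have [s s0 hs] := patch_surjective chart Sp ee en r_gt0.
(* [F] inverts the tangential projection near [p]; it is 2-Lipschitz and turns statements about the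
   boundary into statements on a ball of R^m. *)
have [F hF] : {F & forall y, enorm y < s ->
    [/\ Sigma (F y), enorm (F y - p) < r & (F y - p) *m e^T = y]}.
  apply: (@choice _ _ (fun y x => enorm y < s ->
    [/\ Sigma x, enorm (x - p) < r & (x - p) *m e^T = y])) => y.
  have [/hs[x hx]|ny] := pselect (enorm y < s); first by exists x.
  by exists p => /ny.
have FB y y' : enorm y < s -> enorm y' < s -> (F y - F y') *m e^T = y - y'.
  move=> /hF[_ _ e1] /hF[_ _ e2]; rewrite -{2}e1 -{2}e2 -mulmxBl.
  by rewrite opprB addrA subrK.
have Flip y y' : enorm y < s -> enorm y' < s -> enorm (F y - F y') <= 2 * enorm (y - y').
  move=> ys ys'; rewrite -(FB y y')//.
  have [S1 /rr[_ _ l1] _] := hF y ys; have [S2 /rr[_ _ l2] _] := hF y' ys'.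
  exact: inj.
have Fx x : Sigma x -> enorm (x - p) < r -> enorm (x - p) < s -> F ((x - p) *m e^T) = x.
  move=> Sx xr xs; have ys := le_lt_trans (enorm_proj_le (x - p) ee) xs.
  have [S1 /rr[_ _ l1] e1] := hF _ ys; have /rr[_ _ l2] := xr.
  apply/eqP; rewrite -subr_eq0 -enorm_eq0 eq_le enorm_ge0 andbT.
  apply: le_trans (inj _ _ S1 Sx l1 l2) _.
  have -> : F ((x - p) *m e^T) - x = (F ((x - p) *m e^T) - p) - (x - p).
    by rewrite opprB addrA subrK.
  by rewrite mulmxBl e1 subrr enorm0 mulr0.
have [K KE] : {K : 'rV[R]_m -> R & forall y, K y = H (F y) / m%:R}.
  by exists (fun y => H (F y) / m%:R).
have incr y0 : enorm y0 < s -> forall a, 0 < a -> exists2 d, 0 < d &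
    forall y, enorm y < s -> enorm (y - y0) < d ->
      enorm (u (F y) - u (F y0) - K y0 *: (F y - F y0)) <= a * enorm (y - y0).
  move=> y0s a a0; have [S0 /rr[l0 U0 _] _] := hF y0 y0s.
  have a2 : 0 < a / 2 by rewrite divr_gt0.
  have [d d0 hd] := umbilic_increment S0 l0 U0 a2.
  exists (d / 2); first by rewrite divr_gt0.
  move=> y ys yy0; have [Sy _ _] := hF y ys; have Fl := Flip y y0 ys y0s.
  rewrite KE.
  apply: le_trans (hd (F y) Sy _) _.
    by apply: le_lt_trans Fl _; rewrite -ltr_pdivlMl// mulrC.
  by apply: le_trans (ler_wpM2l (ltW a2) Fl) _; rewrite mulrA divfK.
have segs (y y' : 'rV[R]_m) t : enorm y < s -> enorm y' < s -> 0 <= t <= 1 ->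
    enorm (y + t *: (y' - y)) < s.
  move=> ys ys' t01; have := @eball_convex R m 0 s y' y t t01; rewrite !subr0.
  by apply.
have [N NE] : {N : 'rV[R]_m -> 'rV[R]_m & forall y, N y = u (F y) *m e^T}.
  by exists (fun y => u (F y) *m e^T).
have Nincr y0 : enorm y0 < s -> forall a, 0 < a -> exists2 d, 0 < d &
    forall y, enorm y < s -> enorm (y - y0) < d ->
      enorm (N y - N y0 - K y0 *: (y - y0)) <= a * enorm (y - y0).
  move=> y0s a a0; have [d d0 hd] := incr y0 y0s a a0; exists d => // y ys yy0.
  apply: le_trans (hd y ys yy0); rewrite !NE -(FB y y0)// scalemxAl -!mulmxBl.
  exact: enorm_proj_le.
(* The differential of N is K times the identity, so N y i only depends on y i;
   comparing difference quotients of N in the i-th direction shows that K is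
   constant along the slices where y i is fixed, for every i. *)
have Nslice i y y' : enorm y < s -> enorm y' < s -> y ord0 i = y' ord0 i ->
    N y ord0 i = N y' ord0 i.
  move=> ys ys' yy'.
  have := @small_increments_const R (fun t => N (y + t *: (y' - y)) ord0 i).
  rewrite scale1r scale0r addr0 subrKC => <- // t t01 a a0.
  have L0 : 0 < enorm (y' - y) + 1 by rewrite ltr_wpDl ?enorm_ge0.
  have [d d0 hd] := Nincr _ (segs y y' t ys ys' t01) (a / (enorm (y' - y) + 1)) (divr_gt0 a0 L0).
  exists (d / (enorm (y' - y) + 1)); first by rewrite divr_gt0.
  move=> t' t'01; rewrite ltr_pdivlMr// => tt'.
  have yy : y + t' *: (y' - y) - (y + t *: (y' - y)) = (t' - t) *: (y' - y).
    by rewrite opprD addrACA subrr add0r -scalerBl.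
  have := hd _ (segs y y' t' ys ys' t'01); rewrite yy enormZ.
  have -> : `|t' - t| * enorm (y' - y) < d.
    by apply: le_lt_trans tt'; rewrite ler_wpM2l// lerDl.
  move=> /(_ isT) h; have := le_trans (coord_le_enorm _ i) h.
  set A := N _; set B := N _; rewrite !mxE yy' subrr !mulr0 subr0 => /le_trans; apply.
  rewrite mulrCA [leRHS]mulrC ler_wpM2l// -mulrA ler_piMr ?(ltW a0)//.
  by rewrite ler_pdivrMl// mulr1 lerDl.
have entryE (A B v : 'rV[R]_m) (c : R) i :
    (A - B - c *: v) ord0 i = A ord0 i - B ord0 i - c * v ord0 i by rewrite !mxE.
have Kslice i y y' : enorm y < s -> enorm y' < s -> y ord0 i = y' ord0 i -> K y = K y'.
  move=> ys ys' yy'; apply/eqP; rewrite -subr_eq0 -normr_le0.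
  apply/ler_addgt0Pr => a a0; rewrite add0r; have a2 : 0 < a / 2 by rewrite divr_gt0.
  have [da da0 hda] := Nincr y ys _ a2; have [db db0 hdb] := Nincr y' ys' _ a2.
  pose M := Num.min (Num.min da db) (Num.min (s - enorm y) (s - enorm y')).
  have M0 : 0 < M by rewrite !lt_min da0 db0 !subr_gt0 ys.
  have [t t0 tM] : exists2 t, 0 < t & t < M.
    by exists (M / 2); rewrite ?divr_gt0// ltr_pdivrMr// ltr_pMr// ltr1n.
  move: tM; rewrite !lt_min => /andP[/andP[t1 t2] /andP[t3 t4]].
  have [v [ev vi]] : exists v : 'rV[R]_m, enorm v = t /\ v ord0 i = t.
    exists (t *: delta_mx ord0 i); rewrite enormZ enorm_delta mulr1 gtr0_norm//.
    by rewrite !mxE !eqxx mulr1.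
  have shift z : t < s - enorm z -> enorm (z + v) < s.
    by move=> h; apply: le_lt_trans (ler_enormD _ _) _; rewrite ev addrC -ltrBrDr.
  have sub z : z + v - z = v by rewrite addrC addKr.
  have := hda (y + v) (shift y t3); have := hdb (y' + v) (shift y' t4).
  rewrite !sub ev => /(_ t2) h2 /(_ t1) h1.
  have {}h1 := le_trans (coord_le_enorm _ i) h1.
  have {}h2 := le_trans (coord_le_enorm _ i) h2.
  have n1 := Nslice i y y' ys ys' yy'.
  have n2 : N (y + v) ord0 i = N (y' + v) ord0 i.
    by apply: Nslice; [exact: shift|exact: shift|rewrite !mxE yy'].
  rewrite (entryE (N (y + v))) vi in h1; rewrite (entryE (N (y' + v))) vi -n1 -n2 in h2.
  move: h1 h2; move: (K y) (K y') (N (y + v) ord0 i) (N y ord0 i) => k1 k2 x z h1 h2.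
  rewrite -(ler_pM2r t0) -{1}(gtr0_norm t0) -normrM.
  have -> : (k1 - k2) * t = (x - z - k2 * t) - (x - z - k1 * t) by ring.
  by apply: le_trans (ler_normB _ _) _; rewrite (splitr a) mulrDl lerD.
have s0' : enorm (0 : 'rV[R]_m) < s by rewrite enorm0.
have Kconst y : enorm y < s -> K y = K 0.
  move=> ys; have m0 := ltn_trans (ltn0Sn 0) m_gt1.
  pose i0 := Ordinal m0; pose i1 := Ordinal m_gt1.
  (* [z] lies in a common slice with [y] for the index [i0] and with 0 for the index [i1]; this is
     where two tangent directions are required. *)
  have [z [zs z0 z1]] : exists z : 'rV[R]_m,
      [/\ enorm z < s, y ord0 i0 = z ord0 i0 & z ord0 i1 = (0 : 'rV[R]_m) ord0 i1].
    exists (y ord0 i0 *: delta_mx ord0 i0); split.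
    - by rewrite enormZ enorm_delta mulr1; apply: le_lt_trans ys; exact: coord_le_enorm.
    - by rewrite !mxE !eqxx mulr1.
    - by rewrite !mxE andbF mulr0.
  by rewrite (Kslice i0 y z ys zs z0); exact: (Kslice i1 z 0 zs s0' z1).
have F0 : F 0 = p.
  by rewrite -[in LHS](mul0mx _ e^T) -(subrr p) Fx// subrr enorm0.
have KH : K 0 = H p / m%:R by rewrite KE F0.
(* With [K] constant, the increments of [u - K x] along the segment from 0 to [y] are negligible
   compared with the parameter. *)
have Wconst y : enorm y < s -> u (F y) - K 0 *: F y = u p - K 0 *: p.
  move=> ys.
  have := @small_increments_const_row R _ (fun t => u (F (t *: y)) - K 0 *: F (t *: y)).
  rewrite scale1r scale0r F0; apply=> t t01 a a0.
  have ty t' : 0 <= t' <= 1 -> enorm (t' *: y) < s.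
    by move=> t01'; have := segs 0 y t' s0' ys t01'; rewrite add0r subr0.
  have L0 : 0 < enorm y + 1 by rewrite ltr_wpDl ?enorm_ge0.
  have [d d0 hd] := incr _ (ty t t01) (a / (enorm y + 1)) (divr_gt0 a0 L0).
  exists (d / (enorm y + 1)); first by rewrite divr_gt0.
  move=> t' t'01; rewrite ltr_pdivlMr// => tt'.
  have yy : t' *: y - t *: y = (t' - t) *: y by rewrite scalerBl.
  have dist : `|t' - t| * enorm y < d.
    by apply: le_lt_trans tt'; rewrite ler_wpM2l// lerDl.
  have := hd _ (ty t' t'01); rewrite yy (enormZ (t' - t)) => /(_ dist).
  rewrite (Kconst _ (ty t t01)); set A := u _; set B := u _.
  have -> : A - B - K 0 *: (F (t' *: y) - F (t *: y)) =
      A - K 0 *: F (t' *: y) - (B - K 0 *: F (t *: y)).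
    rewrite scalerBr !opprB -!addrA; congr (_ + _).
    by rewrite addrCA [RHS]addrCA (addrC (- B)).
  move=> /le_trans; apply.
  rewrite mulrCA [leRHS]mulrC ler_wpM2l// -mulrA ler_piMr ?(ltW a0)//.
  by rewrite ler_pdivrMl// mulr1 lerDl.
exists (Num.min r s); first by rewrite lt_min r_gt0.
move=> x Sx; rewrite lt_min => /andP[xr xs].
have ys := le_lt_trans (enorm_proj_le (x - p) ee) xs.
have := Wconst _ ys; have := Kconst _ ys.
rewrite KH KE (Fx x Sx xr xs) => Hx Wx.
split; last exact: Wx.
have m0 : (m%:R^-1 : R) != 0 by rewrite invr_eq0 pnatr_eq0 -lt0n (ltn_trans _ m_gt1).
exact: (mulIf m0 Hx).
Qed.

End local_rigidity.

Section sphere.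
Context {R : realType} {m : nat}.
Local Notation V := 'rV[R]_m.+1.

(* Points near a are reached along the stereographic parametrization
   ((1 - s^2) a + 2 s v) / (1 + s^2) of great circles. *)
Lemma sphere_rotation (a v b : V) s : enorm a = 1 -> enorm v = 1 -> dot v a = 0 ->
  exists z, [/\ enorm z = 1, enorm (z - a) <= 2 * `|s| &
    dot z b - dot a b = 2 * s / (1 + s ^+ 2) * (dot v b - s * dot a b)].
Proof.
move=> a1 v1 va; have s1 : 0 < 1 + s ^+ 2 by rewrite ltr_pwDl ?ltr01 ?sqr_ge0.
have s10 : 1 + s ^+ 2 != 0 by rewrite gt_eqF.
have aa : dot a a = 1 by rewrite -sqr_enorm a1 expr1n.
have vv : dot v v = 1 by rewrite -sqr_enorm v1 expr1n.
have quad x y : dot (x *: a + y *: v) (x *: a + y *: v) = x ^+ 2 + y ^+ 2.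
  by rewrite dotDl !(dotDr, dotZl, dotZr) aa vv va (dotC a v) va; ring.
pose c := (1 - s ^+ 2) / (1 + s ^+ 2); pose d := 2 * s / (1 + s ^+ 2).
exists (c *: a + d *: v); split.
- have sq : enorm (c *: a + d *: v) ^+ 2 = 1 by rewrite sqr_enorm quad /c /d; field.
  by apply/eqP; rewrite -(@eqrXn2 _ 2)// ?enorm_ge0// sq expr1n.
- have -> : c *: a + d *: v - a = (c - 1) *: a + d *: v.
    by rewrite scalerBl scale1r addrAC.
  rewrite -(@ler_pXn2r _ 2)// ?nnegrE ?enorm_ge0 ?mulr_ge0//.
  rewrite sqr_enorm quad (exprMn 2 2 `|s|) real_normK ?num_real//.
  have -> : (c - 1) ^+ 2 + d ^+ 2 = 2 ^+ 2 * s ^+ 2 / (1 + s ^+ 2) by rewrite /c /d; field.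
  rewrite ler_pdivrMr//; apply: (ler_peMr (mulr_ge0 (sqr_ge0 2) (sqr_ge0 s))).
  by rewrite lerDl sqr_ge0.
- by rewrite dotDl !dotZl /c /d; field.
Qed.

(** At a local maximum the tangential part of [b] vanishes, so [b] is a multiple of [a]; the
    second-order term of a rotation then gives [dot a b >= 0], which excludes [- a]. A direction of
    rotation exists because [m] is positive. *)
Lemma sphere_local_max (a b : V) d : (0 < m)%N -> enorm a = 1 -> enorm b = 1 -> 0 < d ->
  (forall z, enorm z = 1 -> enorm (z - a) < d -> dot z b <= dot a b) -> a = b.
Proof.
move=> m0 a1 b1 d0 hmax.
have key v : enorm v = 1 -> dot v a = 0 -> forall s, 0 < s -> 2 * s < d ->
    dot v b <= s * dot a b.
  move=> v1 va s s0 sd; have [z [z1 za zb]] := sphere_rotation b s a1 v1 va.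
  rewrite (gtr0_norm s0) in za.
  have := hmax z z1 (le_lt_trans za sd); rewrite -subr_le0 zb pmulr_rle0 ?subr_le0//.
  by rewrite divr_gt0 ?mulr_gt0 // ltr_pwDl ?ltr01 ?sqr_ge0.
have ab1 : dot a b <= 1 by apply: le_trans (ler_dot _ _) _; rewrite a1 b1 mulr1.
have le0 v : enorm v = 1 -> dot v a = 0 -> dot v b <= 0.
  move=> v1 va; apply/ler_addgt0Pr => e e0; rewrite add0r.
  pose s := Num.min e (d / 4).
  have s0 : 0 < s by rewrite lt_min e0 divr_gt0.
  have sd : 2 * s < d.
    apply: (@le_lt_trans _ _ (2 * (d / 4))); first by rewrite ler_pM2l// ge_min lexx orbT.
    by lra.
  apply: le_trans (key v v1 va s s0 sd) _.
  apply: (@le_trans _ _ s); first by rewrite ler_piMr ?(ltW s0).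
  by rewrite ge_min lexx.
have eq0 v : enorm v = 1 -> dot v a = 0 -> dot v b = 0.
  move=> v1 va; apply/eqP; rewrite eq_le le0//= -oppr_le0 -dotNl le0 ?enormN//.
  by rewrite dotNl va oppr0.
have [e ee en] := orthonormal_completion a1.
have e1 i : enorm (row i e) = 1 by exact: enorm_row.
have ab0 : 0 <= dot a b.
  have d4 : 0 < d / 4 by rewrite divr_gt0.
  have := key _ (e1 (Ordinal m0)) (en (Ordinal m0)) (d / 4) d4.
  by rewrite (eq0 _ (e1 (Ordinal m0)) (en (Ordinal m0))) pmulr_rge0//; apply; lra.
have bE : b = dot b a *: a.
  rewrite {1}(frame_decomp b ee en a1) (_ : b *m e^T = 0) ?mul0mx ?add0r//.
  by apply/rowP => i; rewrite mul_trE dotC eq0// mxE.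
have : enorm b = dot b a by rewrite {1}bE enormZ a1 mulr1 ger0_norm// dotC.
by rewrite b1 => e'; rewrite bE -e' scale1r.
Qed.

End sphere.

Section extremal.
Context {R : realType} {m : nat}.
Local Notation V := 'rV[R]_m.+1.
Variable Omega : set V.
Local Notation Sigma := (boundary Omega).
Local Notation H := (mean_curvature Omega).

(** First-order condition for [dot w] at a local maximum on the boundary, in one-sided form; used
    with [v] and [- v], it makes [w] normal. *)
Lemma boundary_local_max U phi p w r v : local_defining_function Omega p U phi ->
  Sigma p -> 0 < r -> enorm w = 1 ->
  (forall x, Sigma x -> enorm (x - p) < r -> dot (x - p) w <= 0) ->
  dot v (unit_gradient phi p) = 0 -> dot v w <= 0.
Proof.
move=> chart Sp r0 w1 hw vn.
have nu1 : enorm (unit_gradient phi p) = 1.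
  by have [_ Up _ g0 _] := chart; exact: enorm_unit_gradient (g0 _ Up).
suff h e : 0 < e -> e < 1 -> dot v w <= e * enorm v.
  have [->|v0] := eqVneq v 0; first by rewrite -(scale0r 0) dotZl mul0r.
  have ev : 0 < enorm v by rewrite enorm_gt0.
  apply/ler_addgt0Pr => e e0; rewrite add0r.
  pose t := Num.min (e / enorm v) (1 / 2).
  apply: (@le_trans _ _ (t * enorm v)).
    by apply: h; rewrite ?lt_min ?divr_gt0 ?gt_min//=; apply/orP; right; lra.
  by rewrite -ler_pdivlMr// ge_min lexx.
move=> e0 e1; have [d d0 hd] := boundary_graph chart Sp e0.
pose t := Num.min (d / 2) (r / 4) / (enorm v + 1).
have L0 : 0 < enorm v + 1 by rewrite ltr_wpDl ?enorm_ge0.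
have t0 : 0 < t by rewrite divr_gt0// lt_min !divr_gt0.
have tv : enorm (t *: v) <= Num.min (d / 2) (r / 4).
  rewrite enormZ (gtr0_norm t0) /t mulrAC -mulrA ler_piMr//.
    by rewrite le_min !divr_ge0// ltW.
  by rewrite ler_pdivrMr// mul1r lerDl.
have tvn : dot (t *: v) (unit_gradient phi p) = 0 by rewrite (dotZl t) vn mulr0.
have [|s [s1 Sx]] := hd _ tvn.
  by apply: le_lt_trans tv _; rewrite gt_min; apply/orP; left; lra.
move: Sx s1 => /hw; have -> : p + t *: v + s *: unit_gradient phi p - p =
    t *: v + s *: unit_gradient phi p by rewrite -(addrA p) addrAC subrr add0r.
move=> hx s1; have sn : `|dot (s *: unit_gradient phi p) w| <= e * (t * enorm v).
  apply: le_trans (ler_abs_dot _ _) _; rewrite (enormZ s) nu1 w1 !mulr1.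
  by apply: le_trans s1 _; rewrite (enormZ t) (gtr0_norm t0).
have : dot (t *: v + s *: unit_gradient phi p) w <= 0.
  apply: hx; apply: le_lt_trans (ler_enormD _ _) _.
  rewrite (enormZ s) nu1 mulr1.
  have tr : enorm (t *: v) <= r / 4 by apply: le_trans tv _; rewrite ge_min lexx orbT.
  have : e * enorm (t *: v) <= enorm (t *: v) by rewrite ler_piMl ?enorm_ge0// ltW.
  move: s1 tr; move: (enorm (t *: v)) (e * _) `|s| => x y z h1 h2 h3.
  by lra.
rewrite dotDl (dotZl t) => h; rewrite -(ler_pM2l t0) mulrCA.
move: h sn; rewrite ler_norml => h /andP[sn _]; move: h sn.
move: (dot _ w) (t * dot v w) (e * _) => x y z h1 h2.
by lra.
Qed.

(** Stated for a compact, relatively open [K] in order to serve twice: for the whole boundary, where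
    it gives a starting point, and for the part off the osculated sphere. *)
Lemma exists_nonzero_curvature (K : set V) : (0 < m)%N -> smooth_boundary Omega ->
  compact K -> K !=set0 -> K `<=` Sigma ->
  (forall p, K p -> exists2 r, 0 < r & forall x, Sigma x -> enorm (x - p) < r -> K x) ->
  exists2 p, K p & H p != 0.
Proof.
move=> m0 smooth cK [p1 Kp1] KS Kopen.
(* Any centre other than [p1] would do; the distance to the farthest point is then positive. *)
pose q := p1 + delta_mx ord0 ord0.
have cont : continuous (fun x : V => enorm (x - q)).
  move=> x; apply/continuous_enormP => e e0; exists e => // y yx.
  apply: le_lt_trans (ler_dist_enorm _ _) _.
  by rewrite opprB addrA subrK.
have [p Kp pmax] := @EVT_max_rV _ _ (fun x : V => enorm (x - q)) _ (ex_intro _ p1 Kp1) cK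
  (continuous_subspaceT cont).
rewrite inE in Kp; exists p => //.
have far x : K x -> enorm (x - q) <= enorm (p - q) by move=> Kx; apply: pmax; rewrite inE.
pose rho := enorm (p - q).
have rho0 : 0 < rho.
  apply: lt_le_trans (far _ Kp1); rewrite enormB /q addrAC subrr add0r.
  by rewrite enorm_delta.
pose w := rho^-1 *: (p - q).
have w1 : enorm w = 1 by rewrite enormZ gtr0_norm ?invr_gt0// mulVf// gt_eqF.
have [r r0 hr] := Kopen p Kp.
(* Expanding [enorm (x - q) <= rho] around [p] gives [dot (x - p) (p - q) <= - enorm (x - p) ^+ 2 /
   2], to be divided by [rho]. *)
have hw x : Sigma x -> enorm (x - p) < r ->
    dot (x - p) w <= - (2 * rho)^-1 * enorm (x - p) ^+ 2.
  move=> Sx xp; have Kx := hr x Sx xp; have := far x Kx.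
  rewrite -(@ler_pXn2r _ 2)// ?nnegrE ?enorm_ge0//.
  have -> : x - q = (x - p) + (p - q) by rewrite addrA subrK.
  rewrite /w dotZr; move: (x - p) (p - q) => X Y; rewrite !sqr_enorm dotDl !dotDr (dotC Y X).
  move: (dot X X) (dot X Y) (dot Y Y) => a b c h.
  rewrite -(ler_pM2l rho0) mulrA mulfV ?gt_eqF// mul1r invfM mulrA mulrN.
  have -> : rho * (2^-1 / rho) = 2^-1 by field; rewrite gt_eqF.
  by lra.
have c0 : 0 <= (2 * rho)^-1 by rewrite invr_ge0 mulr_ge0// ltW.
have hw0 x : Sigma x -> enorm (x - p) < r -> dot (x - p) w <= 0.
  move=> Sx xp; apply: le_trans (hw x Sx xp) _.
  by rewrite mulNr oppr_le0 mulr_ge0// sqr_ge0.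
have Sp := KS _ Kp; have [U [phi chart]] := smooth p Sp.
have nu1 : enorm (unit_gradient phi p) = 1.
  by have [_ Up _ g0 _] := chart; exact: enorm_unit_gradient (g0 _ Up).
have [e [k [ee en ek]]] := curvature_frame chart.
have ew i : dot (row i e) w = 0.
  apply/eqP; rewrite eq_le (boundary_local_max chart Sp r0 w1 hw0 (en i)) /=.
  rewrite -oppr_le0 -dotNl (boundary_local_max chart Sp r0 w1 hw0)//.
  by rewrite dotNl en oppr0.
(* [w] is normal to the boundary but may be the outer normal or its opposite. In both cases all the
   curvatures have the sign of [sg], so their sum is nonzero. *)
pose sg := dot w (unit_gradient phi p).
have wE : w = sg *: unit_gradient phi p.
  rewrite {1}(frame_decomp w ee en nu1) (_ : w *m e^T = 0) ?mul0mx ?add0r//.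
  by apply/rowP => i; rewrite mul_trE dotC ew mxE.
have sg1 : sg ^+ 2 = 1.
  have : enorm w ^+ 2 = 1 by rewrite w1 expr1n.
  by rewrite wE (enormZ sg) nu1 mulr1 real_normK ?num_real.
rewrite wE in hw.
have ki i : rho^-1 <= sg * k ord0 i.
  have := second_order_contact chart Sp sg1 c0 r0 hw (en i) (enorm_row i ee).
  rewrite ek dotZl dot_rows// eqxx mulr1; apply: le_trans.
  by rewrite invfM mulrA mulfV ?mul1r.
rewrite (mean_curvatureE chart Sp) -(curvature_sum chart ee en ek).
apply/negP => /eqP k0; have : 0 < \sum_(i < m) sg * k ord0 i.
  rewrite (bigD1 (Ordinal m0))//= ltr_pwDl ?sumr_ge0//.
    by apply: lt_le_trans (ki _); rewrite invr_gt0.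
  by move=> i _; apply: le_trans (ki i); rewrite invr_ge0 ltW.
by rewrite -mulr_sumr k0 mulr0 ltxx.
Qed.

End extremal.

(** * Global rigidity: the domain is the osculated ball *)

Section rigidity.
Context {R : realType} {m : nat}.
Local Notation V := 'rV[R]_m.+1.
Variable Omega : set V.
Hypothesis m_gt1 : (1 < m)%N.
Hypothesis Omega_domain : bounded_domain Omega.
Hypothesis Omega_smooth : smooth_boundary Omega.
Local Notation Sigma := (boundary Omega).
Local Notation H := (mean_curvature Omega).
Hypothesis umb : forall U phi p, local_defining_function Omega p U phi -> Sigma p ->
  H p = 0 \/ umbilic_contact Omega U phi p.

Let m_gt0 : (0 < m)%N. Proof. exact: ltnW. Qed.

Lemma umbilic_constant_near U phi p : local_defining_function Omega p U phi ->
  Sigma p -> H p != 0 ->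
  exists2 r, 0 < r & forall x, Sigma x -> enorm (x - p) < r ->
    [/\ U x, H x / m%:R = H p / m%:R &
      unit_gradient phi x - (H p / m%:R) *: x = unit_gradient phi p - (H p / m%:R) *: p].
Proof.
move=> chart Sp H0; have aH : 0 < `|H p| by rewrite normr_gt0.
have [d d0 hd] := mean_curvature_continuous_at chart Sp aH.
have umbd q : Sigma q -> enorm (q - p) < d -> U q -> forall v,
    dot v (unit_gradient phi q) = 0 -> v *m shape phi q = (H q / m%:R) *: v.
  move=> Sq qp Uq; have [Hq|[_ _]//] := umb (chart_recenter chart Uq) Sq.
  by have := hd q Sq qp; rewrite Hq sub0r normrN ltxx.
have [r r0 hr] := umbilic_constant m_gt1 chart Sp d0 umbd.
have [d1 d10 hU] := chart_ball chart.
exists (Num.min r d1); first by rewrite lt_min r0.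
move=> x Sx; rewrite lt_min => /andP[xr xd]; have [e1 e2] := hr x Sx xr.
by split; [exact: hU|rewrite e1|exact: e2].
Qed.

Variables (c : V) (kappa : R).
Hypothesis kappa_gt0 : 0 < kappa.

(* The part of the boundary that osculates the sphere of centre c and radius
   1 / kappa. *)
Let A : set V := [set p | [/\ Sigma p, H p / m%:R = kappa & exists U phi,
  local_defining_function Omega p U phi /\ unit_gradient phi p = kappa *: (p - c)]].

Let HA p : H p / m%:R = kappa -> H p != 0.
Proof. by apply: contra_eq_neq => ->; rewrite mul0r lt_eqF. Qed.

Let A_sphere p : A p -> enorm (p - c) = kappa^-1.
Proof.
move=> [_ _ [U [phi [chart up]]]]; have [_ Up _ g0 _] := chart.
have := enorm_unit_gradient (g0 _ Up); rewrite up enormZ gtr0_norm// => h.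
by rewrite -[RHS]mulr1 -h mulKf// gt_eqF.
Qed.

(** Near [p] both [H] and [u x - (H p / m) x] are constant on the boundary, so membership in [A]
    spreads from any nearby point to all others. With [p] in [A] this gives openness; with [p] a
    limit of points of [A], closedness. *)
Let A_local p U phi : local_defining_function Omega p U phi -> Sigma p -> H p != 0 ->
  exists2 r, 0 < r & forall x y, Sigma x -> Sigma y -> enorm (x - p) < r ->
    enorm (y - p) < r -> A x -> A y.
Proof.
move=> chart Sp H0; have [r r0 hr] := umbilic_constant_near chart Sp H0.
exists r => // x y Sx Sy xr yr [_ Hx [W [psi [chart' ux]]]].
have [Ux e1 e2] := hr x Sx xr; have [Uy e3 e4] := hr y Sy yr.
rewrite -(unit_gradient_indep (chart_recenter chart Ux) chart' Sx) in ux.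
have kE : H p / m%:R = kappa := etrans (esym e1) Hx.
split; [exact: Sy|exact: etrans e3 kE|].
exists U, phi; split; first exact: chart_recenter chart Uy.
move: e2; rewrite -e4 kE ux; move: (unit_gradient phi y) => u e.
rewrite -[LHS](subrK (kappa *: y)) -e !scalerBr.
by rewrite (addrAC (kappa *: x)) subrr add0r addrC.
Qed.

Let A_open p : A p -> exists2 r, 0 < r & forall x, Sigma x -> enorm (x - p) < r -> A x.
Proof.
move=> Ap; have [Sp Hp [U [phi [chart _]]]] := Ap.
have [r r0 hr] := A_local chart Sp (HA Hp); exists r; first exact: r0.
have pp : enorm (p - p) < r by rewrite subrr enorm0.
by move=> x Sx xp; exact: (hr p x Sp Sx pp xp Ap).
Qed.

Let A_closed : closed A.
Proof.
apply/closed_enormP => p hp.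
have Sp : Sigma p.
  by apply/(closed_enormP Sigma).1; [exact: boundary_closed|move=> r /hp[x [Sx _ _] xp]; exists x].
have [U [phi chart]] := Omega_smooth Sp.
have Hp : H p / m%:R = kappa.
  have m0 : (0 : R) < m%:R by rewrite ltr0n.
  apply/eqP; rewrite -subr_eq0 -normr_le0; apply/ler_addgt0Pr => e e0; rewrite add0r.
  have [d d0 hd] := mean_curvature_continuous_at chart Sp (mulr_gt0 e0 m0).
  have [x [Sx <- _] xp] := hp d d0; have := hd x Sx xp; move: (H p) (H x) => h h'.
  by rewrite -mulrBl normrM normfV (gtr0_norm m0) ler_pdivrMr// distrC => /ltW.
have [r r0 hr] := A_local chart Sp (HA Hp).
have [x Ax xp] := hp r r0; have [Sx _ _] := Ax.
have pp : enorm (p - p) < r by rewrite subrr enorm0.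
exact: (hr x p Sx Sp xp pp Ax).
Qed.

(** A sphere point [z] near [p] is matched with the boundary point [x] having the same tangential
    projection. Since [x] is in [A], it lies on the sphere too; the bound [kappa^-1] keeps both in
    the open hemisphere around [p], where the projection determines the point. *)
Let A_relatively_open p : A p -> exists2 d, 0 < d & forall z,
  enorm (z - c) = kappa^-1 -> enorm (z - p) < d -> A z.
Proof.
move=> Ap; have [Sp Hp [U [phi [chart up]]]] := Ap.
have nu1 : enorm (unit_gradient phi p) = 1.
  by have [_ Up _ g0 _] := chart; exact: enorm_unit_gradient (g0 _ Up).
have [e ee en] := orthonormal_completion nu1.
have [r r0 hr] := A_open Ap; have k0 : 0 < kappa^-1 by rewrite invr_gt0.
have r10 : 0 < Num.min r kappa^-1 by rewrite lt_min r0.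
have [d d0 hd] := patch_surjective chart Sp ee en r10.
exists (Num.min d kappa^-1); first by rewrite lt_min d0.
have pos x : enorm (x - p) < kappa^-1 -> 0 < dot (x - c) (unit_gradient phi p).
  move=> xp; rewrite -(subrK p x) -addrA dotDl.
  have -> : dot (p - c) (unit_gradient phi p) = kappa^-1.
    rewrite -(mulKf (lt0r_neq0 kappa_gt0) (dot _ _)) -(dotZl kappa) -up.
    by rewrite (dot_nu_nu chart) mulr1.
  have := ler_abs_dot (x - p) (unit_gradient phi p); rewrite nu1 mulr1 ler_norml => /andP[h _].
  by rewrite -ltrBlDr sub0r; apply: lt_le_trans h; rewrite ltrN2.
move=> z zc; rewrite lt_min => /andP[zd zk].
have [x [Sx]] := hd ((z - p) *m e^T) (le_lt_trans (enorm_proj_le _ ee) zd).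
rewrite lt_min => /andP[xr xk] xz; have Ax := hr x Sx xr.
suff -> : z = x by [].
have xe : (x - c) *m e^T = (z - c) *m e^T.
  rewrite -(subrK p x) -(subrK p z) -(addrA (x - p)) -(addrA (z - p)).
  by rewrite (mulmxDl (x - p)) (mulmxDl (z - p)) xz.
have xn : dot (x - c) (unit_gradient phi p) = dot (z - c) (unit_gradient phi p).
  apply/eqP; rewrite -(@eqrXn2 _ 2)// ?(ltW (pos _ _))//; apply/eqP.
  apply: (@addrI _ (enorm ((z - c) *m e^T) ^+ 2)).
  rewrite -[in LHS]xe -(frame_pythagoras (x - c) ee en nu1).
  by rewrite -(frame_pythagoras (z - c) ee en nu1) zc A_sphere.
apply: (@addIr _ (- c)).
by rewrite (frame_decomp (z - c) ee en nu1) (frame_decomp (x - c) ee en nu1) xe xn.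
Qed.

(** In place of connectedness: the point of the compact set [A] that is farthest in the direction
    [z - c] is, by relative openness, a local maximum on the sphere, hence equal to [z]. *)
Let A_full : A !=set0 -> forall z, enorm (z - c) = kappa^-1 -> A z.
Proof.
move=> A0 z zc; have k0 : 0 < kappa^-1 by rewrite invr_gt0.
have cA : compact A.
  apply: (subclosed_compact A_closed (boundary_compact Omega_domain)).
  by move=> x [].
have [a Aa amax] := @EVT_max_rV _ _ (dot (z - c)) _ A0 cA
  (continuous_subspaceT (@dot_continuous _ _ (z - c))).
rewrite inE in Aa; have [d d0 hd] := A_relatively_open Aa.
have unit x : enorm (x - c) = kappa^-1 -> enorm (kappa *: (x - c)) = 1.
  by move=> xc; rewrite enormZ xc gtr0_norm// mulfV// gt_eqF.
have kd : 0 < kappa * d by rewrite mulr_gt0.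
have hmax y : enorm y = 1 -> enorm (y - kappa *: (a - c)) < kappa * d ->
    dot y (kappa *: (z - c)) <= dot (kappa *: (a - c)) (kappa *: (z - c)).
  move=> y1 ya; pose x := c + kappa^-1 *: y.
  have xc : x - c = kappa^-1 *: y by rewrite /x addrAC subrr add0r.
  have yx : y = kappa *: (x - c) by rewrite xc scalerA mulfV ?scale1r// gt_eqF.
  have Ax : A x.
    apply: hd; first by rewrite xc enormZ y1 mulr1 gtr0_norm.
    move: ya; rewrite yx -scalerBr enormZ (gtr0_norm kappa_gt0) ltr_pM2l//.
    by rewrite opprB addrA subrK.
  have : dot (z - c) x <= dot (z - c) a by apply: amax; rewrite inE.
  move=> h; rewrite yx !dotZl !dotZr !ler_pM2l// dotC (dotC (a - c)).
  by rewrite !(dotBr (z - c)) lerD2r.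
have := sphere_local_max m_gt0 (unit _ (A_sphere Aa)) (unit _ zc) kd hmax.
move/(scalerI (lt0r_neq0 kappa_gt0))/(@addIr _ (- c)) => <-.
exact: Aa.
Qed.

Lemma osculating_ball : A !=set0 -> Omega = eball c kappa^-1.
Proof.
move=> A0; have full := A_full A0.
have k0 : 0 < kappa^-1 by rewrite invr_gt0.
have sphere w : enorm w = 1 -> A (c + kappa^-1 *: w).
  move=> w1; apply: full.
  by rewrite addrAC subrr add0r enormZ w1 mulr1 gtr0_norm.
have Osub : Omega `<=` eball c kappa^-1.
  move=> x Ox; rewrite /eball/= ltNge; apply/negP => xc.
  have x0 : 0 < enorm (x - c) := lt_le_trans k0 xc.
  have [w w1 xw] : exists2 w, enorm w = 1 & x - c = enorm (x - c) *: w.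
    exists ((enorm (x - c))^-1 *: (x - c)); first by rewrite enormZ gtr0_norm ?invr_gt0// mulVf// gt_eqF.
    by rewrite scalerA mulfV ?scale1r// gt_eqF.
  have [Sq Hq [U [phi [chart uq]]]] := sphere w w1.
  have [Hq0|[[_ sup] _ _]] := umb chart Sq; first by have := HA Hq; rewrite Hq0 eqxx.
  have uw : unit_gradient phi (c + kappa^-1 *: w) = w.
    by rewrite uq addrAC subrr add0r scalerA mulfV ?scale1r// gt_eqF.
  have := sup x Ox; rewrite uw opprD addrA dotBl xw !dotZl -sqr_enorm w1 expr1n !mulr1.
  rewrite subr_le0 => xle; apply: (boundary_notin Omega_domain Sq).
  have e : enorm (x - c) = kappa^-1 by apply/eqP; rewrite eq_le xle.
  by rewrite -e -xw addrC subrK.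
have Ssub p : Sigma p -> enorm (p - c) <= kappa^-1.
  move=> [/closure_enormP Cp _]; apply/ler_addgt0Pr => e e0.
  have [x /Osub xc xp] := Cp e e0; apply: le_trans (ler_enorm_dist x _ _) _.
  by rewrite addrC lerD// ltW// enormB.
pose K := Sigma `&` ~` A.
have K_ball p : K p -> enorm (p - c) < kappa^-1.
  move=> [Sp nA]; rewrite lt_neqAle Ssub// andbT; apply/eqP => pc.
  exact: nA (full p pc).
have K_open p : K p -> exists2 r, 0 < r & forall x, Sigma x -> enorm (x - p) < r -> K x.
  move=> Kp; have pc := K_ball p Kp.
  exists (kappa^-1 - enorm (p - c)); first by rewrite subr_gt0.
  move=> x Sx xp; split=> // /A_sphere xc.
  have := ler_enorm_dist p x c; rewrite xc leNgt => /negP; apply.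
  by rewrite -ltrBrDr.
have K_H p : K p -> H p = 0.
  move=> Kp; have [Sp _] := Kp; have [U [phi chart]] := Omega_smooth Sp.
  (* At a contact point with normal [w], the sphere point [c + kappa^-1 *: w] lies in the closure of
     [Omega], hence below the supporting plane at [p]; this forces [enorm (p - c)] to be at least
     [kappa^-1]. *)
  have [//|[sup _ _]] := umb chart Sp; have [w1 _] := sup.
  have [[Cq _] _ _] := sphere _ w1.
  have := supports_closure sup Cq; rewrite addrAC dotDl (dotZl kappa^-1) -sqr_enorm w1 expr1n mulr1.
  have := ler_abs_dot (p - c) (unit_gradient phi p); rewrite w1 mulr1 ler_norml => /andP[_ h1].
  rewrite -opprB dotNl addrC subr_le0 => h2.
  by have := lt_le_trans (K_ball p Kp) (le_trans h2 h1); rewrite ltxx.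
have S_A p : Sigma p -> A p.
  move=> Sp; apply: contrapT => nA.
  have K0 : K !=set0 by exists p.
  have cK : compact K.
    have clK : closed K.
      apply/closed_enormP => q hq.
      have Sq : Sigma q.
        by apply/(closed_enormP Sigma).1; [exact: boundary_closed|move=> r /hq[x [Sx _] xq]; exists x].
      split=> // /A_open[r r0 hr]; have [x [Sx nx] xq] := hq r r0.
      by apply: nx; exact: hr.
    apply: (subclosed_compact clK (boundary_compact Omega_domain)).
    by move=> x [].
  have KS : K `<=` Sigma by move=> x [].
  have [q Kq] := exists_nonzero_curvature m_gt0 Omega_smooth cK K0 KS K_open.
  by rewrite K_H// eqxx.
apply/seteqP; split=> // y yc; apply: contrapT => nOy.
have [oO _ [x0 Ox0] _] := Omega_domain.
pose g t := x0 + t *: (y - x0).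
(* The open ball contains no boundary point, so the indicator of [Omega] is locally constant along
   the segment from [x0] to [y]; being constant, it cannot pass from 1 to 0. *)
pose f (t : R) : R := `[< Omega (g t) >]%:R.
have segc t : 0 <= t <= 1 -> eball c kappa^-1 (g t).
  by move=> t01; apply: eball_convex => //; exact: Osub.
have L0 : 0 < enorm (y - x0) + 1 by rewrite ltr_wpDl ?enorm_ge0.
have gd s t : enorm (g s - g t) <= `|s - t| * (enorm (y - x0) + 1).
  rewrite /g opprD addrACA subrr add0r -scalerBl enormZ ler_wpM2l//.
  by rewrite lerDl.
have := @small_increments_const R f; rewrite /f /g scale1r scale0r addr0 subrKC.
rewrite (asboolT Ox0) (asboolF nOy) => h.
suff /h/eqP : forall t, 0 <= t <= 1 -> forall e, 0 < e -> exists2 d, 0 < d &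
    forall s, 0 <= s <= 1 -> `|s - t| < d -> `|f s - f t| <= e * `|s - t|.
  by rewrite eq_sym oner_eq0.
move=> t t01 e e0.
suff [d d0 hd] : exists2 d, 0 < d & forall x, enorm (x - g t) < d -> Omega x <-> Omega (g t).
  exists (d / (enorm (y - x0) + 1)); first by rewrite divr_gt0.
  move=> s _; rewrite ltr_pdivlMr// => st.
  have eqO := hd (g s) (le_lt_trans (gd s t) st).
  have -> : f s = f t by rewrite /f (asbool_equiv_eq eqO).
  by rewrite subrr normr0 mulr_ge0// ltW.
have [Ot|nOt] := pselect (Omega (g t)).
  move/open_enormP: oO => /(_ _ Ot)[d d0 hd]; exists d => // x xt.
  by split=> // _; exact: hd.
have nC : ~ closure Omega (g t).
  move=> Ct; have St : Sigma (g t).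
    by split=> //; move=> /nbhs_singleton.
  have := segc t t01; rewrite /eball/= (A_sphere (S_A _ St)).
  by rewrite ltxx.
apply: contrapT => nd; apply: nC; apply/closure_enormP => r r0.
apply: contrapT => nx; apply: nd; exists r => // x xt; split=> // Ox.
by exfalso; apply: nx; exists x.
Qed.

End rigidity.

(** * The equality case for balls *)

Section balls.
Context {R : realType} {m : nat}.
Local Notation V := 'rV[R]_m.+1.
Local Notation mu := (area R m.+1).
Variables (c : V) (r : R).
Hypothesis m_gt0 : (0 < m)%N.
Hypothesis r_gt0 : 0 < r.

Lemma boundary_eball : boundary (eball c r) = [set x | enorm (x - c) = r].
Proof.
have oB : (eball c r)° = eball c r by apply/interior_id; exact: open_eball.
apply/seteqP; split=> p; rewrite /boundary oB.
  move=> [/closure_enormP Cp nB]; apply/eqP; rewrite eq_le; apply/andP; split.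
    apply/ler_addgt0Pr => e e0; have [x xc xp] := Cp e e0.
    apply: le_trans (ler_enorm_dist x _ _) _.
    by rewrite addrC; apply: lerD; apply: ltW; rewrite // enormB.
  by rewrite leNgt; apply/negP.
move=> /= pc; split; last by rewrite /eball/= pc ltxx.
apply/closure_enormP => e e0.
(* Moving [p] towards the centre by the fraction [t] covers the distance [t * r], which is at most
   [e / 2]. *)
pose t := Num.min 1 (e / (2 * r)).
have r20 : 0 < 2 * r by rewrite mulr_gt0.
have t0 : 0 < t by rewrite lt_min ltr01 divr_gt0.
have t1 : t <= 1 by rewrite ge_min lexx.
exists (p - t *: (p - c)).
  rewrite /eball/=; have -> : p - t *: (p - c) - c = (1 - t) *: (p - c).
    by rewrite addrAC [RHS]scalerBl scale1r.
  rewrite enormZ pc ger0_norm ?subr_ge0//.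
  by rewrite gtr_pMl// ltrBlDr ltrDl.
rewrite addrAC subrr add0r enormN enormZ pc (gtr0_norm t0).
have : t <= e / (2 * r) by rewrite ge_min lexx orbT.
rewrite ler_pdivlMr// => h; apply: (lt_le_trans _ h).
by rewrite ltr_pM2l// mulrC ltr_pMr// ltr1n.
Qed.

Lemma eball_unit_gradient U phi p : local_defining_function (eball c r) p U phi ->
  boundary (eball c r) p -> unit_gradient phi p = r^-1 *: (p - c).
Proof.
move=> chart bp; have pc : enorm (p - c) = r by move: bp; rewrite boundary_eball.
apply/esym/(support_normal chart bp r_gt0).
  by rewrite enormZ pc gtr0_norm ?invr_gt0// mulVf// gt_eqF.
move=> x xc _; rewrite dotZr pmulr_rle0 ?invr_gt0//.
have -> : x - p = (x - c) - (p - c) by rewrite opprB addrA subrK.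
rewrite dotBl -sqr_enorm pc subr_le0; apply: le_trans (ler_dot _ _) _.
by rewrite pc expr2 ler_wpM2r ?(ltW r_gt0)// ltW.
Qed.

(** Whatever the chart, the normal agrees on the boundary with the affine map [r^-1 *: (x - c)], so
    its tangential derivative is [r^-1] times the identity. *)
Lemma mean_curvature_eball U phi p : local_defining_function (eball c r) p U phi ->
  boundary (eball c r) p -> mean_curvature (eball c r) p = m%:R / r.
Proof.
move=> chart bp; have [e [k [ee en ek]]] := curvature_frame chart.
have df : sdiff (fun x : V => r^-1 *: (x - c)) p (r^-1%:M).
  move=> eps eps0; exists 1 => // x y _ _.
  rewrite mul_mx_scalar -scalerBr opprB addrA subrK subrr enorm0.
  by rewrite mulr_ge0 ?enorm_ge0// ltW.
have ki i : k ord0 i = r^-1.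
  have := normal_tangential_derivative chart bp df r_gt0 _ (en i).
  rewrite ek mul_mx_scalar => /(_ _)/esym h.
  have : dot (k ord0 i *: row i e) (row i e) = dot (r^-1 *: row i e) (row i e).
    by rewrite h// => x U' psi bx _ chart'; rewrite (eball_unit_gradient chart' bx).
  by rewrite !dotZl dot_rows// eqxx !mulr1.
rewrite (mean_curvatureE chart bp) -(curvature_sum chart ee en ek).
by under eq_bigr do rewrite ki; rewrite sumr_const card_ord mulr_natl.
Qed.

(** The integrand is the constant [r^-1 ^+ m], and scaling and translation give the sphere of radius
    [r] the area [r ^+ m] times that of the unit sphere. *)
Lemma willmore_eball : smooth_boundary (eball c r) ->
  mu unit_sphere = (\int[mu]_(p in boundary (eball c r)) (willmore (eball c r) p)%:E)%E.
Proof.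
move=> smooth.
have mS : measurable (boundary (eball c r) : set (caratheodory_type (@hausdorff R m.+1 m))).
  exact: closed_caratheodory (@boundary_closed R m (eball c r)).
have cst_willmore p : boundary (eball c r) p -> willmore (eball c r) p = r^-1 ^+ m.
  move=> bp; have [U [phi chart]] := smooth p bp.
  rewrite /willmore (mean_curvature_eball chart bp) ger0_norm ?divr_ge0 ?(ltW r_gt0)//.
  by rewrite mulrAC mulfV ?mul1r// pnatr_eq0 -lt0n.
rewrite (eq_integral (cst (r^-1 ^+ m)%:E)); last first.
  by move=> p; rewrite inE => bp; rewrite cst_willmore.
rewrite (integral_cst mu mS).
have areaE : hausdorff m (boundary (eball c r)) =
    ((r ^+ m)%:E * hausdorff m (@unit_sphere R m.+1))%E.
  rewrite -(hausdorff_scale m _ r_gt0) -[RHS](hausdorff_translate m _ c).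
  congr (hausdorff m _).
  rewrite boundary_eball; apply/seteqP; split=> [x /= xc|_ [_ [x /= x1 <-] <-]/=].
    exists (r *: (r^-1 *: (x - c))); last by rewrite scalerA mulfV ?scale1r ?subrK// gt_eqF.
    exists (r^-1 *: (x - c)) => //.
    by rewrite /unit_sphere/= enormZ xc gtr0_norm ?invr_gt0// mulVf// gt_eqF.
  by rewrite addrK enormZ x1 mulr1 gtr0_norm.
apply: (@etrans _ _ ((r^-1 ^+ m)%:E * hausdorff m (boundary (eball c r)))%E _ _ erefl).
rewrite areaE muleA -EFinM -exprMn.
by rewrite mulVf ?gt_eqF// expr1n mul1e.
Qed.

End balls.

Section equality.
Context {R : realType} {m : nat}.
Local Notation V := 'rV[R]_m.+1.
Local Notation mu := (area R m.+1).
Variable Omega : set V.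
Hypothesis m_gt1 : (1 < m)%N.
Hypothesis Omega_domain : bounded_domain Omega.
Hypothesis Omega_smooth : smooth_boundary Omega.
Local Notation Sigma := (boundary Omega).
Local Notation H := (mean_curvature Omega).

Let m_gt0 : (0 < m)%N. Proof. exact: ltnW. Qed.

Lemma willmore_equality_ball :
  mu unit_sphere = (\int[mu]_(p in Sigma) (willmore Omega p)%:E)%E ->
  exists c r, 0 < r /\ Omega = eball c r.
Proof.
move=> eqW; have umb := willmore_equality m_gt0 Omega_domain Omega_smooth eqW.
have [p0 Sp0] : Sigma !=set0.
  have u1 : @unit_sphere R m.+1 (delta_mx ord0 ord0) by exact: enorm_delta.
  by move: u1; rewrite -(supports_sphere Omega_domain) => -[p Sp _]; exists p.
have SS : Sigma `<=` Sigma by [].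
have SO p : Sigma p -> exists2 r : R, 0 < r & forall x, Sigma x -> enorm (x - p) < r -> Sigma x.
  by exists 1.
have [p Sp H0] := exists_nonzero_curvature m_gt0 Omega_smooth
  (boundary_compact Omega_domain) (ex_intro _ p0 Sp0) SS SO.
have [U [phi chart]] := Omega_smooth Sp.
have [Hp|[_ Hp _]] := umb U phi p chart Sp; first by rewrite Hp eqxx in H0.
have k0 : 0 < H p / m%:R by rewrite divr_gt0// ltr0n.
(* The radius is the inverse of the common principal curvature at [p], and the centre lies at that
   distance along the inner normal. *)
exists (p - (H p / m%:R)^-1 *: unit_gradient phi p), (H p / m%:R)^-1; split; first by rewrite invr_gt0.
apply: (osculating_ball m_gt1 Omega_domain Omega_smooth umb k0).
exists p; split; [exact: Sp|by []|exists U, phi; split; first exact: chart].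
by rewrite opprB addrC subrK scalerA mulfV ?scale1r// gt_eqF.
Qed.

End equality.

Unset Implicit Arguments.

Theorem corollary1p2 (R : realType) (n : nat) (Omega : set 'rV[R]_n)
    (n_ge3 : (3 <= n)%N)
    (Omega_domain : bounded_domain Omega)
    (Omega_smooth : smooth_boundary Omega) :
  let W := (\int[area R n]_(p in boundary Omega)
             ((`|mean_curvature Omega p| / n.-1%:R) ^+ n.-1)%:E)%E in
  (area R n unit_sphere <= W)%E /\
  (area R n unit_sphere = W <->
     exists (c : 'rV[R]_n) (r : R), 0 < r /\ Omega = eball c r).
Proof.
(* With [n = m.+1], [n.-1] computes to [m] and [3 <= n] becomes [1 < m]. *)
case: n Omega n_ge3 Omega_domain Omega_smooth => // m Omega m_gt1 domain smooth W.
have m_gt0 : (0 < m)%N by exact: ltnW.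
split; first exact: (willmore_inequality m_gt0 domain smooth).
split; first exact: (willmore_equality_ball m_gt1 domain smooth).
move=> [c [r [r0 OE]]]; rewrite /W; move: smooth; rewrite OE.
exact: (willmore_eball m_gt0 r0).
Qed.
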